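(* Let $n\ge 1$ and let $\mathbf{p}=(\mathbf{p}_1,\dots,\mathbf{p}_N)$ and $\mathbf{q}=(\mathbf{q}_1,\dots,\mathbf{q}_N)$ be configurations of $N$ points in $\mathbb{E}^n$ such that $|\mathbf{p}_i-\mathbf{p}_j|\le|\mathbf{q}_i-\mathbf{q}_j|$ for all $1\le i<j\le N$. Then there exists $r_0>0$ such that for every $r\ge r_0$ $$\mathrm{Vol}_n\Big[\bigcup_{i=1}^N B_n(\mathbf{p}_i,r)\Big]\le \mathrm{Vol}_n\Big[\bigcup_{i=1}^N B_n(\mathbf{q}_i,r)\Big]\quad\text{and}\quad \mathrm{Vol}_n\Big[\bigcap_{i=1}^N B_n(\mathbf{p}_i,r)\Big]\ge \mathrm{Vol}_n\Big[\bigcap_{i=1}^N B_n(\mathbf{q}_i,r)\Big].$$ Moreover, if $\mathbf{p}$ and $\mathbf{q}$ are not congruent (i.e. there is no isometry of $\mathbb{E}^n$ mapping $\mathbf{p}_i$ to $\mathbf{q}_i$ for all $i$), then both inequalities are strict for every $r\ge r_0$.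
   Context: $|\cdot|$ is the Euclidean norm, $B_n(\mathbf{x},r)$ denotes the closed $n$-dimensional ball of radius $r$ centered at $\mathbf{x}\in\mathbb{E}^n$, and $\mathrm{Vol}_n$ is $n$-dimensional volume (Lebesgue measure). *)

(* Defs.v *)
From Stdlib Require Import Reals Lra ClassicalEpsilon.
Open Scope R_scope.

(* Points of E^n are modelled as functions nat -> R; only the coordinates
   0..n-1 are ever used (all notions below depend only on them). *)
Definition point := nat -> R.

Fixpoint sqdist (n : nat) (x y : point) : R :=
  match n with
  | O => 0
  | S m => sqdist m x y + (x m - y m) ^ 2
  end.

Definition edist (n : nat) (x y : point) : R := sqrt (sqdist n x y).

Definition ball (n : nat) (c : point) (r : R) : point -> Prop :=
  fun x => edist n x c <= r.

Definition union_balls (n N : nat) (p : nat -> point) (r : R) : point -> Prop :=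
  fun x => exists i, (i < N)%nat /\ ball n (p i) r x.
Definition inter_balls (n N : nat) (p : nat -> point) (r : R) : point -> Prop :=
  fun x => forall i, (i < N)%nat -> ball n (p i) r x.

Fixpoint box_vol (n : nat) (a b : point) : R :=
  match n with
  | O => 1
  | S m => box_vol m a b * (b m - a m)
  end.

Definition cover_value (n : nat) (S : point -> Prop) (s : R) : Prop :=
  exists a b : nat -> point,
    (forall j k, (k < n)%nat -> a j k <= b j k) /\
    (forall x, S x -> exists j, forall k, (k < n)%nat -> a j k <= x k <= b j k) /\
    Un_cv (fun m => sum_f_R0 (fun j => box_vol n (a j) (b j)) m) s.

Definition is_inf (E : R -> Prop) (v : R) : Prop :=
  (forall s, E s -> v <= s) /\ (forall w, (forall s, E s -> w <= s) -> w <= v).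

(* Lebesgue (outer) measure Vol_n: infimum of total volumes of countable box
   covers.  It coincides with Lebesgue measure on measurable sets, in
   particular on finite unions/intersections of closed balls. *)
Definition Vol (n : nat) (S : point -> Prop) : R :=
  epsilon (inhabits 0) (fun v => is_inf (cover_value n S) v).

Definition congruent (n N : nat) (p q : nat -> point) : Prop :=
  exists f : point -> point,
    (forall x y, edist n (f x) (f y) = edist n x y) /\
    (forall i k, (i < N)%nat -> (k < n)%nat -> f (p i) k = q i k).

(* Main.v *)
(** Up to an error of relative order [1/r^2], the union of the balls of radius [r] about the points [p i] is [r] times
    the unit ball of the 1-homogeneous function [|x| - (1/r) * max_i <p i, x>], and the intersection has the same
    description with [- p i] and [- 1/r]. The integral of a radial profile of such a function is a fixed multiple of
    the volume of its unit ball, and differentiating at [1/r = 0] gives the mean width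
    [M(p)], the integral of [max_i <p i, x>] against a radial weight. So noncongruent configurations are compared
    through the strict inequality [M(p) < M(q)].

    That inequality is Sudakov-Fernique interpolation along [z_i(t) = (cos t * p i, sin t * q i)] in [R^(2n)] with a
    compactly supported weight in place of the Gaussian: for a soft maximum with parameter [b] the derivative is
    a positive multiple of [b * sum_ij (|q i - q j|^2 - |p i - p j|^2) * I_ij], where [I_ij >= 0] integrates the product of
    the [i]-th and [j]-th soft weights. It stays bounded below as [b] grows, because some exposed point [i]
    can be abandoned in a direction in which it competes only with points [j] whose distance to it really increases.

    If all distances agree, a product of reflections carries [p] to [q], and reflections preserve the integral by the
    uniqueness of a translation invariant integral. Integrals are iterated one-dimensional integrals of continuous
    compactly supported functions; they are tied to outer measure by slicing and by Dini's theorem. *)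
From Stdlib Require Import Reals Lra Lia Arith List Classical ClassicalEpsilon FunctionalExtensionality PropExtensionality.
From Coquelicot Require Import Coquelicot.
Require Import Defs.
Import ListNotations.
Open Scope R_scope.

(** The obstacle is strictness. A strict gap for each soft maximum could be lost in the limit of
    large [b], so the increase along the interpolation needs a lower bound independent of [b]; the
    factor [b] in front of the derivative pays for the [I_ij], of which only order [1/b] is
    guaranteed. Differentiability is the reason for the soft maximum, bounded support the reason for
    giving up the Gaussian: with [D] the positive part of [R0^2 - |x|^2], the weights [D^2] and
    [4 D] satisfy [grad (D^2) = - 4 D x], so Gaussian integration by parts survives as an exchange
    of one weight for the other. Integrating out half of the coordinates turns [4 D] into the radial
    weight of the mean width, and minus a primitive of it is the radial profile whose derivative
    produces [max_i <p i, x>]. After rescaling by [r] the gap between the volumes has order [1/r],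
    so it absorbs the [1/r^2] error of replacing balls by sublevel sets. The intersection needs no
    second argument: the points [- p i] have the same mutual distances, and the sign of [1/r]
    reverses the comparison. *)

(** * Finite sums of reals *)

Fixpoint rsum (n : nat) (f : nat -> R) : R :=
  match n with O => 0 | S m => rsum m f + f m end.

Lemma rsum_ext n f g : (forall k, (k < n)%nat -> f k = g k) -> rsum n f = rsum n g.
Proof.
  induction n as [|n IH]; simpl; intros H; [reflexivity|].
  rewrite IH by (intros; apply H; lia). rewrite H by lia. reflexivity.
Qed.

Lemma rsum_plus n f g : rsum n (fun k => f k + g k) = rsum n f + rsum n g.
Proof. induction n as [|n IH]; simpl; lra. Qed.

Lemma rsum_minus n f g : rsum n (fun k => f k - g k) = rsum n f - rsum n g.
Proof. induction n as [|n IH]; simpl; lra. Qed.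

Lemma rsum_scal n c f : rsum n (fun k => c * f k) = c * rsum n f.
Proof. induction n as [|n IH]; simpl; [ring|rewrite IH; ring]. Qed.

Lemma rsum_le n f g : (forall k, (k < n)%nat -> f k <= g k) -> rsum n f <= rsum n g.
Proof.
  induction n as [|n IH]; simpl; intros H; [lra|].
  apply Rplus_le_compat; [apply IH; intros; apply H; lia | apply H; lia].
Qed.

Lemma rsum_0 n : rsum n (fun _ => 0) = 0.
Proof. induction n; simpl; lra. Qed.

Lemma rsum_const n c : rsum n (fun _ => c) = INR n * c.
Proof. induction n as [|n IH]; [simpl; ring|]. rewrite S_INR; simpl; rewrite IH; ring. Qed.

Lemma rsum_ge0 n f : (forall k, (k < n)%nat -> 0 <= f k) -> 0 <= rsum n f.
Proof. intros H. rewrite <- (rsum_0 n). now apply rsum_le. Qed.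

Lemma rsum_term n f k : (forall k, (k < n)%nat -> 0 <= f k) -> (k < n)%nat -> f k <= rsum n f.
Proof.
  induction n as [|n IH]; intros H Hk; [lia|]. simpl.
  assert (0 <= rsum n f) by (apply rsum_ge0; intros; apply H; lia).
  destruct (Nat.eq_dec k n) as [->|Hn]; [lra|].
  specialize (IH (fun k Hk => H k (Nat.lt_lt_succ_r _ _ Hk)) ltac:(lia)).
  assert (0 <= f n) by (apply H; lia). lra.
Qed.

Lemma rsum_swap n m f :
  rsum n (fun i => rsum m (fun j => f i j)) = rsum m (fun j => rsum n (fun i => f i j)).
Proof.
  induction n as [|n IH]; simpl; [now rewrite rsum_0|].
  now rewrite IH, rsum_plus.
Qed.

Lemma rsum_app n m f : rsum (n + m) f = rsum n f + rsum m (fun k => f (n + k)%nat).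
Proof.
  induction m as [|m IH]; [rewrite Nat.add_0_r; simpl; ring|].
  rewrite Nat.add_succ_r; simpl; rewrite IH; ring.
Qed.

Lemma rsum_Rabs n f : Rabs (rsum n f) <= rsum n (fun k => Rabs (f k)).
Proof.
  induction n as [|n IH]; simpl; [rewrite Rabs_R0; lra|].
  eapply Rle_trans; [apply Rabs_triang|]; lra.
Qed.

Lemma rsum_mult_r n c f : rsum n (fun k => f k * c) = rsum n f * c.
Proof. induction n as [|n IH]; simpl; [ring|rewrite IH; ring]. Qed.

(** * Continuity for pseudo-distances *)

(** Only pseudo-distances are available on points: the coordinates beyond the dimension are ignored.
    Nothing but [d x x = 0] is ever needed. *)

Definition cont {T : Type} (d : T -> T -> R) (f : T -> R) : Prop :=
  forall x eps, 0 < eps -> exists del, 0 < del /\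
    forall y, d x y < del -> Rabs (f y - f x) < eps.

Definition dR (s t : R) : R := Rabs (t - s).

Definition dprod {A B : Type} (d : A -> A -> R) (e : B -> B -> R) (x y : A * B) : R :=
  Rmax (d (fst x) (fst y)) (e (snd x) (snd y)).

Fixpoint dpt (n : nat) (x y : point) : R :=
  match n with O => 0 | S m => Rmax (dpt m x y) (Rabs (y m - x m)) end.

Lemma dR_refl s : dR s s = 0.
Proof. unfold dR. rewrite Rminus_diag. apply Rabs_R0. Qed.

Lemma dpt_refl n x : dpt n x x = 0.
Proof.
  induction n as [|n IH]; simpl; [reflexivity|].
  rewrite IH, Rminus_diag, Rabs_R0. apply Rmax_left; lra.
Qed.

Lemma dprod_refl {A B} (d : A -> A -> R) (e : B -> B -> R) :
  (forall x, d x x = 0) -> (forall x, e x x = 0) -> forall p, dprod d e p p = 0.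
Proof. intros Hd He [x y]; unfold dprod; simpl; rewrite Hd, He; apply Rmax_left; lra. Qed.

Lemma dpt_ge0 n x y : 0 <= dpt n x y.
Proof. induction n; simpl; [lra|]. eapply Rle_trans; [|apply Rmax_l]; auto. Qed.

Lemma dpt_coord n x y k : (k < n)%nat -> Rabs (y k - x k) <= dpt n x y.
Proof.
  induction n as [|n IH]; intros H; [lia|]; simpl.
  destruct (Nat.eq_dec k n) as [->|]; [apply Rmax_r|].
  eapply Rle_trans; [apply IH; lia|apply Rmax_l].
Qed.

Lemma dpt_ext n x y x' y' :
  (forall k, (k < n)%nat -> x k = x' k) -> (forall k, (k < n)%nat -> y k = y' k) ->
  dpt n x y = dpt n x' y'.
Proof.
  induction n as [|n IH]; intros H H'; simpl; [reflexivity|].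
  rewrite IH, H, H' by (intros; try apply H; try apply H'; lia). reflexivity.
Qed.

Lemma dpt_eq0 n x y : (forall k, (k < n)%nat -> x k = y k) -> dpt n x y = 0.
Proof.
  intros H. rewrite (dpt_ext n x y y y) by auto. apply dpt_refl.
Qed.

Section ContClosure.
Context {T : Type} (d : T -> T -> R).

Lemma cont_const c : cont d (fun _ => c).
Proof. intros x e He; exists 1; split; [lra|]; intros; rewrite Rminus_diag, Rabs_R0; lra. Qed.

Lemma cont_comp f (phi : R -> R) :
  (forall x, continuity_pt phi (f x)) -> cont d f -> cont d (fun x => phi (f x)).
Proof.
  intros Hphi Hf x e He.
  destruct (Hphi x e He) as [a [Ha H]].
  destruct (Hf x a Ha) as [del [Hdel H']].
  exists del; split; [assumption|]. intros y Hy.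
  destruct (Req_dec (f y) (f x)) as [->|Hn]; [rewrite Rminus_diag, Rabs_R0; lra|].
  apply (H (f y)). split; [|apply H'; assumption].
  split; [exact I|auto].
Qed.

Lemma cont_plus f g : cont d f -> cont d g -> cont d (fun x => f x + g x).
Proof.
  intros Hf Hg x e He.
  destruct (Hf x (e / 2)) as [a [Ha H]]; [lra|].
  destruct (Hg x (e / 2)) as [b [Hb H']]; [lra|].
  exists (Rmin a b); split; [apply Rmin_pos; assumption|]. intros y Hy.
  replace (f y + g y - (f x + g x)) with ((f y - f x) + (g y - g x)) by ring.
  eapply Rle_lt_trans; [apply Rabs_triang|].
  assert (Rabs (f y - f x) < e / 2) by (apply H; eapply Rlt_le_trans; [exact Hy|apply Rmin_l]).
  assert (Rabs (g y - g x) < e / 2) by (apply H'; eapply Rlt_le_trans; [exact Hy|apply Rmin_r]).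
  lra.
Qed.

Lemma cont_opp f : cont d f -> cont d (fun x => - f x).
Proof.
  intros Hf x e He. destruct (Hf x e He) as [a [Ha H]]. exists a; split; auto.
  intros y Hy. replace (- f y - - f x) with (- (f y - f x)) by ring. rewrite Rabs_Ropp; auto.
Qed.

Lemma cont_minus f g : cont d f -> cont d g -> cont d (fun x => f x - g x).
Proof. intros Hf Hg. apply cont_plus; [assumption|apply cont_opp; assumption]. Qed.

Lemma cont_scal c f : cont d f -> cont d (fun x => c * f x).
Proof.
  intros Hf. apply (cont_comp f (fun t => c * t)); [|assumption].
  intros x. reg.
Qed.

(** Polarisation: [4 f g = (f + g)^2 - (f - g)^2], and squares are covered by [cont_comp]. *)
Lemma cont_mult f g : cont d f -> cont d g -> cont d (fun x => f x * g x).
Proof.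
  intros Hf Hg.
  assert (Hsq : forall h, cont d h -> cont d (fun x => h x * h x)).
  { intros h Hh. apply (cont_comp h (fun t => t * t)); [|assumption]. intros x. reg. }
  assert (H : cont d (fun x => /4 * ((f x + g x) * (f x + g x) - (f x - g x) * (f x - g x)))).
  { apply cont_scal, cont_minus; apply Hsq; [apply cont_plus|apply cont_minus]; assumption. }
  intros x e He. destruct (H x e He) as [a [Ha H']]. exists a; split; auto.
  intros y Hy. specialize (H' y Hy).
  replace (f y * g y - f x * g x) with
   (/ 4 * ((f y + g y) * (f y + g y) - (f y - g y) * (f y - g y)) -
       / 4 * ((f x + g x) * (f x + g x) - (f x - g x) * (f x - g x))) by field.
  assumption.
Qed.

Lemma cont_rsum n f : (forall k, (k < n)%nat -> cont d (f k)) -> cont d (fun x => rsum n (fun k => f k x)).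
Proof.
  induction n as [|n IH]; intros H; simpl; [apply cont_const|].
  apply cont_plus; [apply IH; intros; apply H; lia|apply H; lia].
Qed.

Lemma cont_pow f n : cont d f -> cont d (fun x => f x ^ n).
Proof. intros Hf. induction n; simpl; [apply cont_const|now apply cont_mult]. Qed.

Lemma cont_ext f g : (forall x, f x = g x) -> cont d f -> cont d g.
Proof.
  intros E H x e He. destruct (H x e He) as [a [Ha H']]; exists a; split; auto.
  intros y Hy; rewrite <- !E; auto.
Qed.

Lemma cont_Rabs f : cont d f -> cont d (fun x => Rabs (f x)).
Proof. intros H. apply (cont_comp f Rabs); [|assumption]. intros; apply Rcontinuity_abs. Qed.

Lemma Rmax_formula a b : Rmax a b = / 2 * (a + b + Rabs (a - b)).
Proof. unfold Rmax, Rabs. destruct (Rle_dec a b), (Rcase_abs (a - b)); lra. Qed.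

Lemma cont_Rmax f g : cont d f -> cont d g -> cont d (fun x => Rmax (f x) (g x)).
Proof.
  intros Hf Hg. eapply cont_ext; [intros x; symmetry; apply Rmax_formula|].
  apply cont_scal, cont_plus; [now apply cont_plus|now apply cont_Rabs, cont_minus].
Qed.

Lemma Rmin_formula a b : Rmin a b = - Rmax (- a) (- b).
Proof. unfold Rmax, Rmin. destruct (Rle_dec a b), (Rle_dec (- a) (- b)); lra. Qed.

Lemma cont_Rmin f g : cont d f -> cont d g -> cont d (fun x => Rmin (f x) (g x)).
Proof.
  intros Hf Hg. eapply cont_ext; [intros x; symmetry; apply Rmin_formula|].
  apply cont_opp, cont_Rmax; apply cont_opp; assumption.
Qed.

Lemma cont_exp f : cont d f -> cont d (fun x => exp (f x)).
Proof. intros H. apply (cont_comp f exp); [|assumption]. intros; reg. Qed.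

Lemma cont_inv f : (forall x, f x <> 0) -> cont d f -> cont d (fun x => / f x).
Proof.
  intros Hn H. apply (cont_comp f Rinv); [|assumption].
  intros x. apply (continuity_pt_inv (fun t => t)); [reg|apply Hn].
Qed.

Lemma cont_div f g : (forall x, g x <> 0) -> cont d f -> cont d g -> cont d (fun x => f x / g x).
Proof. intros Hn Hf Hg. apply cont_mult; [assumption|now apply cont_inv]. Qed.

Lemma cont_ln f : (forall x, 0 < f x) -> cont d f -> cont d (fun x => ln (f x)).
Proof.
  intros Hn H. apply (cont_comp f ln); [|assumption].
  intros x. apply derivable_continuous_pt. exists (/ f x). apply derivable_pt_lim_ln; auto.
Qed.

Lemma cont_map {U} (e : U -> U -> R) (phi : T -> U) f :
  (forall x eps, 0 < eps -> exists del, 0 < del /\ forall y, d x y < del -> e (phi x) (phi y) < eps) ->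
  cont e f -> cont d (fun x => f (phi x)).
Proof.
  intros Hphi Hf x eps He.
  destruct (Hf (phi x) eps He) as [a [Ha H]].
  destruct (Hphi x a Ha) as [b [Hb H']].
  exists b; split; auto.
Qed.

Lemma cont_map_le {U} (e : U -> U -> R) (phi : T -> U) f :
  (forall x y, e (phi x) (phi y) <= d x y) ->
  cont e f -> cont d (fun x => f (phi x)).
Proof.
  intros Hphi. apply cont_map. intros x eps He. exists eps; split; [assumption|].
  intros y Hy. eapply Rle_lt_trans; eauto.
Qed.

Lemma cont_into_dpt n (phi : T -> point) :
  (forall k, (k < n)%nat -> cont d (fun x => phi x k)) ->
  forall x eps, 0 < eps -> exists del, 0 < del /\ forall y, d x y < del -> dpt n (phi x) (phi y) < eps.
Proof.
  intros H x eps He. induction n as [|n IH]; simpl.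
  - exists 1; split; [lra|]; intros; assumption.
  - destruct IH as [a [Ha H1]]; [intros; apply H; lia|].
    destruct (H n (Nat.lt_succ_diag_r n) x eps He) as [b [Hb H2]].
    exists (Rmin a b); split; [now apply Rmin_pos|].
    intros y Hy. apply Rmax_lub_lt.
    + apply H1; eapply Rlt_le_trans; [exact Hy|apply Rmin_l].
    + apply H2; eapply Rlt_le_trans; [exact Hy|apply Rmin_r].
Qed.

Lemma cont_pt n (phi : T -> point) f :
  (forall k, (k < n)%nat -> cont d (fun x => phi x k)) ->
  cont (dpt n) f -> cont d (fun x => f (phi x)).
Proof. intros H. apply cont_map. now apply cont_into_dpt. Qed.

End ContClosure.

Lemma cont_fst {A B} (d : A -> A -> R) (e : B -> B -> R) f :
  cont d f -> cont (dprod d e) (fun p => f (fst p)).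
Proof. apply cont_map_le. intros x y. apply Rmax_l. Qed.

Lemma cont_snd {A B} (d : A -> A -> R) (e : B -> B -> R) f :
  cont e f -> cont (dprod d e) (fun p => f (snd p)).
Proof. apply cont_map_le. intros x y. apply Rmax_r. Qed.

Lemma cont_coord n k : (k < n)%nat -> cont (dpt n) (fun x => x k).
Proof.
  intros Hk x e He. exists e; split; [assumption|]. intros y Hy.
  eapply Rle_lt_trans; [apply (dpt_coord n x y k Hk)|exact Hy].
Qed.

Lemma cont_id : cont dR (fun t => t).
Proof. intros x e He; exists e; split; auto. Qed.

Lemma cont_dR_continuous f : cont dR f <-> forall x, continuous f x.
Proof.
  split.
  - intros H x. apply continuity_pt_filterlim. intros e He.
    destruct (H x e He) as [a [Ha H']]. exists a; split; auto.
    intros y [_ Hy]. apply H'. apply Hy.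
  - intros H x e He. specialize (H x). apply continuity_pt_filterlim in H.
    destruct (H e He) as [a [Ha H']]. exists a; split; auto.
    intros y Hy. destruct (Req_dec y x) as [->|Hn]; [rewrite Rminus_diag, Rabs_R0; lra|].
    apply H'. split; [split; [exact I|auto]|exact Hy].
Qed.

Lemma cont_comp_R {T} (d : T -> T -> R) f h : cont dR h -> cont d f -> cont d (fun x => h (f x)).
Proof. intros Hh. apply cont_comp. intros x. now apply continuity_pt_filterlim, cont_dR_continuous. Qed.

(** Points that agree on the first [n] coordinates are at pseudo-distance 0, so continuity alone
    makes [f] blind to the others. This is how functions on [nat -> R] act as functions on [R^n]. *)
Lemma cont_dpt_ext n f x y : cont (dpt n) f -> (forall k, (k < n)%nat -> x k = y k) -> f x = f y.
Proof.
  intros Hf Hxy. destruct (Req_dec (f x) (f y)) as [|Hn]; [assumption|exfalso].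
  assert (Hp : 0 < Rabs (f y - f x)) by (apply Rabs_pos_lt; lra).
  destruct (Hf x _ Hp) as [a [Ha H]].
  specialize (H y). rewrite dpt_eq0 in H by assumption. specialize (H Ha). lra.
Qed.

(** The tube lemma: compactness of [[a, b]] makes continuity in the parameter uniform in [t], which
    is what passing to integrals needs. *)
Lemma tube {T} (d : T -> T -> R) (F : T -> R -> R) a b :
  (forall x, d x x = 0) -> cont (dprod d dR) (fun p => F (fst p) (snd p)) ->
  forall x eps, 0 < eps -> exists del, 0 < del /\
    forall y t, d x y < del -> a <= t <= b -> Rabs (F y t - F x t) < eps.
Proof.
  intros Hd HF x eps He.
  assert (H : forall t, exists del : posreal, forall y s,
      d x y < del -> Rabs (s - t) < del -> Rabs (F y s - F x t) < eps / 2).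
  { intros t. destruct (HF (x, t) (eps / 2)) as [del [Hdel H]]; [lra|].
    exists (mkposreal del Hdel). intros y s H1 H2. apply (H (y, s)). 
    unfold dprod, dR; simpl in *. now apply Rmax_lub_lt. }
  pose (delta := fun t => proj1_sig (constructive_indefinite_description _ (H t))).
  assert (Hdelta : forall t y s, d x y < delta t -> Rabs (s - t) < delta t -> Rabs (F y s - F x t) < eps / 2).
  { intros t. unfold delta. destruct (constructive_indefinite_description _ (H t)); auto. }
  destruct (compactness_value_1d a b delta) as [del Hdel].
  exists del; split; [apply cond_pos|]. intros y t Hy Ht.
  destruct (NNPP _ (Hdel t Ht)) as [s [_ [Hs Hle]]].
  assert (H1 : Rabs (F y t - F x s) < eps / 2) by (apply Hdelta; lra).
  assert (H2 : Rabs (F x t - F x s) < eps / 2).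
  { apply Hdelta; [rewrite Hd; apply cond_pos|assumption]. }
  replace (F y t - F x t) with ((F y t - F x s) - (F x t - F x s)) by ring.
  unfold Rminus at 1. eapply Rle_lt_trans; [apply Rabs_triang|]. rewrite Rabs_Ropp. lra.
Qed.

(** Coquelicot states equalities about [RInt] in a type that [ring] does not recognize as [R]. *)
Ltac toR := apply Rminus_diag_uniq.

Lemma slice_l {A B} (d : A -> A -> R) (e : B -> B -> R) F x :
  (forall x, d x x = 0) -> cont (dprod d e) (fun p => F (fst p) (snd p)) -> cont e (F x).
Proof.
  intros Hd H. apply (cont_map e (dprod d e) (fun y => (x, y)) (fun p => F (fst p) (snd p))); [|assumption].
  intros y eps He; exists eps; split; [assumption|]. intros y' Hy'. unfold dprod; simpl.
  rewrite Hd. now apply Rmax_lub_lt.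
Qed.

Lemma slice_r {A B} (d : A -> A -> R) (e : B -> B -> R) F y :
  (forall y, e y y = 0) -> cont (dprod d e) (fun p => F (fst p) (snd p)) -> cont d (fun x => F x y).
Proof.
  intros Hd H. apply (cont_map d (dprod d e) (fun x => (x, y)) (fun p => F (fst p) (snd p))); [|assumption].
  intros x eps He; exists eps; split; [assumption|]. intros y' Hy'. unfold dprod; simpl.
  rewrite Hd. now apply Rmax_lub_lt.
Qed.

(** * One-dimensional integrals of compactly supported functions *)

Lemma cont_ex_RInt f a b : cont dR f -> ex_RInt f a b.
Proof. intros H. apply (ex_RInt_continuous f a b). intros; apply cont_dR_continuous; assumption. Qed.

Lemma RInt_const_R (a b c : R) : RInt (fun _ => c) a b = (b - a) * c :> R.
Proof. exact (RInt_const a b c). Qed.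

Lemma RInt_point_R f a : RInt f a a = 0 :> R.
Proof. exact (RInt_point (V := R_CompleteNormedModule) a f). Qed.

Lemma RInt_Chasles_R f a b c : cont dR f -> RInt f a b + RInt f b c = RInt f a c :> R.
Proof. intros H. apply (RInt_Chasles f a b c); now apply cont_ex_RInt. Qed.

Lemma RInt_swap_R f a b : cont dR f -> RInt f b a = - RInt f a b :> R.
Proof. intros H. symmetry. apply (opp_RInt_swap f a b); now apply cont_ex_RInt. Qed.

Definition supp1 (B : R) (f : R -> R) : Prop := forall t, B < Rabs t -> f t = 0.

Definition Cc1 (f : R -> R) : Prop := cont dR f /\ exists B, supp1 B f.

Lemma supp1_le B B' f : B <= B' -> supp1 B f -> supp1 B' f.
Proof. intros H Hf t Ht; apply Hf; lra. Qed.

Lemma supp1_bound B f : supp1 B f -> exists C, 0 < C /\ B <= C /\ supp1 C f.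
Proof.
  intros H. exists (Rmax B 1). split; [|split].
  - eapply Rlt_le_trans; [|apply Rmax_r]; lra.
  - apply Rmax_l.
  - eapply supp1_le; [apply Rmax_l|assumption].
Qed.

(** Meaningful for functions in [Cc1]: the sequence is then eventually constant. *)
Definition int1 (f : R -> R) : R := real (Lim_seq (fun k => RInt f (- INR k) (INR k))).

Lemma RInt_supp_le f B c c' : cont dR f -> supp1 B f -> 0 <= c -> B <= c -> c <= c' ->
  RInt f (- c) c = RInt f (- c') c' :> R.
Proof.
  intros Hf HB H0 H1 H2.
  rewrite <- (RInt_Chasles_R f (- c') (- c) c'), <- (RInt_Chasles_R f (- c) c c') by assumption.
  rewrite (RInt_ext f (fun _ => 0) (- c') (- c)).
  2: { intros x. rewrite Rmin_left, Rmax_right by lra. intros Hx. apply HB.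
       rewrite Rabs_left1 by lra. lra. }
  rewrite (RInt_ext f (fun _ => 0) c c').
  2: { intros x. rewrite Rmin_left, Rmax_right by lra. intros Hx. apply HB.
       rewrite Rabs_pos_eq by lra. lra. }
  rewrite !RInt_const_R. toR; ring.
Qed.

Lemma int1_RInt f B c : cont dR f -> supp1 B f -> 0 <= c -> B <= c ->
  int1 f = RInt f (- c) c.
Proof.
  intros Hf HB H0 H1. unfold int1.
  rewrite (Lim_seq_ext_loc _ (fun _ => RInt f (- c) c)).
  - now rewrite Lim_seq_const.
  - destruct (INR_unbounded c) as [N HN]. exists N. intros k Hk.
    symmetry. apply (RInt_supp_le f B); try assumption.
    apply le_INR in Hk. lra.
Qed.

Lemma Cc1_common f g : Cc1 f -> Cc1 g ->
  exists c, 0 < c /\ supp1 c f /\ supp1 c g /\ cont dR f /\ cont dR g.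
Proof.
  intros [Hf [B HB]] [Hg [B' HB']].
  destruct (supp1_bound B f HB) as [c [Hc [_ H]]]. exists (Rmax c B'). split; [|split; [|split; [|now split]]].
  - eapply Rlt_le_trans; [exact Hc|apply Rmax_l].
  - eapply supp1_le; [apply Rmax_l|assumption].
  - eapply supp1_le; [apply Rmax_r|assumption].
Qed.

Lemma Cc1_0 : Cc1 (fun _ => 0).
Proof. split; [apply cont_const|]. now exists 0. Qed.

Lemma int1_plus f g : Cc1 f -> Cc1 g -> int1 (fun t => f t + g t) = int1 f + int1 g.
Proof.
  intros Hf Hg. destruct (Cc1_common f g Hf Hg) as [c [Hc [Hfc [Hgc [Hf' Hg']]]]].
  rewrite (int1_RInt f c c), (int1_RInt g c c) by (assumption || lra).
  rewrite (int1_RInt _ c c); try lra.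
  - apply (RInt_plus f g); now apply cont_ex_RInt.
  - now apply cont_plus.
  - intros t Ht. rewrite Hfc, Hgc by lra. ring.
Qed.

Lemma int1_scal k f : Cc1 f -> int1 (fun t => k * f t) = k * int1 f.
Proof.
  intros [Hf [B HB]]. destruct (supp1_bound _ _ HB) as [c [H0 [H1 H2]]].
  rewrite (int1_RInt f c c) by (try assumption; lra).
  rewrite (int1_RInt _ c c); try lra.
  - apply (RInt_scal f); now apply cont_ex_RInt.
  - now apply cont_scal.
  - intros t Ht. rewrite H2 by lra. ring.
Qed.

Lemma int1_le f g : Cc1 f -> Cc1 g -> (forall t, f t <= g t) -> int1 f <= int1 g.
Proof.
  intros Hf Hg Hle. destruct (Cc1_common f g Hf Hg) as [c [Hc [Hfc [Hgc [Hf' Hg']]]]].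
  rewrite (int1_RInt f c c), (int1_RInt g c c) by (assumption || lra).
  apply RInt_le; try (now apply cont_ex_RInt); [lra|auto].
Qed.

Lemma int1_0 : int1 (fun _ => 0) = 0.
Proof.
  rewrite (int1_RInt _ 0 0); try lra.
  - rewrite RInt_const_R; toR; ring.
  - apply cont_const.
  - now intros t Ht.
Qed.

Lemma int1_ge0 f : Cc1 f -> (forall t, 0 <= f t) -> 0 <= int1 f.
Proof. intros Hf H. rewrite <- int1_0. now apply int1_le; [apply Cc1_0| |]. Qed.

Lemma int1_affine f k c : k <> 0 -> Cc1 f -> int1 (fun t => f (k * t + c)) = / Rabs k * int1 f.
Proof.
  intros Hk [Hf [B0 HB0]]. destruct (supp1_bound _ _ HB0) as [B [H0 [_ HB]]]. clear B0 HB0.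
  assert (Hk' : 0 < Rabs k) by now apply Rabs_pos_lt.
  set (g := fun t => f (k * t + c)).
  assert (Hg : cont dR g).
  { apply (cont_map dR dR (fun t => k * t + c)); [|assumption].
    apply (cont_plus dR _ _ (cont_scal dR k _ cont_id) (cont_const dR c)). }
  set (C := (B + Rabs c) / Rabs k).
  assert (HC : 0 <= C). { apply Rdiv_le_0_compat; [|assumption]. pose proof (Rabs_pos c); lra. }
  assert (HkC : Rabs k * C = B + Rabs c) by (unfold C; field; lra).
  assert (HgC : supp1 C g).
  { intros t Ht. apply HB. apply (Rmult_lt_compat_l (Rabs k)) in Ht; [|assumption].
    rewrite HkC, <- Rabs_mult in Ht.
    pose proof (Rabs_triang (k * t + c) (- c)) as Htr.
    replace (k * t + c + - c) with (k * t) in Htr by ring. rewrite Rabs_Ropp in Htr. lra. }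
  rewrite (int1_RInt g C C) by (try assumption; lra).
  assert (E : RInt (fun t => k * g t) (- C) C = RInt f (k * - C + c) (k * C + c)).
  { apply (RInt_comp_lin f k c (- C) C). now apply cont_ex_RInt. }
  assert (E' : RInt (fun t => k * g t) (- C) C = k * RInt g (- C) C).
  { apply (RInt_scal g). now apply cont_ex_RInt. }
  (* [[-D, D]] contains the image of [[-C, C]] under [k * t + c], and that image contains the
     support of [f], so the pieces in between contribute 0. *)
  set (D := B + Rabs c + Rabs c).
  assert (Hout : forall a b, (forall t, Rmin a b < t < Rmax a b -> B < Rabs t) -> RInt f a b = 0).
  { intros a b H. rewrite (RInt_ext f (fun _ => 0)).
    - rewrite RInt_const_R; toR; ring.
    - intros x Hx. apply HB. auto. }
  assert (Hc := Rabs_pos c). assert (Hc1 := Rle_abs c). assert (Hc2 := Rle_abs (- c)). rewrite Rabs_Ropp in Hc2.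
  assert (HI : int1 f = RInt f (- D) D) by (apply (int1_RInt f B); try assumption; unfold D; lra).
  assert (E2 : RInt f (k * - C + c) (k * C + c) = (k / Rabs k) * int1 f).
  { rewrite HI. destruct (Rlt_or_le k 0) as [Hn|Hp].
    - rewrite (Rabs_left k) in HkC by assumption. rewrite (Rabs_left k) by assumption.
      assert (HkC' : k * C = - (B + Rabs c)) by lra.
      replace (k / - k) with (-1) by (field; lra).
      replace (k * - C + c) with (B + Rabs c + c) by lra.
      replace (k * C + c) with (- (B + Rabs c) + c) by lra.
      rewrite <- (RInt_Chasles_R f _ D _) by assumption.
      rewrite <- (RInt_Chasles_R f D (- D) _) by assumption.
      rewrite (Hout (B + Rabs c + c) D), (Hout (- D)).
      + rewrite (RInt_swap_R f (- D) D) by assumption. toR; ring.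
      + intros t. unfold D. rewrite Rmin_left, Rmax_right by lra. intros Ht. rewrite Rabs_left1; lra.
      + intros t. unfold D. rewrite Rmin_left, Rmax_right by lra. intros Ht. rewrite Rabs_pos_eq; lra.
    - rewrite (Rabs_pos_eq k) in HkC by assumption. rewrite (Rabs_pos_eq k) by assumption.
      replace (k / k) with 1 by (field; lra).
      replace (k * - C + c) with (- (B + Rabs c) + c) by lra.
      replace (k * C + c) with ((B + Rabs c) + c) by lra.
      rewrite <- (RInt_Chasles_R f (- D) (- (B + Rabs c) + c) D) by assumption.
      rewrite <- (RInt_Chasles_R f (- (B + Rabs c) + c) (B + Rabs c + c) D) by assumption.
      rewrite (Hout (B + Rabs c + c) D), (Hout (- D)).
      + toR; ring.
      + intros t. unfold D. rewrite Rmin_left, Rmax_right by lra. intros Ht. rewrite Rabs_left1; lra.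
      + intros t. unfold D. rewrite Rmin_left, Rmax_right by lra. intros Ht. rewrite Rabs_pos_eq; lra. }
  rewrite E', E2 in E || (rewrite E2 in E; rewrite E' in E).
  apply (Rmult_eq_reg_l k); [|assumption]. rewrite E. field. lra.
Qed.

Lemma int1_cont {T} (d : T -> T -> R) F B : (forall x, d x x = 0) ->
  cont (dprod d dR) (fun p => F (fst p) (snd p)) -> (forall x, supp1 B (F x)) ->
  cont d (fun x => int1 (F x)).
Proof.
  intros Hd HF HB x eps He.
  set (c := Rmax B 1).
  assert (Hc : 1 <= c) by apply Rmax_r. assert (HBc : B <= c) by apply Rmax_l.
  destruct (tube d F (- c) c Hd HF x (eps / (4 * c))) as [del [Hdel H]].
  { apply Rdiv_lt_0_compat; lra. }
  exists del; split; [assumption|]. intros y Hy.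
  assert (Hs : forall z, cont dR (F z)) by (intros; now apply (slice_l d dR)).
  rewrite (int1_RInt (F x) B c), (int1_RInt (F y) B c) by (auto; lra).
  change (RInt (F y) (- c) c - RInt (F x) (- c) c) with (minus (RInt (F y) (- c) c) (RInt (F x) (- c) c)).
  rewrite <- RInt_minus by now apply cont_ex_RInt.
  eapply Rle_lt_trans.
  - apply (abs_RInt_le_const _ (- c) c (eps / (4 * c))); [lra| |].
    + apply cont_ex_RInt. now apply (cont_minus dR).
    + intros t Ht. left. now apply H.
  - replace ((c - - c) * (eps / (4 * c))) with (eps / 2) by (field; lra). lra.
Qed.

Lemma int1_derive (F F' : R -> R -> R) B :
  (forall u t, is_derive (fun u => F u t) u (F' u t)) ->
  cont (dprod dR dR) (fun p => F (fst p) (snd p)) ->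
  cont (dprod dR dR) (fun p => F' (fst p) (snd p)) ->
  (forall u, supp1 B (F u)) -> (forall u, supp1 B (F' u)) ->
  forall u, is_derive (fun u => int1 (F u)) u (int1 (F' u)).
Proof.
  intros HD HF HF' HB HB' u.
  destruct (supp1_bound _ _ (HB 0)) as [c [Hc [HBc _]]].
  assert (Hs : forall z, cont dR (F z)) by (intros z; apply (slice_l dR dR); [apply dR_refl|exact HF]).
  assert (Hs' : forall z, cont dR (F' z)) by (intros z; apply (slice_l dR dR); [apply dR_refl|exact HF']).
  rewrite (int1_RInt (F' u) B c) by (auto; lra).
  apply (is_derive_ext (fun u => RInt (F u) (- c) c)).
  { intros v. symmetry. apply (int1_RInt _ B); auto; lra. }
  assert (HDv : forall v t, Derive (fun u => F u t) v = F' v t) by (intros; apply is_derive_unique, HD).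
  rewrite (RInt_ext (F' u) (fun t => Derive (fun u => F u t) u)) by (intros; now rewrite HDv).
  apply is_derive_RInt_param.
  - apply filter_forall. intros v t _. eexists; apply HD.
  - intros t _. intros eps. destruct (HF' (u, t) eps (cond_pos eps)) as [del [Hdel H]].
    exists (mkposreal del Hdel). intros v s Hv Ht. rewrite !HDv.
    apply (H (v, s)). unfold dprod, dR; simpl in *. now apply Rmax_lub_lt.
  - apply filter_forall. intros v. apply cont_ex_RInt, Hs.
Qed.

(** * The iterated integral *)

Definition upd (x : point) (k : nat) (t : R) : point :=
  fun j => if Nat.eq_dec j k then t else x j.

Definition orig : point := fun _ => 0.

(** The highest coordinate is integrated innermost; coordinates from [n] on stay at their value 0 in
    [orig]. *)
Fixpoint integ (n : nat) (f : point -> R) : R :=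
  match n with
  | O => f orig
  | S m => integ m (fun x => int1 (fun t => f (upd x m t)))
  end.

Lemma upd_same x k t : upd x k t k = t.
Proof. unfold upd; now destruct (Nat.eq_dec k k). Qed.

Lemma upd_other x k t j : j <> k -> upd x k t j = x j.
Proof. unfold upd; now destruct (Nat.eq_dec j k). Qed.

Definition supp (n : nat) (B : R) (f : point -> R) : Prop :=
  forall x k, (k < n)%nat -> B < Rabs (x k) -> f x = 0.

Definition Cc (n : nat) (f : point -> R) : Prop :=
  cont (dpt n) f /\ exists B, supp n B f.

Lemma supp_le n B B' f : B <= B' -> supp n B f -> supp n B' f.
Proof. intros H Hf x k Hk Hx; apply (Hf x k); [assumption|lra]. Qed.

Lemma dpt_upd n x y s t : dpt (S n) (upd x n s) (upd y n t) = Rmax (dpt n x y) (Rabs (t - s)).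
Proof.
  simpl. rewrite !upd_same. f_equal.
  apply dpt_ext; intros; apply upd_other; lia.
Qed.

Lemma cont_upd {T} (d : T -> T -> R) m (F : T -> point -> R) :
  cont (dprod d (dpt (S m))) (fun p => F (fst p) (snd p)) ->
  cont (dprod (dprod d (dpt m)) dR) (fun p => F (fst (fst p)) (upd (snd (fst p)) m (snd p))).
Proof.
  intros H.
  apply (cont_map_le _ (dprod d (dpt (S m))) (fun p => (fst (fst p), upd (snd (fst p)) m (snd p)))
     (fun p => F (fst p) (snd p))); [|assumption].
  intros [[x y] t] [[x' y'] t']. unfold dprod. cbn [fst snd]. rewrite dpt_upd. unfold dR.
  rewrite Rmax_assoc. lra.
Qed.

Lemma supp_upd m B f x : supp (S m) B f -> supp1 B (fun t => f (upd x m t)).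
Proof. intros H t Ht. apply (H _ m); [lia|now rewrite upd_same]. Qed.

Lemma supp_int1 m B f : supp (S m) B f -> supp m B (fun x => int1 (fun t => f (upd x m t))).
Proof.
  intros H x k Hk Hx. rewrite <- int1_0 at 1. f_equal. apply functional_extensionality; intros t.
  apply (H _ k); [lia|]. rewrite upd_other by lia. assumption.
Qed.

Lemma integ_cont m : forall {T} (d : T -> T -> R) (F : T -> point -> R) B, (forall x, d x x = 0) ->
  cont (dprod d (dpt m)) (fun p => F (fst p) (snd p)) -> (forall x, supp m B (F x)) ->
  cont d (fun x => integ m (F x)).
Proof.
  induction m as [|m IH]; intros T d F B Hd HF HB; simpl.
  - apply (slice_r d (dpt 0) F orig); [intros; apply dpt_refl|assumption].
  - apply (IH _ d (fun x y => int1 (fun t => F x (upd y m t))) B Hd).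
    + apply (int1_cont (dprod d (dpt m)) (fun p t => F (fst p) (upd (snd p) m t)) B).
      * apply dprod_refl; [assumption|apply dpt_refl].
      * now apply cont_upd.
      * intros [x y]. simpl. now apply supp_upd.
    + intros x. now apply supp_int1.
Qed.

Lemma cont_upd0 m f : cont (dpt (S m)) f -> cont (dprod (dpt m) dR) (fun p => f (upd (fst p) m (snd p))).
Proof.
  apply (cont_map_le _ (dpt (S m)) (fun p => upd (fst p) m (snd p))).
  intros [x s] [y t]. rewrite dpt_upd. apply Rle_refl.
Qed.

Lemma Cc_slice m f x : Cc (S m) f -> Cc1 (fun t => f (upd x m t)).
Proof.
  intros [Hf [B HB]]; split; [|exists B; now apply supp_upd].
  apply (slice_l (dpt m) dR (fun x t => f (upd x m t))); [apply dpt_refl|now apply cont_upd0].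
Qed.

Lemma Cc_int1 m f : Cc (S m) f -> Cc m (fun x => int1 (fun t => f (upd x m t))).
Proof.
  intros [Hf [B HB]]; split; [|exists B; now apply supp_int1].
  apply (int1_cont (dpt m) (fun x t => f (upd x m t)) B); [apply dpt_refl|now apply cont_upd0|].
  intros x. now apply supp_upd.
Qed.

Lemma Cc_plus m f g : Cc m f -> Cc m g -> Cc m (fun x => f x + g x).
Proof.
  intros [Hf [B HB]] [Hg [B' HB']]; split; [now apply cont_plus|].
  exists (Rmax B B'). intros x k Hk Hx.
  rewrite (HB x k), (HB' x k); try assumption; [ring| |];
   (eapply Rle_lt_trans; [|exact Hx]); [apply Rmax_r|apply Rmax_l].
Qed.

Lemma Cc_mult m f g : cont (dpt m) g -> Cc m f -> Cc m (fun x => g x * f x).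
Proof.
  intros Hg [Hf [B HB]]; split; [now apply cont_mult|].
  exists B. intros x k Hk Hx. rewrite (HB x k Hk Hx). ring.
Qed.

Lemma Cc_scal m c f : Cc m f -> Cc m (fun x => c * f x).
Proof. apply Cc_mult, cont_const. Qed.

Lemma Cc_ext m f g : (forall x, f x = g x) -> Cc m f -> Cc m g.
Proof. intros H. apply functional_extensionality in H. now subst. Qed.

Lemma Cc_minus m f g : Cc m f -> Cc m g -> Cc m (fun x => f x - g x).
Proof.
  intros Hf Hg. apply (Cc_ext m (fun x => f x + (-1) * g x)); [intros; ring|].
  apply Cc_plus; [assumption|now apply Cc_scal].
Qed.

Lemma Cc_0 m : Cc m (fun _ => 0).
Proof. split; [apply cont_const|]. now exists 0. Qed.

Lemma Cc_rsum m N f : (forall k, (k < N)%nat -> Cc m (f k)) -> Cc m (fun x => rsum N (fun k => f k x)).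
Proof.
  induction N as [|N IH]; intros H; simpl.
  - apply Cc_0.
  - apply Cc_plus; [apply IH; intros; apply H; lia|apply H; lia].
Qed.

Lemma integ_ext m f g : (forall x, f x = g x) -> integ m f = integ m g.
Proof. intros H. apply functional_extensionality in H. now subst. Qed.

Lemma integ_plus m : forall f g, Cc m f -> Cc m g -> integ m (fun x => f x + g x) = integ m f + integ m g.
Proof.
  induction m as [|m IH]; intros f g Hf Hg; simpl; [reflexivity|].
  rewrite <- IH by now apply Cc_int1.
  apply integ_ext; intros x. apply int1_plus; now apply Cc_slice.
Qed.

Lemma integ_scal m : forall c f, Cc m f -> integ m (fun x => c * f x) = c * integ m f.
Proof.
  induction m as [|m IH]; intros c f Hf; simpl; [reflexivity|].
  rewrite <- IH by now apply Cc_int1.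
  apply integ_ext; intros x. apply int1_scal; now apply Cc_slice.
Qed.

Lemma integ_minus m f g : Cc m f -> Cc m g -> integ m (fun x => f x - g x) = integ m f - integ m g.
Proof.
  intros Hf Hg. rewrite (integ_ext m _ (fun x => f x + (-1) * g x)) by (intros; ring).
  rewrite integ_plus, integ_scal by (try apply Cc_scal; assumption). ring.
Qed.

Lemma integ_0 m : integ m (fun _ => 0) = 0.
Proof.
  induction m as [|m IH]; simpl; [reflexivity|]. etransitivity; [|exact IH].
  apply integ_ext; intros; apply int1_0.
Qed.

Lemma integ_rsum m N f : (forall k, (k < N)%nat -> Cc m (f k)) ->
  integ m (fun x => rsum N (fun k => f k x)) = rsum N (fun k => integ m (f k)).
Proof.
  induction N as [|N IH]; intros H; simpl; [apply integ_0|].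
  rewrite integ_plus, IH; [reflexivity|intros; apply H; lia| |apply H; lia].
  apply Cc_rsum. intros; apply H; lia.
Qed.

Lemma integ_le m : forall f g, Cc m f -> Cc m g -> (forall x, f x <= g x) -> integ m f <= integ m g.
Proof.
  induction m as [|m IH]; intros f g Hf Hg H; simpl; [apply H|].
  apply IH; try now apply Cc_int1.
  intros x. apply int1_le; try now apply Cc_slice. intros; apply H.
Qed.

Lemma integ_ge0 m f : Cc m f -> (forall x, 0 <= f x) -> 0 <= integ m f.
Proof.
  intros Hf H. rewrite <- (integ_0 m). now apply integ_le; [apply Cc_0| |].
Qed.

Definition aff (k : R) (c : point) (x : point) : point := fun j => k * x j + c j.

Lemma cont_aff m k c f : cont (dpt m) f -> cont (dpt m) (fun x => f (aff k c x)).
Proof.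
  intros Hf. apply (cont_pt (dpt m) m (aff k c)); [|assumption].
  intros j Hj. apply cont_plus; [apply cont_scal, cont_coord; assumption|apply cont_const].
Qed.

Lemma bound_coords m (c : point) : exists C, 0 <= C /\ forall j, (j < m)%nat -> Rabs (c j) <= C.
Proof.
  exists (rsum m (fun j => Rabs (c j))). split.
  - apply rsum_ge0; intros; apply Rabs_pos.
  - intros j Hj. apply (rsum_term m (fun j => Rabs (c j))); [intros; apply Rabs_pos|assumption].
Qed.

Lemma Cc_aff m k c f : k <> 0 -> Cc m f -> Cc m (fun x => f (aff k c x)).
Proof.
  intros Hk [Hf [B HB]]. split; [now apply cont_aff|].
  destruct (bound_coords m c) as [C [HC HcC]].
  exists ((B + C) / Rabs k). intros x j Hj Hx. apply (HB _ j Hj). unfold aff.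
  assert (Hk' : 0 < Rabs k) by now apply Rabs_pos_lt.
  apply (Rmult_lt_compat_l (Rabs k)) in Hx; [|assumption].
  replace (Rabs k * ((B + C) / Rabs k)) with (B + C) in Hx by (field; lra).
  rewrite <- Rabs_mult in Hx.
  pose proof (Rabs_triang (k * x j + c j) (- c j)) as Htr.
  replace (k * x j + c j + - c j) with (k * x j) in Htr by ring. rewrite Rabs_Ropp in Htr.
  specialize (HcC j Hj). lra.
Qed.

Lemma integ_aff m : forall k c f, k <> 0 -> Cc m f ->
  integ m (fun x => f (aff k c x)) = (/ Rabs k) ^ m * integ m f.
Proof.
  induction m as [|m IH]; intros k c f Hk Hf; simpl.
  - rewrite Rmult_1_l. apply (cont_dpt_ext 0); [apply Hf|intros; lia].
  - rewrite Rmult_assoc, <- (IH k c) by (try assumption; now apply Cc_int1).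
    rewrite <- (integ_scal m (/ Rabs k)) by (apply (Cc_aff m k c (fun x => int1 (fun t => f (upd x m t)))); [assumption|now apply Cc_int1]).
    apply integ_ext; intros x.
    rewrite <- (int1_affine _ k (c m)) by (try assumption; now apply Cc_slice).
    f_equal; apply functional_extensionality; intros t.
    f_equal. apply functional_extensionality; intros j. unfold aff, upd.
    destruct (Nat.eq_dec j m) as [->|]; reflexivity.
Qed.

Lemma integ_translate m c f : Cc m f -> integ m (fun x => f (fun j => x j + c j)) = integ m f.
Proof.
  intros Hf. rewrite <- (Rmult_1_l (integ m f)).
  replace 1 with ((/ Rabs 1) ^ m) by (rewrite Rabs_R1, Rinv_1; apply pow1).
  rewrite <- (integ_aff m 1 c) by (try assumption; lra).
  apply integ_ext; intros x. f_equal. apply functional_extensionality; intros j. unfold aff; ring.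
Qed.

Lemma integ_derive m : forall (F F' : R -> point -> R) B,
  (forall u x, is_derive (fun u => F u x) u (F' u x)) ->
  cont (dprod dR (dpt m)) (fun p => F (fst p) (snd p)) ->
  cont (dprod dR (dpt m)) (fun p => F' (fst p) (snd p)) ->
  (forall u, supp m B (F u)) -> (forall u, supp m B (F' u)) ->
  forall u, is_derive (fun u => integ m (F u)) u (integ m (F' u)).
Proof.
  induction m as [|m IH]; intros F F' B HD HF HF' HB HB' u; simpl; [apply HD|].
  assert (Hjoint : forall G, cont (dprod dR (dpt (S m))) (fun p => G (fst p) (snd p)) ->
     (forall u, supp (S m) B (G u)) ->
     cont (dprod dR (dpt m)) (fun p => int1 (fun t => G (fst p) (upd (snd p) m t)))).
  { intros G HG HBG.
    apply (int1_cont (dprod dR (dpt m)) (fun p t => G (fst p) (upd (snd p) m t)) B).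
    - apply dprod_refl; [apply dR_refl|apply dpt_refl].
    - now apply cont_upd.
    - intros [v y]. simpl. now apply supp_upd. }
  apply (IH (fun u x => int1 (fun t => F u (upd x m t))) (fun u x => int1 (fun t => F' u (upd x m t))) B).
  - intros v x. apply (int1_derive (fun v t => F v (upd x m t)) (fun v t => F' v (upd x m t)) B).
    + intros; apply HD.
    + apply (cont_map_le _ (dprod dR (dpt (S m))) (fun p => (fst p, upd x m (snd p))) (fun p => F (fst p) (snd p))); [|assumption].
      intros [a s] [b t]. unfold dprod. cbn [fst snd]. rewrite dpt_upd, dpt_refl.
      rewrite (Rmax_right 0) by apply Rabs_pos. apply Rle_refl.
    + apply (cont_map_le _ (dprod dR (dpt (S m))) (fun p => (fst p, upd x m (snd p))) (fun p => F' (fst p) (snd p))); [|assumption].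
      intros [a s] [b t]. unfold dprod. cbn [fst snd]. rewrite dpt_upd, dpt_refl.
      rewrite (Rmax_right 0) by apply Rabs_pos. apply Rle_refl.
    + intros; now apply supp_upd.
    + intros; now apply supp_upd.
  - now apply Hjoint.
  - now apply Hjoint.
  - intros; now apply supp_int1.
  - intros; now apply supp_int1.
Qed.

(** * Fubini's theorem *)

Lemma RInt_cont_param {T} (d : T -> T -> R) F a b : a <= b -> (forall x, d x x = 0) ->
  cont (dprod d dR) (fun p => F (fst p) (snd p)) -> cont d (fun x => RInt (F x) a b).
Proof.
  intros Hab Hd HF x eps He.
  destruct (tube d F a b Hd HF x (eps / (b - a + 1))) as [del [Hdel H]].
  { apply Rdiv_lt_0_compat; lra. }
  exists del; split; [assumption|]. intros y Hy.
  assert (Hs : forall z, cont dR (F z)) by (intros; now apply (slice_l d dR)).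
  change (RInt (F y) a b - RInt (F x) a b) with (minus (RInt (F y) a b) (RInt (F x) a b)).
  rewrite <- RInt_minus by now apply cont_ex_RInt.
  eapply Rle_lt_trans.
  - apply (abs_RInt_le_const _ a b (eps / (b - a + 1))); [lra| |].
    + apply cont_ex_RInt. now apply (cont_minus dR).
    + intros t Ht. left. now apply H.
  - apply (Rmult_lt_reg_r (b - a + 1)); [lra|].
    replace ((b - a) * (eps / (b - a + 1)) * (b - a + 1)) with ((b - a) * eps) by (field; lra). nra.
Qed.

Lemma cont_swap {A B} (d : A -> A -> R) (e : B -> B -> R) F :
  cont (dprod d e) (fun p => F (fst p) (snd p)) -> cont (dprod e d) (fun p => F (snd p) (fst p)).
Proof.
  apply (cont_map_le _ (dprod d e) (fun p => (snd p, fst p)) (fun p => F (fst p) (snd p))).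
  intros x y. unfold dprod; simpl. rewrite Rmax_comm. lra.
Qed.

(** As functions of the upper limit of the variable [s], both sides vanish at [a] and have the
    derivative [RInt (F x) c d] at [x], hence they agree at [b]. *)
Lemma RInt_fubini F a b c d : a <= b -> c <= d ->
  cont (dprod dR dR) (fun p => F (fst p) (snd p)) ->
  RInt (fun s => RInt (F s) c d) a b = RInt (fun t => RInt (fun s => F s t) a b) c d :> R.
Proof.
  intros Hab Hcd HF.
  assert (HF1 : forall s, cont dR (F s)) by (intros; now apply (slice_l dR dR); [apply dR_refl|]).
  assert (HF2 : forall t, cont dR (fun s => F s t)) by (intros; now apply (slice_r dR dR); [apply dR_refl|]).
  assert (HFs : cont (dprod dR dR) (fun p => F (snd p) (fst p))) by now apply cont_swap.
  destruct (Req_dec a b) as [->|Hn].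
  { rewrite RInt_point. rewrite (RInt_ext _ (fun _ => 0)).
    - rewrite RInt_const_R. toR. change (@zero R_CompleteNormedModule) with 0. ring.
    - intros t _. apply (RInt_point (V := R_CompleteNormedModule)). }
  set (G := fun x => RInt (fun t => RInt (fun s => F s t) a x) c d - RInt (fun s => RInt (F s) c d) a x).
  assert (HG : forall x, a <= x <= b -> is_derive G x 0).
  { intros x Hx.
    assert (HDv : forall y t, is_derive (fun x => RInt (fun s => F s t) a x) y (F y t)).
    { intros y t. apply (is_derive_RInt (fun s => F s t) (fun x => RInt (fun s => F s t) a x) a y).
      - apply filter_forall. intros z. apply (RInt_correct (fun s => F s t)), cont_ex_RInt, HF2.
      - apply (proj1 (cont_dR_continuous (fun s => F s t))), HF2. }
    assert (H1 : is_derive (fun x => RInt (fun t => RInt (fun s => F s t) a x) c d) x (RInt (F x) c d)).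
    { rewrite (RInt_ext (F x) (fun t => Derive (fun u => RInt (fun s => F s t) a u) x)).
      2: { intros t _. symmetry. apply is_derive_unique, HDv. }
      apply (is_derive_RInt_param (fun x t => RInt (fun s => F s t) a x)).
      - apply filter_forall. intros v t _. eexists; apply HDv.
      - intros t _. apply (continuity_2d_pt_ext (fun u v => F u v)).
        { intros u v. symmetry. apply is_derive_unique, HDv. }
        intros eps. destruct (HF (x, t) eps (cond_pos eps)) as [del [Hdel H]].
        exists (mkposreal del Hdel). intros v s Hv Ht.
        apply (H (v, s)). unfold dprod, dR; simpl in *. now apply Rmax_lub_lt.
      - apply filter_forall. intros y. apply cont_ex_RInt.
        destruct (Rle_dec a y) as [Hy|Hy].
        + apply (RInt_cont_param dR (fun t s => F s t) a y Hy dR_refl HFs).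
        + eapply cont_ext; [|apply cont_opp, (RInt_cont_param dR (fun t s => F s t) y a)].
          * intros t. symmetry. apply RInt_swap_R. apply HF2.
          * lra.
          * apply dR_refl.
          * apply HFs. }
    assert (HFc : cont dR (fun s => RInt (F s) c d)) by (apply RInt_cont_param; [assumption|apply dR_refl|assumption]).
    assert (H2 : is_derive (fun x => RInt (fun s => RInt (F s) c d) a x) x (RInt (F x) c d)).
    { apply (is_derive_RInt (fun s => RInt (F s) c d) (fun x => RInt (fun s => RInt (F s) c d) a x) a x).
      - apply filter_forall. intros z. apply (RInt_correct (fun s => RInt (F s) c d)), cont_ex_RInt, HFc.
      - apply (proj1 (cont_dR_continuous (fun s => RInt (F s) c d))), HFc. }
    replace 0 with (RInt (F x) c d - RInt (F x) c d) by (toR; ring).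
    apply (is_derive_minus _ _ _ _ _ H1 H2). }
  assert (E : G a = G b) by (apply (eq_is_derive G a b HG); lra).
  unfold G in E. rewrite RInt_point in E.
  rewrite (RInt_ext _ (fun _ => 0)) in E.
  2: { intros t _. apply (RInt_point (V := R_CompleteNormedModule)). }
  rewrite RInt_const_R in E. change (@zero R_CompleteNormedModule) with 0 in E. lra.
Qed.

Lemma int1_fubini F B :
  cont (dprod dR dR) (fun p => F (fst p) (snd p)) ->
  (forall s, supp1 B (F s)) -> (forall t, supp1 B (fun s => F s t)) ->
  int1 (fun s => int1 (F s)) = int1 (fun t => int1 (fun s => F s t)).
Proof.
  intros HF H1 H2.
  assert (HF1 : forall s, cont dR (F s)) by (intros; now apply (slice_l dR dR); [apply dR_refl|]).
  assert (HF2 : forall t, cont dR (fun s => F s t)) by (intros; now apply (slice_r dR dR); [apply dR_refl|]).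
  assert (HFs : cont (dprod dR dR) (fun p => F (snd p) (fst p))) by now apply cont_swap.
  destruct (supp1_bound _ _ (H1 0)) as [c [Hc [HBc _]]].
  assert (C1 : cont dR (fun s => int1 (F s))) by (apply (int1_cont dR F B); [apply dR_refl|assumption|assumption]).
  assert (C2 : cont dR (fun t => int1 (fun s => F s t))) by (apply (int1_cont dR (fun t s => F s t) B); [apply dR_refl|assumption|assumption]).
  assert (S1 : supp1 B (fun s => int1 (F s))).
  { intros s Hs. rewrite <- int1_0. f_equal. apply functional_extensionality; intros t. now apply (H2 t). }
  assert (S2 : supp1 B (fun t => int1 (fun s => F s t))).
  { intros s Hs. rewrite <- int1_0. f_equal. apply functional_extensionality; intros t. now apply (H1 t). }
  rewrite (int1_RInt _ B c C1 S1), (int1_RInt _ B c C2 S2) by lra.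
  rewrite (RInt_ext _ (fun s => RInt (F s) (- c) c)).
  2: { intros s _. apply (int1_RInt (F s) B); auto; lra. }
  rewrite (RInt_ext (fun t => int1 _) (fun t => RInt (fun s => F s t) (- c) c)).
  2: { intros t _. apply (int1_RInt (fun s => F s t) B); auto; lra. }
  apply RInt_fubini; [lra|lra|assumption].
Qed.

Lemma integ_int1_fubini m : forall F B,
  cont (dprod (dpt m) dR) (fun p => F (fst p) (snd p)) ->
  (forall x, supp1 B (F x)) -> (forall t, supp m B (fun x => F x t)) ->
  integ m (fun x => int1 (F x)) = int1 (fun t => integ m (fun x => F x t)).
Proof.
  induction m as [|m IH]; intros F B HF H1 H2; simpl; [reflexivity|].
  assert (HF' : cont (dprod (dprod (dpt m) dR) dR) (fun p => F (upd (fst (fst p)) m (snd p)) (snd (fst p)))).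
  { apply (cont_map_le _ (dprod (dpt (S m)) dR) (fun p => (upd (fst (fst p)) m (snd p), snd (fst p)))
      (fun p => F (fst p) (snd p))); [|assumption].
    intros [[x y] t] [[x' y'] t']. unfold dprod. cbn [fst snd]. rewrite dpt_upd. unfold dR.
    rewrite <- !Rmax_assoc, (Rmax_comm (Rabs (t' - t))). lra. }
  rewrite <- (IH (fun y t => int1 (fun s => F (upd y m s) t)) B).
  - apply integ_ext. intros y.
    apply (int1_fubini (fun s t => F (upd y m s) t) B).
    + apply (cont_map_le _ (dprod (dprod (dpt m) dR) dR) (fun p => ((y, snd p), fst p))
       (fun p => F (upd (fst (fst p)) m (snd p)) (snd (fst p)))); [|assumption].
      intros [s t] [s' t']. unfold dprod; cbn [fst snd]. rewrite dpt_refl.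
      rewrite (Rmax_right 0) by apply Rabs_pos. rewrite Rmax_comm; lra.
    + intros s. apply H1.
    + intros t. apply (supp_upd m B (fun x => F x t)), H2.
  - apply (int1_cont (dprod (dpt m) dR) (fun p s => F (upd (fst p) m s) (snd p)) B).
    + apply dprod_refl; [apply dpt_refl|apply dR_refl].
    + assumption.
    + intros [x t]. apply (supp_upd m B (fun x => F x t)), H2.
  - intros x t Ht. rewrite <- int1_0. f_equal. apply functional_extensionality; intros s. now apply H1.
  - intros t. apply (supp_int1 m B (fun x => F x t)), H2.
Qed.

Lemma integ_fubini m n : forall F B,
  cont (dprod (dpt m) (dpt n)) (fun p => F (fst p) (snd p)) ->
  (forall x, supp n B (F x)) -> (forall y, supp m B (fun x => F x y)) ->
  integ m (fun x => integ n (F x)) = integ n (fun y => integ m (fun x => F x y)).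
Proof.
  induction n as [|n IH]; intros F B HF H1 H2; simpl; [reflexivity|].
  rewrite (IH (fun x y => int1 (fun t => F x (upd y n t))) B).
  - apply integ_ext. intros y.
    apply (integ_int1_fubini m (fun x t => F x (upd y n t)) B).
    + apply (cont_map_le _ (dprod (dpt m) (dpt (S n))) (fun p => (fst p, upd y n (snd p)))
       (fun p => F (fst p) (snd p))); [|assumption].
      intros [s t] [s' t']. unfold dprod; cbn [fst snd]. rewrite dpt_upd, dpt_refl.
      rewrite (Rmax_right 0) by apply Rabs_pos. apply Rle_refl.
    + intros x. now apply supp_upd.
    + intros t. apply H2.
  - apply (int1_cont (dprod (dpt m) (dpt n)) (fun p t => F (fst p) (upd (snd p) n t)) B).
    + apply dprod_refl; apply dpt_refl.
    + now apply cont_upd.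
    + intros [x y]. now apply supp_upd.
  - intros x. now apply supp_int1.
  - intros y x k Hk Hx. rewrite <- int1_0. f_equal. apply functional_extensionality; intros s. now apply (H2 _ x k).
Qed.

Definition cat (m : nat) (x y : point) : point :=
  fun k => if lt_dec k m then x k else y (k - m)%nat.

Lemma integ_split m n : forall f, Cc (m + n) f ->
  integ (m + n) f = integ m (fun x => integ n (fun y => f (cat m x y))).
Proof.
  induction n as [|n IH]; intros f Hf.
  - rewrite Nat.add_0_r in *. apply integ_ext. intros x. simpl.
    apply (cont_dpt_ext m); [apply Hf|]. intros k Hk. unfold cat. now destruct (lt_dec k m).
  - rewrite Nat.add_succ_r in *. simpl. rewrite IH by now apply Cc_int1.
    apply integ_ext; intros x. apply integ_ext; intros y. f_equal.
    apply functional_extensionality; intros t. f_equal.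
    apply functional_extensionality; intros k. unfold cat, upd.
    destruct (Nat.eq_dec k (m + n)), (lt_dec k m), (Nat.eq_dec (k - m) n); try lia; reflexivity.
Qed.

(** * Positivity and Dini's theorem *)

Lemma int1_pos f t0 : Cc1 f -> (forall t, 0 <= f t) -> 0 < f t0 -> 0 < int1 f.
Proof.
  intros [Hf [B0 HB0]] Hp H0.
  destruct (supp1_bound _ _ HB0) as [B [HB [_ HBs]]].
  destruct (Hf t0 (f t0) H0) as [del [Hdel H]].
  set (e := Rmin (del / 2) 1).
  assert (He : 0 < e) by (apply Rmin_pos; lra).
  assert (He1 : e <= del / 2) by apply Rmin_l. assert (He2 : e <= 1) by apply Rmin_r.
  set (c := B + Rabs t0 + 1).
  assert (Hc1 := Rle_abs t0). assert (Hc2 := Rle_abs (- t0)). rewrite Rabs_Ropp in Hc2.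
  rewrite (int1_RInt f B c) by (try assumption; unfold c; lra).
  rewrite <- (RInt_Chasles_R f (- c) (t0 - e) c), <- (RInt_Chasles_R f (t0 - e) (t0 + e) c) by assumption.
  assert (G1 : 0 <= RInt f (- c) (t0 - e)) by (apply RInt_ge_0; [unfold c; lra|now apply cont_ex_RInt|auto]).
  assert (G2 : 0 <= RInt f (t0 + e) c) by (apply RInt_ge_0; [unfold c; lra|now apply cont_ex_RInt|auto]).
  assert (G3 : 0 < RInt f (t0 - e) (t0 + e)).
  { apply RInt_gt_0; [lra| |].
    - intros t Ht. specialize (H t). unfold dR in H.
      assert (Hd : Rabs (t - t0) < del) by (apply Rabs_def1; lra).
      specialize (H Hd). apply Rabs_def2 in H. lra.
    - intros t _. now apply cont_dR_continuous. }
  lra.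
Qed.

Lemma integ_pos m : forall f x0, Cc m f -> (forall x, 0 <= f x) -> 0 < f x0 -> 0 < integ m f.
Proof.
  induction m as [|m IH]; intros f x0 Hf Hp H0; simpl.
  - rewrite (cont_dpt_ext 0 f orig x0); [assumption|apply Hf|intros; lia].
  - apply (IH _ x0); [now apply Cc_int1| |].
    + intros x. apply int1_ge0; [now apply Cc_slice|auto].
    + apply (int1_pos _ (x0 m)); [now apply Cc_slice|auto|].
      rewrite (cont_dpt_ext (S m) f _ x0); [assumption|apply Hf|].
      intros k Hk. unfold upd. destruct (Nat.eq_dec k m); congruence.
Qed.

Lemma int1_dini (f : nat -> R -> R) :
  (forall J, Cc1 (f J)) -> (forall J t, 0 <= f J t) -> (forall J t, f (S J) t <= f J t) ->
  (forall t eps, 0 < eps -> exists J, f J t < eps) ->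
  forall eps, 0 < eps -> exists J, int1 (f J) < eps.
Proof.
  intros Hf Hp Hd H0 eps Heps.
  assert (Hmon : forall t J K, (J <= K)%nat -> f K t <= f J t).
  { intros t J K HJK. induction HJK; [lra|]. eapply Rle_trans; [apply Hd|assumption]. }
  destruct (Hf O) as [_ [B HB]]. destruct (supp1_bound _ _ HB) as [c [Hc [_ Hcs]]].
  assert (Hs : forall J, supp1 c (f J)).
  { intros J t Ht. apply Rle_antisym; [|apply Hp]. rewrite <- (Hcs t Ht). apply Hmon; lia. }
  set (e := eps / (4 * c)). assert (He : 0 < e) by (apply Rdiv_lt_0_compat; lra).
  (* Tying the gauge to the index by [del <= / (INR J + 1)] lets the uniform [del] of the
     compactness argument bound the indices as well, so that one [K] beyond [/ del] serves every
     [t]. *)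
  assert (H : forall t, exists del : posreal, exists J, del <= / (INR J + 1) /\ forall s, Rabs (s - t) < del -> f J s < e).
  { intros t. destruct (H0 t (e / 2)) as [J HJ]; [lra|].
    destruct (proj1 (Hf J) t (e / 2)) as [del [Hdel H]]; [lra|].
    assert (HJ1 : 0 < / (INR J + 1)) by (apply Rinv_0_lt_compat; pose proof (pos_INR J); lra).
    exists (mkposreal _ (Rmin_pos _ _ Hdel HJ1)). exists J. simpl. split; [apply Rmin_r|].
    intros s Hs'. specialize (H s). unfold dR in H.
    assert (Hsd : Rabs (s - t) < del) by (eapply Rlt_le_trans; [exact Hs'|apply Rmin_l]).
    specialize (H Hsd). apply Rabs_def2 in H. lra. }
  pose (delta := fun t => proj1_sig (constructive_indefinite_description _ (H t))).
  assert (Hdelta : forall t, exists J, delta t <= / (INR J + 1) /\ forall s, Rabs (s - t) < delta t -> f J s < e).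
  { intros t. unfold delta. destruct (constructive_indefinite_description _ (H t)); auto. }
  destruct (compactness_value_1d (- c) c delta) as [del Hdel].
  destruct (INR_unbounded (/ del)) as [K HK].
  exists K.
  assert (HKe : forall t, - c <= t <= c -> f K t <= e).
  { intros t Ht. destruct (NNPP _ (Hdel t Ht)) as [s [_ [Hs1 Hs2]]].
    destruct (Hdelta s) as [J [HJ1 HJ2]]. left.
    eapply Rle_lt_trans; [|apply (HJ2 t Hs1)]. apply Hmon.
    assert (HJp : 0 < INR J + 1) by (pose proof (pos_INR J); lra).
    assert (Hd2 : del <= / (INR J + 1)) by lra.
    apply Rinv_le_contravar in Hd2; [|apply cond_pos]. rewrite Rinv_inv in Hd2.
    apply INR_le. lra. }
  rewrite (int1_RInt (f K) c c) by (try apply Hs; try apply Hf; lra).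
  apply Rle_lt_trans with ((c - - c) * e).
  - eapply Rle_trans; [apply Rle_abs|]. apply (abs_RInt_le_const (f K) (- c) c e); [lra|apply cont_ex_RInt, Hf|].
    intros t Ht. rewrite Rabs_pos_eq by apply Hp. auto.
  - unfold e. replace ((c - - c) * (eps / (4 * c))) with (eps / 2) by (field; lra). lra.
Qed.

(** Only pointwise decrease to 0 is asked, and the one-dimensional case returns it for the partial
    integrals, so the variables can be integrated one at a time. *)
Lemma integ_dini m : forall (f : nat -> point -> R),
  (forall J, Cc m (f J)) -> (forall J x, 0 <= f J x) -> (forall J x, f (S J) x <= f J x) ->
  (forall x eps, 0 < eps -> exists J, f J x < eps) ->
  forall eps, 0 < eps -> exists J, integ m (f J) < eps.
Proof.
  induction m as [|m IH]; intros f Hf Hp Hd H0; simpl; [intros; now apply H0|].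
  apply IH.
  - intros J; now apply Cc_int1.
  - intros J x. apply int1_ge0; [now apply Cc_slice|auto].
  - intros J x. apply int1_le; try now apply Cc_slice. auto.
  - intros x. apply int1_dini; auto. intros; now apply Cc_slice.
Qed.

(** * Continuous majorants of boxes *)

Lemma int1_le_length f a b : a <= b -> Cc1 f -> (forall t, f t <= 1) ->
  (forall t, t < a \/ b < t -> f t = 0) -> int1 f <= b - a.
Proof.
  intros Hab [Hf [B HB]] H1 H0.
  set (c := Rabs a + Rabs b + Rabs B).
  assert (Ha1 := Rle_abs a). assert (Ha2 := Rle_abs (- a)). rewrite Rabs_Ropp in Ha2.
  assert (Hb1 := Rle_abs b). assert (Hb2 := Rle_abs (- b)). rewrite Rabs_Ropp in Hb2.
  assert (HB1 := Rle_abs B).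
  assert (Ha := Rabs_pos a). assert (Hb := Rabs_pos b). assert (Hbb := Rabs_pos B).
  rewrite (int1_RInt f B c) by (try assumption; unfold c; lra).
  rewrite <- (RInt_Chasles_R f (- c) a c), <- (RInt_Chasles_R f a b c) by assumption.
  rewrite (RInt_ext f (fun _ => 0) (- c) a).
  2: { intros t. rewrite Rmin_left, Rmax_right by (unfold c; lra). intros Ht. apply H0; lra. }
  rewrite (RInt_ext f (fun _ => 0) b c).
  2: { intros t. rewrite Rmin_left, Rmax_right by (unfold c; lra). intros Ht. apply H0; lra. }
  rewrite !RInt_const_R.
  assert (RInt f a b <= RInt (fun _ => 1) a b).
  { apply RInt_le; [assumption|now apply cont_ex_RInt|apply cont_ex_RInt, cont_const|auto]. }
  rewrite RInt_const_R in H. lra.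
Qed.

(** A trapezoid: 1 on [[a, b]], 0 beyond distance [th] from it, with slope [1 / th] between. It
    serves for boxes and also as a continuous cutoff of level sets. *)
Definition trap (a b th t : R) : R := Rmax 0 (Rmin 1 (Rmin ((t - a) / th + 1) ((b - t) / th + 1))).

Lemma trap_ge0 a b th t : 0 <= trap a b th t.
Proof. apply Rmax_l. Qed.

Lemma trap_le1 a b th t : trap a b th t <= 1.
Proof. apply Rmax_lub; [lra|apply Rmin_l]. Qed.

Lemma trap_in a b th t : 0 < th -> a <= t <= b -> trap a b th t = 1.
Proof.
  intros Hth Ht. unfold trap.
  assert (0 <= (t - a) / th) by (apply Rdiv_le_0_compat; lra).
  assert (0 <= (b - t) / th) by (apply Rdiv_le_0_compat; lra).
  rewrite Rmin_left; [apply Rmax_right; lra|]. apply Rmin_glb; lra.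
Qed.

Lemma trap_out a b th t : 0 < th -> t < a - th \/ b + th < t -> trap a b th t = 0.
Proof.
  intros Hth Ht. unfold trap. apply Rmax_left.
  eapply Rle_trans; [apply Rmin_r|].
  assert (E : forall u, u < - th -> u / th + 1 <= 0).
  { intros u Hu. apply (Rmult_le_reg_r th); [assumption|].
    replace ((u / th + 1) * th) with (u + th) by (field; lra). lra. }
  destruct Ht as [Ht|Ht]; [eapply Rle_trans; [apply Rmin_l|]|eapply Rle_trans; [apply Rmin_r|]]; apply E; lra.
Qed.

Lemma trap_Cc1 a b th : 0 < th -> Cc1 (trap a b th).
Proof.
  intros Hth. split.
  - unfold trap. apply cont_Rmax; [apply cont_const|]. apply cont_Rmin; [apply cont_const|].
    apply cont_Rmin; (apply cont_plus; [|apply cont_const]); apply cont_mult; try apply cont_const;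
    apply cont_minus; try apply cont_const; apply cont_id.
  - exists (Rabs a + Rabs b + th). intros t Ht. apply trap_out; [assumption|].
    assert (Ha1 := Rle_abs a). assert (Ha2 := Rle_abs (- a)). rewrite Rabs_Ropp in Ha2.
    assert (Hb1 := Rle_abs b). assert (Hb2 := Rle_abs (- b)). rewrite Rabs_Ropp in Hb2.
    assert (Ha := Rabs_pos a). assert (Hb := Rabs_pos b).
    unfold Rabs in Ht at 3. destruct (Rcase_abs t); lra.
Qed.

Lemma box_fun n a b : (forall k, (k < n)%nat -> a k <= b k) -> forall eta, 0 < eta ->
  exists F, Cc n F /\ (forall x, 0 <= F x) /\
    (forall x, (forall k, (k < n)%nat -> a k <= x k <= b k) -> 1 <= F x) /\
    integ n F <= box_vol n a b + eta.
Proof.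
  induction n as [|n IH]; intros Hab eta Heta; simpl.
  { exists (fun _ => 1). repeat split; try (intros; lra); [apply cont_const|].
    exists 0; intros x k Hk; lia. }
  assert (Hn : a n <= b n) by (apply Hab; lia).
  (* The error is split evenly: [e1] times the last edge is at most [eta / 2], and the two ramps of
     width [th] chosen below cost at most [2 * th * integ n F <= eta / 2]. *)
  set (e1 := Rmin 1 (eta / (2 * (b n - a n + 1)))).
  assert (He1 : 0 < e1). { apply Rmin_pos; [lra|]. apply Rdiv_lt_0_compat; lra. }
  assert (He2 : e1 * (b n - a n) <= eta / 2).
  { assert (e1 <= eta / (2 * (b n - a n + 1))) by apply Rmin_r.
    apply Rle_trans with (e1 * (b n - a n + 1)); [nra|].
    apply (Rmult_le_compat_r (b n - a n + 1)) in H; [|lra].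
    replace (eta / (2 * (b n - a n + 1)) * (b n - a n + 1)) with (eta / 2) in H by (field; lra). exact H. }
  destruct (IH (fun k Hk => Hab k (Nat.lt_lt_succ_r _ _ Hk)) e1 He1) as [F [HF [HF0 [HF1 HFI]]]].
  assert (HI0 : 0 <= integ n F) by now apply integ_ge0.
  set (th := eta / (4 * (integ n F + 1))).
  assert (Hth : 0 < th) by (apply Rdiv_lt_0_compat; lra).
  exists (fun x => trap (a n) (b n) th (x n) * F x).
  assert (HFS : cont (dpt (S n)) F).
  { apply (cont_map_le _ (dpt n) (fun x => x)); [|apply HF]. intros; apply Rmax_l. }
  assert (HC : Cc (S n) (fun x => trap (a n) (b n) th (x n) * F x)).
  { split.
    - apply cont_mult; [|assumption].
      apply (cont_map _ dR (fun x : point => x n)); [|apply trap_Cc1; assumption].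
      intros x e He. exists e; split; [assumption|]. intros y Hy.
      eapply Rle_lt_trans; [apply (dpt_coord (S n)); lia|exact Hy].
    - destruct (trap_Cc1 (a n) (b n) th Hth) as [_ [B HB]]. destruct HF as [_ [B' HB']].
      exists (Rmax B B'). intros x k Hk Hx. destruct (Nat.eq_dec k n) as [->|Hkn].
      + rewrite HB; [ring|]. eapply Rle_lt_trans; [apply Rmax_l|exact Hx].
      + rewrite (HB' x k); [ring|lia|]. eapply Rle_lt_trans; [apply Rmax_r|exact Hx]. }
  split; [assumption|]. split; [|split].
  - intros x. apply Rmult_le_pos; [apply trap_ge0|apply HF0].
  - intros x Hx. rewrite trap_in by (try assumption; apply Hx; lia). rewrite Rmult_1_l.
    apply HF1. intros; apply Hx; lia.
  - assert (E : integ n (fun x => int1 (fun t => trap (a n) (b n) th (upd x n t n) * F (upd x n t))) =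
                int1 (trap (a n) (b n) th) * integ n F).
    { rewrite <- integ_scal by assumption. apply integ_ext; intros x.
      rewrite (Rmult_comm _ (F x)), <- int1_scal by now apply trap_Cc1.
      f_equal. apply functional_extensionality; intros t. rewrite upd_same, Rmult_comm. f_equal.
      apply (cont_dpt_ext n); [apply HF|]. intros; apply upd_other; lia. }
    rewrite E.
    assert (Hl : int1 (trap (a n) (b n) th) <= (b n + th) - (a n - th)).
    { apply int1_le_length; [lra|now apply trap_Cc1|apply trap_le1|]. intros t Ht; now apply trap_out. }
    assert (Hth2 : th * (integ n F + 1) = eta / 4) by (unfold th; field; lra).
    apply Rle_trans with (((b n + th) - (a n - th)) * integ n F); [now apply Rmult_le_compat_r|].
    assert ((b n - a n) * integ n F <= (b n - a n) * (box_vol n a b + e1)) by (apply Rmult_le_compat_l; lra).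
    nra.
Qed.

Lemma plateau n B : exists F, Cc n F /\ (forall x, 0 <= F x) /\
  (forall x, (forall k, (k < n)%nat -> Rabs (x k) <= B) -> 1 <= F x).
Proof.
  destruct (box_fun n (fun _ => - Rabs B) (fun _ => Rabs B)) with (eta := 1) as [F [H1 [H2 [H3 _]]]].
  - intros; pose proof (Rabs_pos B); lra.
  - lra.
  - exists F. split; [assumption|]. split; [assumption|]. intros x Hx. apply H3. intros k Hk.
    specialize (Hx k Hk). pose proof (Rle_abs B). apply Rabs_le_between. lra.
Qed.

(** * Finite covers by boxes *)

Definition bdd (n : nat) (S : point -> Prop) : Prop :=
  exists B, forall x, S x -> forall k, (k < n)%nat -> Rabs (x k) <= B.

Lemma box_vol_ge0 n a b : (forall k, (k < n)%nat -> a k <= b k) -> 0 <= box_vol n a b.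
Proof.
  induction n as [|n IH]; intros H; simpl; [lra|].
  apply Rmult_le_pos; [apply IH; intros; apply H; lia|]. specialize (H n (Nat.lt_succ_diag_r n)). lra.
Qed.

Lemma cover_value_ge0 n S s : cover_value n S s -> 0 <= s.
Proof.
  intros [a [b [H1 [_ H3]]]].
  eapply Rle_trans; [|apply (sum_incr (fun j => box_vol n (a j) (b j)) O s H3)].
  - simpl. apply box_vol_ge0; auto.
  - intros j. apply box_vol_ge0; auto.
Qed.

Definition boxes_vol (n : nat) (l : list (point * point)) : R :=
  fold_right (fun p s => box_vol n (fst p) (snd p) + s) 0 l.

(** Finite covers suffice for bounds from above, and they can be concatenated and multiplied by an
    interval, which a slicing argument requires. *)
Definition fincov (n : nat) (S : point -> Prop) (c : R) : Prop :=
  exists l : list (point * point),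
    (forall p, In p l -> forall k, (k < n)%nat -> fst p k <= snd p k) /\
    (forall x, S x -> exists p, In p l /\ forall k, (k < n)%nat -> fst p k <= x k <= snd p k) /\
    c = boxes_vol n l.

Lemma box_vol_orig n : (1 <= n)%nat -> box_vol n orig orig = 0.
Proof. destruct n; [lia|]; intros _; simpl; unfold orig; ring. Qed.

Lemma sum_boxes_nth n l : (1 <= n)%nat -> forall m, (length l <= m)%nat ->
  sum_f_R0 (fun j => box_vol n (fst (nth j l (orig, orig))) (snd (nth j l (orig, orig)))) m = boxes_vol n l.
Proof.
  intros Hn. induction l as [|p l IH]; intros m Hm; simpl in *.
  - apply sum_eq_R0. intros j _. destruct j; apply box_vol_orig; assumption.
  - destruct m as [|m]; [lia|]. rewrite decomp_sum by lia. simpl. f_equal. apply IH; lia.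
Qed.

(** The list is padded by the degenerate box at [orig]. Its volume is 0 only from dimension 1 on,
    since the empty product is 1; hence [1 <= n]. *)
Lemma fincov_cover_value n S c : (1 <= n)%nat -> fincov n S c -> cover_value n S c.
Proof.
  intros Hn [l [H1 [H2 ->]]].
  exists (fun j => fst (nth j l (orig, orig))), (fun j => snd (nth j l (orig, orig))).
  split; [|split].
  - intros j k Hk. destruct (nth_in_or_default j l (orig, orig)) as [Hin| ->]; [now apply H1|simpl; lra].
  - intros x Hx. destruct (H2 x Hx) as [p [Hp Hb]].
    destruct (In_nth l p (orig, orig) Hp) as [j [_ Hj]]. exists j. intros k Hk. rewrite Hj. auto.
  - intros e He. exists (length l). intros m Hm. rewrite sum_boxes_nth by (assumption || lia).
    unfold R_dist. rewrite Rminus_diag, Rabs_R0. lra.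
Qed.

Lemma boxes_vol_app n l1 l2 : boxes_vol n (l1 ++ l2) = boxes_vol n l1 + boxes_vol n l2.
Proof. induction l1 as [|p l1 IH]; simpl; [ring|rewrite IH; ring]. Qed.

Lemma fincov_union n S1 S2 c1 c2 : fincov n S1 c1 -> fincov n S2 c2 ->
  fincov n (fun x => S1 x \/ S2 x) (c1 + c2).
Proof.
  intros [l1 [A1 [B1 ->]]] [l2 [A2 [B2 ->]]]. exists (l1 ++ l2). split; [|split].
  - intros p Hp. apply in_app_or in Hp. destruct Hp; auto.
  - intros x [Hx|Hx]; [destruct (B1 x Hx) as [p [Hp Hb]]|destruct (B2 x Hx) as [p [Hp Hb]]];
    exists p; (split; [apply in_or_app; auto|assumption]).
  - symmetry. apply boxes_vol_app.
Qed.

Lemma fincov_mono n (S S' : point -> Prop) c : (forall x, S' x -> S x) -> fincov n S c -> fincov n S' c.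
Proof. intros H [l [A [B ->]]]. exists l. split; [assumption|]. split; auto. Qed.

Lemma fincov_slab m S c t h : 0 <= h -> fincov m S c ->
  fincov (Datatypes.S m) (fun x => S x /\ t <= x m <= t + h) (c * h).
Proof.
  intros Hh [l [A [B ->]]].
  exists (map (fun p => (upd (fst p) m t, upd (snd p) m (t + h))) l). split; [|split].
  - intros p Hp k Hk. apply in_map_iff in Hp. destruct Hp as [q [<- Hq]]. simpl.
    unfold upd. destruct (Nat.eq_dec k m) as [->|]; [lra|]. apply A; [assumption|lia].
  - intros x [Hx Ht]. destruct (B x Hx) as [p [Hp Hb]].
    exists (upd (fst p) m t, upd (snd p) m (t + h)). split.
    + apply in_map_iff. now exists p.
    + intros k Hk. simpl. unfold upd. destruct (Nat.eq_dec k m) as [->|]; [lra|]. apply Hb; lia.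
  - assert (E : forall a b, box_vol (Datatypes.S m) (upd a m t) (upd b m (t + h)) = box_vol m a b * h).
    { intros a b. simpl. rewrite !upd_same. replace (t + h - t) with h by ring. f_equal.
      assert (E' : forall j, (j <= m)%nat -> box_vol j (upd a m t) (upd b m (t + h)) = box_vol j a b).
      { induction j as [|j IH]; intros Hj; simpl; [reflexivity|].
        rewrite IH, !upd_other by lia. reflexivity. }
      apply E'; lia. }
    clear A B. induction l as [|p l IH]; [simpl; ring|].
    cbn [map boxes_vol fold_right fst snd]. fold (boxes_vol (Datatypes.S m)).
    rewrite E. change (fold_right _ _ l) with (boxes_vol m l). 
    rewrite Rmult_plus_distr_r, IH. reflexivity.
Qed.

(** * Outer measure of bounded sets *)

Lemma bdd_cover n S : (1 <= n)%nat -> bdd n S -> exists s, cover_value n S s.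
Proof.
  intros Hn [B HB]. 
  exists (boxes_vol n [((fun _ => - Rabs B), (fun _ => Rabs B))]).
  apply fincov_cover_value; [assumption|].
  eexists; split; [|split]; [| |reflexivity].
  - intros p [<-|[]] k _. simpl. pose proof (Rabs_pos B); lra.
  - intros x Hx. eexists; split; [left; reflexivity|]. intros k Hk. simpl.
    specialize (HB x Hx k Hk). pose proof (Rle_abs B). apply Rabs_le_between. lra.
Qed.

(** [epsilon] returns an infimum only if there is one. Boundedness provides a cover, the values of
    covers are nonnegative, and completeness is applied to their opposites. *)
Lemma Vol_is_inf n S : (1 <= n)%nat -> bdd n S -> is_inf (cover_value n S) (Vol n S).
Proof.
  intros Hn HS. unfold Vol. apply epsilon_spec.
  destruct (completeness (fun v => cover_value n S (- v))) as [m [Hm1 Hm2]].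
  - exists 0. intros v Hv. apply cover_value_ge0 in Hv. lra.
  - destruct (bdd_cover n S Hn HS) as [s Hs]. exists (- s). now rewrite Ropp_involutive.
  - exists (- m). split.
    + intros s Hs. assert (- s <= m); [|lra]. apply Hm1. cbv beta. now rewrite Ropp_involutive.
    + intros w Hw. assert (m <= - w); [|lra]. apply Hm2. intros v Hv. specialize (Hw _ Hv). lra.
Qed.

Lemma bdd_mono n (S S' : point -> Prop) : (forall x, S' x -> S x) -> bdd n S -> bdd n S'.
Proof. intros H [B HB]. exists B. auto. Qed.

Lemma box_vol_scale n lam a b :
  box_vol n (fun k => lam * a k) (fun k => lam * b k) = lam ^ n * box_vol n a b.
Proof. induction n as [|n IH]; simpl; [ring|]. rewrite IH. ring. Qed.

(** Dilating a cover of [S] by [lam] multiplies each box volume by [lam ^ n]. Only an inclusion into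
    the dilate is asked, so inclusion and scaling are used in one step. *)
Lemma Vol_scale_le n (S S' : point -> Prop) lam : (1 <= n)%nat -> bdd n S -> 0 < lam ->
  (forall x, S' x -> S (fun k => / lam * x k)) -> Vol n S' <= lam ^ n * Vol n S.
Proof.
  intros Hn HS Hlam H.
  assert (HS' : bdd n S').
  { destruct HS as [B HB]. exists (lam * B). intros x Hx k Hk.
    specialize (HB _ (H x Hx) k Hk). cbv beta in HB. rewrite Rabs_mult, (Rabs_pos_eq (/ lam)) in HB by (left; now apply Rinv_0_lt_compat).
    apply (Rmult_le_compat_l lam) in HB; [|lra].
    replace (lam * (/ lam * Rabs (x k))) with (Rabs (x k)) in HB by (field; lra). assumption. }
  assert (Hp : 0 < lam ^ n) by now apply pow_lt.
  assert (Hle : / lam ^ n * Vol n S' <= Vol n S).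
  { apply (Vol_is_inf n S Hn HS). intros s [a [b [H1 [H2 H3]]]].
    assert (Hc : cover_value n S' (lam ^ n * s)).
    { exists (fun j k => lam * a j k), (fun j k => lam * b j k). split; [|split].
      - intros j k Hk. apply Rmult_le_compat_l; [lra|auto].
      - intros x Hx. destruct (H2 _ (H x Hx)) as [j Hj]. exists j. intros k Hk. specialize (Hj k Hk).
        replace (x k) with (lam * (/ lam * x k)) by (field; lra).
        split; apply Rmult_le_compat_l; lra.
      - apply (Un_cv_ext (fun m => lam ^ n * sum_f_R0 (fun j => box_vol n (a j) (b j)) m)).
        + intros m. rewrite scal_sum. apply sum_eq. intros j _. 
          change (box_vol n (fun k => lam * a j k) (fun k => lam * b j k)) with
            (box_vol n (fun k => lam * (a j) k) (fun k => lam * (b j) k)).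
          rewrite box_vol_scale. ring.
        + apply CV_mult; [|assumption]. intros e He. exists O. intros. unfold R_dist. rewrite Rminus_diag, Rabs_R0. lra. }
    apply (Vol_is_inf n S' Hn HS') in Hc.
    apply (Rmult_le_reg_l (lam ^ n)); [assumption|]. rewrite <- Rmult_assoc, Rinv_r by lra. lra. }
  apply (Rmult_le_compat_l (lam ^ n)) in Hle; [|lra]. rewrite <- Rmult_assoc, Rinv_r in Hle by lra. lra.
Qed.

Lemma rsum_sum_f_R0 f J : rsum (S J) f = sum_f_R0 f J.
Proof. induction J as [|J IH]; [simpl; ring|]. rewrite tech5, <- IH. reflexivity. Qed.

Lemma rsum_geom J e : rsum J (fun j => e * (/ 2) ^ S j) = e * (1 - (/ 2) ^ J).
Proof. induction J as [|J IH]; cbn [rsum]; [simpl; ring|]. rewrite IH. simpl. field. Qed.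

(** The covering boxes are replaced by continuous trapezoids; Dini's theorem handles the infinite cover. *)
Lemma integ_le_Vol n S f : (1 <= n)%nat -> bdd n S -> Cc n f ->
  (forall x, f x <= 1) -> (forall x, ~ S x -> f x <= 0) -> integ n f <= Vol n S.
Proof.
  intros Hn HS Hf H1 H0. apply (Vol_is_inf n S Hn HS). intros s [a [b [Hab [Hcov Hcv]]]].
  apply Rle_plus_epsilon. intros eps Heps.
  assert (HF : forall j, exists F, Cc n F /\ (forall x, 0 <= F x) /\
    (forall x, (forall k, (k < n)%nat -> a j k <= x k <= b j k) -> 1 <= F x) /\
    integ n F <= box_vol n (a j) (b j) + eps / 2 * (/ 2) ^ Datatypes.S j).
  { intros j. apply box_fun; [auto|]. apply Rmult_lt_0_compat; [lra|]. apply pow_lt; lra. }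
  pose (F := fun j => proj1_sig (constructive_indefinite_description _ (HF j))).
  assert (HF' : forall j, Cc n (F j) /\ (forall x, 0 <= F j x) /\
    (forall x, (forall k, (k < n)%nat -> a j k <= x k <= b j k) -> 1 <= F j x) /\
    integ n (F j) <= box_vol n (a j) (b j) + eps / 2 * (/ 2) ^ Datatypes.S j).
  { intros j. unfold F. destruct (constructive_indefinite_description _ (HF j)); auto. }
  clearbody F. clear HF.
  assert (HFC : forall j, Cc n (F j)) by apply HF'.
  set (T := fun J x => rsum J (fun j => F j x)).
  assert (HT : forall J, Cc n (T J)) by (intros J; apply Cc_rsum; auto).
  assert (HT0 : forall J x, 0 <= T J x) by (intros J x; apply rsum_ge0; intros; apply HF').
  (* The part of [f] not yet covered by the first [J] boxes decreases to 0 everywhere: on [S] a box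
     containing the point contributes at least 1 while [f <= 1], and off [S] already [f <= 0]. *)
  set (g := fun J x => Rmax 0 (f x - T J x)).
  assert (Hg : forall J, Cc n (g J)).
  { intros J. split.
    - apply cont_Rmax; [apply cont_const|]. apply cont_minus; [apply Hf|apply HT].
    - destruct Hf as [_ [B HB]]. exists B. intros x k Hk Hx. unfold g. rewrite (HB x k Hk Hx).
      apply Rmax_left. specialize (HT0 J x). lra. }
  destruct (integ_dini n g) with (eps := eps / 2) as [J HJ]; try assumption.
  - intros J x. apply Rmax_l.
  - intros J x. unfold g. apply Rle_max_compat_l. unfold T; simpl. destruct (HF' J) as [_ [Hp _]]. specialize (Hp x). lra.
  - intros x e He. destruct (classic (S x)) as [Hx|Hx].
    + destruct (Hcov x Hx) as [j Hj]. exists (Datatypes.S j). unfold g. rewrite Rmax_left; [assumption|].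
      unfold T; simpl. destruct (HF' j) as [_ [_ [Hp _]]]. specialize (Hp x Hj). specialize (H1 x).
      assert (0 <= rsum j (fun j => F j x)) by (apply rsum_ge0; intros; apply HF'). lra.
    + exists O. unfold g. rewrite Rmax_left; [assumption|]. specialize (H0 x Hx). specialize (HT0 O x). lra.
  - lra.
  - assert (E1 : integ n f <= integ n (fun x => g J x + T J x)).
    { apply integ_le; [assumption|now apply Cc_plus|]. intros x. unfold g.
      pose proof (Rmax_r 0 (f x - T J x)). lra. }
    rewrite integ_plus in E1 by auto. unfold T in E1. rewrite integ_rsum in E1 by auto.
    assert (E2 : rsum J (fun j => integ n (F j)) <= rsum J (fun j => box_vol n (a j) (b j)) + eps / 2).
    { eapply Rle_trans; [apply rsum_le; intros j _; apply HF'|].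
      rewrite rsum_plus, rsum_geom.
      assert (0 < (/ 2) ^ J) by (apply pow_lt; lra). nra. }
    assert (E3 : rsum J (fun j => box_vol n (a j) (b j)) <= s).
    { destruct J as [|J]; [simpl; apply (cover_value_ge0 n S); exists a, b; auto|].
      rewrite rsum_sum_f_R0. apply sum_incr; [assumption|]. intros; apply box_vol_ge0; auto. }
    lra.
Qed.

(** * Covering superlevel sets of Lipschitz functions *)

(** The l^1 distance is chosen so that moving one coordinate costs exactly its increment, as slicing
    needs. *)
Definition lipn (n : nat) (L : R) (f : point -> R) : Prop :=
  forall x y, Rabs (f y - f x) <= L * rsum n (fun k => Rabs (y k - x k)).

Lemma lipn_cont n L f : lipn n L f -> cont (dpt n) f.
Proof.
  intros Hf x e He.
  set (K := Rabs L * INR n + 1).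
  assert (HK : 0 < K). { unfold K. pose proof (Rabs_pos L); pose proof (pos_INR n); nra. }
  exists (e / K). split; [now apply Rdiv_lt_0_compat|]. intros y Hy.
  eapply Rle_lt_trans; [apply Hf|].
  assert (H : rsum n (fun k => Rabs (y k - x k)) <= INR n * dpt n x y).
  { rewrite <- rsum_const. apply rsum_le. intros; now apply dpt_coord. }
  assert (H0 : 0 <= rsum n (fun k => Rabs (y k - x k))) by (apply rsum_ge0; intros; apply Rabs_pos).
  assert (Hd : dpt n x y * K < e).
  { apply (Rmult_lt_compat_r K) in Hy; [|assumption]. replace (e / K * K) with e in Hy by (field; lra). assumption. }
  pose proof (Rle_abs L). pose proof (Rabs_pos L). pose proof (dpt_ge0 n x y).
  apply Rle_lt_trans with (Rabs L * (INR n * dpt n x y)); [|unfold K in Hd; nra].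
  apply Rle_trans with (Rabs L * rsum n (fun k => Rabs (y k - x k))); [nra|].
  apply Rmult_le_compat_l; assumption.
Qed.

Lemma rsum_upd_diff m x s t (y := upd x m s) :
  rsum (S m) (fun k => Rabs (upd x m t k - y k)) = Rabs (t - s).
Proof.
  simpl. unfold y. rewrite !upd_same. rewrite (rsum_ext m _ (fun _ => 0)).
  - rewrite rsum_0; ring.
  - intros k Hk. rewrite !upd_other by lia. rewrite Rminus_diag. apply Rabs_R0.
Qed.

Lemma riemann_upper g L B h M : 0 <= h -> 0 <= L -> (forall s t, Rabs (g t - g s) <= L * Rabs (t - s)) ->
  rsum M (fun l => h * g (- B + INR l * h)) <= RInt g (- B) (- B + INR M * h) + INR M * h * (L * h).
Proof.
  intros Hh HL Hg.
  assert (Hc : cont dR g).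
  { intros x e He. exists (e / (L + 1)). split; [apply Rdiv_lt_0_compat; lra|]. intros y Hy. unfold dR in Hy.
    eapply Rle_lt_trans; [apply Hg|].
    apply (Rmult_lt_compat_r (L + 1)) in Hy; [|lra]. replace (e / (L + 1) * (L + 1)) with e in Hy by (field; lra).
    pose proof (Rabs_pos (y - x)). nra. }
  induction M as [|M IH].
  - simpl rsum. change (INR 0) with 0. rewrite !Rmult_0_l, !Rplus_0_r, RInt_point_R. lra.
  - cbn [rsum]. rewrite S_INR.
    rewrite <- (RInt_Chasles_R g (- B) (- B + INR M * h)) by assumption.
    assert (H : h * (g (- B + INR M * h) - L * h) <= RInt g (- B + INR M * h) (- B + (INR M + 1) * h)).
    { replace h with ((- B + (INR M + 1) * h) - (- B + INR M * h)) at 1 by ring.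
      rewrite <- RInt_const_R. apply RInt_le.
      - nra.
      - apply cont_ex_RInt, cont_const.
      - now apply cont_ex_RInt.
      - intros t Ht. specialize (Hg (- B + INR M * h) t).
        assert (Ht' : Rabs (t - (- B + INR M * h)) <= h) by (apply Rabs_le_between; lra).
        apply Rabs_le_between in Hg. nra. }
    lra.
Qed.

(** Induction by slicing. On a slab of height [h] the function varies by at most [u = L * h], so
    where [f >= 1] the slice at the lower face is at least [1 - u]. A cover for the slice divided by
    [1 - u], times the height of the slab, covers that part of the set, and the total is a Riemann
    sum of integrals of slices. *)
Lemma cover_upper n : forall f L B, 0 <= L -> lipn n L f -> supp n B f -> (forall x, 0 <= f x) ->
  forall eta, 0 < eta -> exists c, fincov n (fun x => 1 <= f x) c /\ c <= integ n f + eta.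
Proof.
  induction n as [|m IH]; intros f L B0 HL Hlip HB0 Hp eta Heta.
  - assert (E : forall x, f x = f orig).
    { intros x. specialize (Hlip orig x). simpl in Hlip. rewrite Rmult_0_r in Hlip.
      pose proof (Rabs_pos (f x - f orig)). assert (Rabs (f x - f orig) = 0) by lra.
      destruct (Req_dec (f x - f orig) 0); [lra|]. now apply Rabs_no_R0 in H0. }
    destruct (Rle_dec 1 (f orig)) as [H|H].
    + exists 1. split; [|simpl; lra]. exists [(orig, orig)]. split; [|split].
      * intros p _ k Hk; lia.
      * intros x _. exists (orig, orig). split; [now left|intros; lia].
      * simpl; ring.
    + exists 0. split; [|simpl; specialize (Hp orig); lra]. exists []. split; [|split].
      * intros p [].
      * intros x Hx. rewrite E in Hx. contradiction.
      * reflexivity.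
  (* Strictly larger than [B0], so that the half-open slabs between [- B] and [B] contain the whole
     set to be covered. *)
  - set (B := Rabs B0 + 1). assert (HBp : 0 < B) by (unfold B; pose proof (Rabs_pos B0); lra).
    assert (HB0B : B0 < B) by (unfold B; pose proof (Rle_abs B0); lra).
    assert (HB : supp (S m) B f) by (eapply supp_le; [|exact HB0]; lra).
    assert (HCf : Cc (S m) f) by (split; [now apply (lipn_cont _ L)|now exists B]).
    (* The Riemann sum errs by at most [2 * B * u], uniformly in the remaining coordinates; [chi]
       turns this into an integrable error of size [2 * B * u * K]. *)
    destruct (plateau m B) as [chi [Hchi [Hchi0 Hchi1]]].
    set (K := integ m chi). assert (HK : 0 <= K) by now apply integ_ge0.
    set (A := integ (S m) f). assert (HA : 0 <= A) by now apply integ_ge0.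
    (* Since [/ (1 - u) <= 1 + 2 * u], the final error is [2uA + 2BuK + 4Bu^2K]; with [u <= 1/2] the
       bound [u0] keeps it below [eta / 2]. The other half of [eta] goes to the covers of the
       slices. *)
    set (u0 := Rmin (/ 2) (eta / (2 * (2 * A + 4 * B * K + 1)))).
    assert (HD : 0 < 2 * A + 4 * B * K + 1) by nra.
    assert (Hu0 : 0 < u0). { apply Rmin_pos; [lra|]. apply Rdiv_lt_0_compat; lra. }
    assert (Hu1 : u0 <= / 2) by apply Rmin_l.
    assert (Hu2 : u0 * (2 * A + 4 * B * K + 1) <= eta / 2).
    { assert (H : u0 <= eta / (2 * (2 * A + 4 * B * K + 1))) by apply Rmin_r.
      apply (Rmult_le_compat_r (2 * A + 4 * B * K + 1)) in H; [|lra].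
      replace (eta / (2 * (2 * A + 4 * B * K + 1)) * (2 * A + 4 * B * K + 1)) with (eta / 2) in H by (field; lra). exact H. }
    destruct (INR_unbounded (2 * B * (L + 1) / u0)) as [M HM].
    assert (HMp : 0 < INR M).
    { eapply Rle_lt_trans; [|exact HM]. apply Rdiv_le_0_compat; [|assumption]. nra. }
    set (h := 2 * B / INR M). assert (Hh : 0 < h) by (apply Rdiv_lt_0_compat; lra).
    assert (HMh : INR M * h = 2 * B) by (unfold h; field; lra).
    assert (Hu : (L + 1) * h <= u0).
    { apply (Rmult_lt_compat_r u0) in HM; [|assumption].
      replace (2 * B * (L + 1) / u0 * u0) with (2 * B * (L + 1)) in HM by (field; lra).
      apply (Rmult_le_reg_r (INR M)); [assumption|].
      replace ((L + 1) * h * INR M) with ((L + 1) * (INR M * h)) by ring. rewrite HMh. lra. }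
    set (u := L * h). assert (Huu : 0 <= u <= u0) by (unfold u; split; nra).
    set (eta' := eta / (4 * B)). assert (Heta' : 0 < eta') by (apply Rdiv_lt_0_compat; lra).
    set (t := fun l => - B + INR l * h).
    set (fl := fun l x => / (1 - u) * f (upd x m (t l))).
    assert (Hinv : 0 < / (1 - u)) by (apply Rinv_0_lt_compat; lra).
    assert (Hsl : forall l, Cc m (fun x => f (upd x m (t l)))).
    { intros l. split.
      - apply (cont_map_le _ (dpt (S m)) (fun x => upd x m (t l))); [|apply HCf].
        intros x y. rewrite dpt_upd, Rminus_diag, Rabs_R0. apply Rmax_lub; [lra|apply dpt_ge0].
      - exists B. intros x k Hk Hx. apply (HB _ k); [lia|]. now rewrite upd_other by lia. }
    assert (Hfl : forall l, exists c, fincov m (fun x => 1 <= fl l x) c /\ c <= integ m (fl l) + eta').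
    { intros l. apply (IH (fl l) (/ (1 - u) * L) B).
      - nra.
      - intros x y. unfold fl.
        replace (/ (1 - u) * f (upd y m (t l)) - / (1 - u) * f (upd x m (t l)))
          with (/ (1 - u) * (f (upd y m (t l)) - f (upd x m (t l)))) by ring.
        rewrite Rabs_mult, (Rabs_pos_eq (/ (1 - u))), Rmult_assoc by lra.
        apply Rmult_le_compat_l; [lra|]. eapply Rle_trans; [apply Hlip|].
        apply Rmult_le_compat_l; [assumption|]. simpl. rewrite !upd_same, Rminus_diag, Rabs_R0, Rplus_0_r.
        apply Req_le, rsum_ext. intros k Hk. now rewrite !upd_other by lia.
      - intros x k Hk Hx. unfold fl. rewrite (HB _ k); [ring|lia|]. now rewrite upd_other by lia.
      - intros x. unfold fl. apply Rmult_le_pos; [lra|apply Hp].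
      - assumption. }
    assert (Hcov : forall j, exists c, fincov (S m) (fun x => 1 <= f x /\ - B <= x m < t j) c /\
         c <= rsum j (fun l => (integ m (fl l) + eta') * h)).
    { induction j as [|j IHj].
      - exists 0. split; [|simpl; lra]. exists []. split; [|split].
        + intros p [].
        + intros x [_ Hx]. unfold t in Hx. simpl in Hx. lra.
        + reflexivity.
      - destruct IHj as [c1 [Hc1 Hle1]]. destruct (Hfl j) as [c2 [Hc2 Hle2]].
        exists (c1 + c2 * h). split; [|simpl; apply Rplus_le_compat; [assumption|]; apply Rmult_le_compat_r; lra].
        eapply fincov_mono; [|apply (fincov_union _ _ _ _ _ Hc1 (fincov_slab m _ _ (t j) h (Rlt_le _ _ Hh) Hc2))].
        intros x [Hx1 Hx2]. destruct (Rlt_or_le (x m) (t j)) as [Hlt|Hge]; [left; split; [assumption|lra]|right].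
        assert (Htj : t (S j) = t j + h) by (unfold t; rewrite S_INR; ring).
        split; [|lra]. unfold fl.
        specialize (Hlip x (upd x m (t j))).
        replace (rsum (S m) (fun k => Rabs (upd x m (t j) k - x k))) with (Rabs (t j - x m)) in Hlip.
        2: { rewrite <- (rsum_upd_diff m x (x m) (t j)). apply rsum_ext. intros k Hk. do 2 f_equal.
             unfold upd. now destruct (Nat.eq_dec k m) as [->|]. }
        rewrite (Rabs_left1 (t j - x m)) in Hlip by lra. apply Rabs_le_between in Hlip.
        assert (L * - (t j - x m) <= u) by (unfold u; apply Rmult_le_compat_l; lra).
        apply (Rmult_le_reg_l (1 - u)); [lra|]. rewrite <- Rmult_assoc, Rinv_r by lra. lra. }
    destruct (Hcov M) as [c [Hc Hle]]. exists c. split.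
    + eapply fincov_mono; [|exact Hc]. intros x Hx. split; [assumption|].
      assert (Hxm : Rabs (x m) <= B0).
      { apply Rnot_lt_le. intros Hn. rewrite (HB0 x m) in Hx; [lra|lia|assumption]. }
      apply Rabs_le_between in Hxm. unfold t. rewrite HMh. lra.
    + eapply Rle_trans; [exact Hle|].
      rewrite (rsum_ext M _ (fun l => / (1 - u) * integ m (fun x => h * f (upd x m (t l))) + eta' * h)).
      2: { intros l _. rewrite integ_scal by auto. unfold fl. rewrite integ_scal by auto. ring. }
      rewrite rsum_plus, rsum_const, rsum_scal, <- integ_rsum by (intros; now apply Cc_scal).
      replace (INR M * (eta' * h)) with (eta / 2).
      2: { replace (INR M * (eta' * h)) with (eta' * (INR M * h)) by ring. rewrite HMh. unfold eta'; field; lra. }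
      assert (HI : integ m (fun x => rsum M (fun l => h * f (upd x m (t l)))) <= A + 2 * B * u * K).
      { unfold A, K. simpl integ. rewrite <- integ_scal, <- integ_plus by (assumption || (now apply Cc_int1) || (now apply Cc_scal)).
        apply integ_le.
        - apply Cc_rsum. intros; now apply Cc_scal.
        - apply Cc_plus; [now apply Cc_int1|now apply Cc_scal].
        - intros x. destruct (classic (exists k, (k < m)%nat /\ B < Rabs (x k))) as [[k [Hk Hx]]|Hx].
          + rewrite (rsum_ext M _ (fun _ => 0)).
            2: { intros l _. rewrite (HB _ k); [ring|lia|]. now rewrite upd_other by lia. }
            rewrite rsum_0. apply Rplus_le_le_0_compat.
            * apply int1_ge0; [now apply Cc_slice|auto].
            * apply Rmult_le_pos; [nra|apply Hchi0].
          + assert (H1 : 1 <= chi x).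
            { apply Hchi1. intros k Hk. apply Rnot_lt_le. intros Hlt. apply Hx. now exists k. }
            eapply Rle_trans; [apply (riemann_upper (fun s => f (upd x m s)) L B h M)|]; [lra|assumption| |].
            * intros s t'. eapply Rle_trans; [apply Hlip|]. rewrite rsum_upd_diff. lra.
            * rewrite HMh. replace (- B + 2 * B) with B by ring.
              rewrite (int1_RInt (fun s => f (upd x m s)) B B); try lra.
              -- fold u. assert (0 <= 2 * B * u) by nra. nra.
              -- now apply Cc_slice.
              -- now apply supp_upd. }
      assert (Hi2 : / (1 - u) <= 1 + 2 * u).
      { apply (Rmult_le_reg_l (1 - u)); [lra|]. rewrite Rinv_r by lra. nra. }
      assert (HBK : 0 <= B * K) by nra.
      apply Rle_trans with ((1 + 2 * u) * (A + 2 * B * u * K) + eta / 2).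
      * apply Rplus_le_compat_r. apply Rle_trans with (/ (1 - u) * (A + 2 * B * u * K)).
        -- apply Rmult_le_compat_l; lra.
        -- apply Rmult_le_compat_r; [nra|assumption].
      * assert (u * (2 * A + 4 * B * K + 1) <= eta / 2).
        { eapply Rle_trans; [|exact Hu2]. apply Rmult_le_compat_r; lra. }
        assert (HX : 0 <= u * (B * K)) by nra.
        assert (2 * u * (2 * B * u * K) <= 2 * B * u * K) by nra. nra.
Qed.

Lemma Vol_le_integ n S f L B : (1 <= n)%nat -> 0 <= L -> lipn n L f -> supp n B f -> (forall x, 0 <= f x) ->
  (forall x, S x -> 1 <= f x) -> Vol n S <= integ n f.
Proof.
  intros Hn HL Hlip HB Hp H1. apply Rle_plus_epsilon. intros eps Heps.
  destruct (cover_upper n f L B HL Hlip HB Hp eps Heps) as [c [Hc Hle]].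
  eapply Rle_trans; [|exact Hle].
  assert (HS : bdd n S).
  { exists B. intros x Hx k Hk. apply Rnot_lt_le. intros Hlt. specialize (H1 x Hx).
    rewrite (HB x k Hk Hlt) in H1. lra. }
  apply (Vol_is_inf n S Hn HS). apply fincov_cover_value; [assumption|].
  eapply fincov_mono; [|exact Hc]. assumption.
Qed.

(** * Inner product and Euclidean norm *)

Definition dot (n : nat) (x y : point) : R := rsum n (fun k => x k * y k).
Definition nrm (n : nat) (x : point) : R := sqrt (dot n x x).

Lemma Rabs_m1 : Rabs (-1) = 1.
Proof. rewrite Rabs_left by lra. ring. Qed.

Lemma dot_comm n x y : dot n x y = dot n y x.
Proof. apply rsum_ext; intros; ring. Qed.

Lemma dot_plus_l n x y z : dot n (fun k => x k + y k) z = dot n x z + dot n y z.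
Proof. unfold dot. rewrite <- rsum_plus. apply rsum_ext; intros; ring. Qed.

Lemma dot_minus_l n x y z : dot n (fun k => x k - y k) z = dot n x z - dot n y z.
Proof. unfold dot. rewrite <- rsum_minus. apply rsum_ext; intros; ring. Qed.

Lemma dot_scal_l n c x z : dot n (fun k => c * x k) z = c * dot n x z.
Proof. unfold dot. rewrite <- rsum_scal. apply rsum_ext; intros; ring. Qed.

Lemma dot_plus_r n x y z : dot n z (fun k => x k + y k) = dot n z x + dot n z y.
Proof. rewrite !(dot_comm n z). apply dot_plus_l. Qed.

Lemma dot_minus_r n x y z : dot n z (fun k => x k - y k) = dot n z x - dot n z y.
Proof. rewrite !(dot_comm n z). apply dot_minus_l. Qed.

Lemma dot_scal_r n c x z : dot n z (fun k => c * x k) = c * dot n z x.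
Proof. rewrite !(dot_comm n z). apply dot_scal_l. Qed.

Lemma dot_ext n x y x' y' : (forall k, (k < n)%nat -> x k = x' k) ->
  (forall k, (k < n)%nat -> y k = y' k) -> dot n x y = dot n x' y'.
Proof. intros H H'. apply rsum_ext; intros k Hk. now rewrite H, H'. Qed.

Lemma dot_self_ge0 n x : 0 <= dot n x x.
Proof. apply rsum_ge0; intros; apply Rle_0_sqr. Qed.

Lemma dot_self_eq0 n x : dot n x x = 0 -> forall k, (k < n)%nat -> x k = 0.
Proof.
  intros H k Hk. apply Rsqr_0_uniq. apply Rle_antisym; [|apply Rle_0_sqr].
  rewrite <- H. apply (rsum_term n (fun k => x k * x k)); [intros; apply Rle_0_sqr|assumption].
Qed.

Lemma dot_CS n x y : dot n x y * dot n x y <= dot n x x * dot n y y.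
Proof.
  assert (H : forall l, 0 <= dot n x x - 2 * l * dot n x y + l * l * dot n y y).
  { intros l. pose proof (dot_self_ge0 n (fun k => x k - l * y k)) as H.
    rewrite dot_minus_l, !dot_minus_r, !dot_scal_l, !dot_scal_r, (dot_comm n y x) in H. lra. }
  pose proof (dot_self_ge0 n x) as Hx. pose proof (dot_self_ge0 n y) as Hy.
  destruct (Req_dec (dot n y y) 0) as [E|E].
  - rewrite E. rewrite E in H.
    assert (dot n x y = 0); [|nra].
    pose proof (H ((dot n x x + 1) / (2 * dot n x y))) as H'.
    destruct (Req_dec (dot n x y) 0) as [E'|E']; [assumption|].
    replace (2 * ((dot n x x + 1) / (2 * dot n x y)) * dot n x y) with (dot n x x + 1) in H' by (field; assumption). lra.
  - specialize (H (dot n x y / dot n y y)).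
    apply (Rmult_le_compat_r (dot n y y)) in H; [|assumption].
    replace ((dot n x x - 2 * (dot n x y / dot n y y) * dot n x y + dot n x y / dot n y y * (dot n x y / dot n y y) * dot n y y) * dot n y y)
      with (dot n x x * dot n y y - dot n x y * dot n x y) in H by (field; assumption). lra.
Qed.

Lemma dot_orig n x : dot n orig x = 0.
Proof. unfold dot, orig. rewrite (rsum_ext n _ (fun _ => 0)) by (intros; ring). apply rsum_0. Qed.

Lemma nrm_orig n : nrm n orig = 0.
Proof. unfold nrm. rewrite dot_orig. apply sqrt_0. Qed.

Lemma nrm_ge0 n x : 0 <= nrm n x.
Proof. apply sqrt_pos. Qed.

Lemma nrm_sq n x : nrm n x * nrm n x = dot n x x.
Proof. apply sqrt_sqrt, dot_self_ge0. Qed.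

Lemma nrm_ext n x y : (forall k, (k < n)%nat -> x k = y k) -> nrm n x = nrm n y.
Proof. intros H. unfold nrm. f_equal. now apply dot_ext. Qed.

Lemma Rabs_le_of_sqr a b : 0 <= b -> a * a <= b * b -> Rabs a <= b.
Proof. intros Hb H. apply Rsqr_le_abs_0 in H. rewrite (Rabs_pos_eq b Hb) in H. assumption. Qed.

Lemma dot_le_nrm n x y : Rabs (dot n x y) <= nrm n x * nrm n y.
Proof.
  apply Rabs_le_of_sqr; [apply Rmult_le_pos; apply nrm_ge0|].
  replace (nrm n x * nrm n y * (nrm n x * nrm n y)) with ((nrm n x * nrm n x) * (nrm n y * nrm n y)) by ring.
  rewrite !nrm_sq. apply dot_CS.
Qed.

Lemma nrm_triangle n x y : nrm n (fun k => x k + y k) <= nrm n x + nrm n y.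
Proof.
  pose proof (nrm_ge0 n x). pose proof (nrm_ge0 n y).
  eapply Rle_trans; [apply Rle_abs|]. apply Rabs_le_of_sqr; [lra|].
  rewrite nrm_sq, dot_plus_l, !dot_plus_r, (dot_comm n y x), <- !nrm_sq.
  pose proof (dot_le_nrm n x y) as H1. pose proof (Rle_abs (dot n x y)). nra.
Qed.

Lemma nrm_scal n c x : nrm n (fun k => c * x k) = Rabs c * nrm n x.
Proof.
  unfold nrm. rewrite dot_scal_l, dot_scal_r, <- Rmult_assoc, sqrt_mult_alt by apply Rle_0_sqr.
  f_equal. apply sqrt_Rsqr_abs.
Qed.

Lemma nrm_le_sum n x : nrm n x <= rsum n (fun k => Rabs (x k)).
Proof.
  assert (H0 : 0 <= rsum n (fun k => Rabs (x k))) by (apply rsum_ge0; intros; apply Rabs_pos).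
  eapply Rle_trans; [apply Rle_abs|]. apply Rabs_le_of_sqr; [assumption|]. rewrite nrm_sq.
  unfold dot. clear H0. induction n as [|n IH]; simpl; [lra|].
  assert (H0 : 0 <= rsum n (fun k => Rabs (x k))) by (apply rsum_ge0; intros; apply Rabs_pos).
  pose proof (Rabs_pos (x n)).
  assert (x n * x n = Rabs (x n) * Rabs (x n)) by (rewrite <- Rabs_mult; symmetry; apply Rabs_pos_eq, Rle_0_sqr).
  nra.
Qed.

Lemma coord_le_nrm n x k : (k < n)%nat -> Rabs (x k) <= nrm n x.
Proof.
  intros Hk. apply Rabs_le_of_sqr; [apply nrm_ge0|]. rewrite nrm_sq.
  apply (rsum_term n (fun k => x k * x k)); [intros; apply Rle_0_sqr|assumption].
Qed.

Lemma nrm_le_coords n x B : (forall k, (k < n)%nat -> Rabs (x k) <= B) -> nrm n x <= INR n * B.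
Proof.
  intros H. eapply Rle_trans; [apply nrm_le_sum|]. rewrite <- rsum_const. now apply rsum_le.
Qed.

Lemma nrm_lip n : lipn n 1 (nrm n).
Proof.
  intros x y. rewrite Rmult_1_l.
  assert (H : forall u v, nrm n v - nrm n u <= rsum n (fun k => Rabs (v k - u k))).
  { intros u v. eapply Rle_trans; [|apply (nrm_le_sum n (fun k => v k - u k))].
    pose proof (nrm_triangle n (fun k => v k - u k) u) as H. cbv beta in H.
    rewrite (nrm_ext n (fun k => v k - u k + u k) v) in H by (intros; ring). lra. }
  apply Rabs_le_between. split; [|apply H].
  specialize (H y x). rewrite (rsum_ext n (fun k => Rabs (y k - x k)) (fun k => Rabs (x k - y k))) by (intros; apply Rabs_minus_sym).
  lra.
Qed.

Lemma cont_nrm n : cont (dpt n) (nrm n).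
Proof. apply (lipn_cont n 1), nrm_lip. Qed.

Lemma bump_Cc n c : Cc n (fun x => Rmax 0 (c - nrm n x)).
Proof.
  split.
  - apply cont_Rmax; [apply cont_const|]. apply cont_minus; [apply cont_const|apply cont_nrm].
  - exists c. intros x k Hk Hx. apply Rmax_left. pose proof (coord_le_nrm n x k Hk). lra.
Qed.

Lemma bump_integ_pos n c : 0 < c -> 0 < integ n (fun x => Rmax 0 (c - nrm n x)).
Proof.
  intros Hc. apply (integ_pos n _ orig (bump_Cc n c)); [intros; apply Rmax_l|].
  rewrite nrm_orig, Rmax_right; lra.
Qed.

Lemma cont_dot n a : cont (dpt n) (dot n a).
Proof. apply cont_rsum. intros k Hk. now apply cont_scal, cont_coord. Qed.

Lemma sqdist_dot n x y : sqdist n x y = dot n (fun k => x k - y k) (fun k => x k - y k).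
Proof. induction n as [|n IH]; simpl; [reflexivity|]. unfold dot in *; simpl. rewrite IH. ring. Qed.

Lemma edist_nrm n x y : edist n x y = nrm n (fun k => x k - y k).
Proof. unfold edist, nrm. now rewrite sqdist_dot. Qed.

Lemma edist_ext n x y x' y' : (forall k, (k < n)%nat -> x k = x' k) ->
  (forall k, (k < n)%nat -> y k = y' k) -> edist n x y = edist n x' y'.
Proof. intros H H'. rewrite !edist_nrm. apply nrm_ext. intros k Hk. now rewrite H, H'. Qed.

Lemma edist_sym n x y : edist n x y = edist n y x.
Proof.
  rewrite !edist_nrm. rewrite (nrm_ext n _ (fun k => (-1) * (y k - x k))) by (intros; ring).
  rewrite nrm_scal, Rabs_m1. ring.
Qed.

(** * Reflections preserve the integral *)

Definition refl (n : nat) (v x : point) : point :=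
  fun k => x k - 2 * (dot n v x / dot n v v) * v k.

Section Reflection.
Variables (n : nat) (v : point).
Hypothesis Hv : dot n v v <> 0.

Lemma dot_refl_v x : dot n v (refl n v x) = - dot n v x.
Proof. unfold refl. rewrite dot_minus_r, dot_scal_r. field. assumption. Qed.

Lemma refl_involutive x : refl n v (refl n v x) = x.
Proof.
  apply functional_extensionality; intros k. unfold refl at 1. rewrite dot_refl_v. unfold refl. field. assumption.
Qed.

Lemma refl_minus x y : refl n v (fun k => x k - y k) = (fun k => refl n v x k - refl n v y k).
Proof. apply functional_extensionality; intros k. unfold refl. rewrite dot_minus_r. field. assumption. Qed.

Lemma nrm_refl x : nrm n (refl n v x) = nrm n x.
Proof.
  unfold nrm. f_equal. unfold refl. rewrite dot_minus_l, !dot_minus_r, !dot_scal_l, !dot_scal_r, (dot_comm n x v).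
  field. assumption.
Qed.

Lemma cont_refl_coord k : (k < n)%nat -> cont (dpt n) (fun x => refl n v x k).
Proof.
  intros Hk. unfold refl. apply cont_minus; [now apply cont_coord|].
  apply (cont_ext _ (fun x => (2 * v k / dot n v v) * dot n v x)); [intros; field; assumption|].
  apply cont_scal, cont_dot.
Qed.

Lemma Cc_refl f : Cc n f -> Cc n (fun x => f (refl n v x)).
Proof.
  intros [Hf [B HB]]. split; [apply (cont_pt _ n (refl n v)); [apply cont_refl_coord|assumption]|].
  exists (INR n * B). intros x k Hk Hx.
  destruct (classic (exists j, (j < n)%nat /\ B < Rabs (refl n v x j))) as [[j [Hj Hlt]]|Hno].
  - now apply (HB _ j).
  - exfalso. assert (H : nrm n x <= INR n * B); [|pose proof (coord_le_nrm n x k Hk); lra].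
    rewrite <- nrm_refl. apply nrm_le_coords. intros j Hj. apply Rnot_lt_le. intros Hlt. apply Hno; eauto.
Qed.

(** Uniqueness of the translation invariant integral: both sides equal the double integral of
    [f x * g (refl y - x)]. *)
Lemma integ_refl_haar f g : Cc n f -> Cc n g ->
  integ n f * integ n (fun y => g (refl n v y)) = integ n g * integ n (fun y => f (refl n v y)).
Proof.
  assert (Step : forall f g, Cc n f -> Cc n g ->
    integ n f * integ n (fun y => g (refl n v y)) =
    integ n (fun x => integ n (fun y => f x * g (fun k => refl n v y k - x k)))).
  { clear f g. intros f g Hf Hg. rewrite Rmult_comm, <- integ_scal by assumption.
    apply integ_ext; intros x. rewrite Rmult_comm.
    (* Translating the inner variable by [- refl n v x] turns [g (refl y)] into [g (refl y - x)]. *)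
    rewrite <- (integ_translate n (fun k => - refl n v x k) (fun y => g (refl n v y))) by now apply Cc_refl.
    rewrite <- integ_scal.
    2: { apply (Cc_ext n (fun y => g (refl n v (aff 1 (fun k => - refl n v x k) y)))).
         - intros y. do 2 f_equal. apply functional_extensionality; intros k. unfold aff; ring.
         - apply (Cc_aff n 1 _ (fun y => g (refl n v y))); [lra|now apply Cc_refl]. }
    apply integ_ext; intros y. do 2 f_equal.
    change (fun j => y j + - refl n v x j) with (fun j => y j - refl n v x j).
    now rewrite refl_minus, refl_involutive. }
  assert (Hswap : forall f g, Cc n f -> Cc n g -> integ n (fun x => integ n (fun y => f x * g (fun k => refl n v y k - x k))) =
                  integ n (fun y => integ n (fun x => f x * g (fun k => refl n v y k - x k)))).
  { clear f g. intros f g [Hf [B HB]] Hg. destruct Hg as [Hg [B' HB']].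
    set (C := Rmax B B').
    assert (HC : supp n C f) by (eapply supp_le; [apply Rmax_l|exact HB]).
    assert (HC' : supp n C g) by (eapply supp_le; [apply Rmax_r|exact HB']).
    set (D := Rmax C (INR n * (C + C))).
    apply (integ_fubini n n (fun x y => f x * g (fun k => refl n v y k - x k)) D).
    - apply cont_mult; [now apply (cont_fst (dpt n) (dpt n) f)|].
      apply (cont_pt _ n (fun p k => refl n v (snd p) k - fst p k)); [|assumption].
      intros k Hk. apply cont_minus.
      + apply (cont_snd (dpt n) (dpt n) (fun y => refl n v y k)). now apply cont_refl_coord.
      + apply (cont_fst (dpt n) (dpt n) (fun x => x k)). now apply cont_coord.
    - intros x k y Hk Hy. 
      destruct (classic (exists j, (j < n)%nat /\ C < Rabs (x j))) as [[j [Hj Hlt]]|Hno].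
      { rewrite (HC x j Hj Hlt). ring. }
      destruct (classic (exists j, (j < n)%nat /\ C < Rabs (refl n v k j - x j))) as [[j [Hj Hlt]]|Hno'].
      { rewrite (HC' _ j Hj Hlt). ring. }
      exfalso. assert (H : nrm n k <= INR n * (C + C)).
      { rewrite <- nrm_refl. apply nrm_le_coords. intros j Hj.
        replace (refl n v k j) with ((refl n v k j - x j) + x j) by ring.
        eapply Rle_trans; [apply Rabs_triang|]. apply Rplus_le_compat; apply Rnot_lt_le; intros Hlt.
        - apply Hno'; eauto.
        - apply Hno; eauto. }
      pose proof (coord_le_nrm n k y Hk). pose proof (Rmax_r C (INR n * (C + C))). unfold D in Hy. lra.
    - intros y x k Hk Hx. rewrite (HC x k Hk); [ring|].
      eapply Rle_lt_trans; [|exact Hx]. apply Rmax_l. }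
  intros Hf Hg. rewrite (Step f g Hf Hg), (Step g f Hg Hf), (Hswap f g Hf Hg), (Hswap g f Hg Hf).
  apply integ_ext; intros y.
  (* For fixed [y], substituting [refl y - x] for [x] exchanges the roles of [f] and [g]. *)
  rewrite <- (Rmult_1_l (integ n (fun x => f x * _))).
  replace 1 with ((/ Rabs (-1)) ^ n) by (rewrite Rabs_m1, Rinv_1; apply pow1).
  rewrite <- (integ_aff n (-1) (refl n v y)).
  - apply integ_ext; intros x. rewrite Rmult_comm. f_equal.
    + f_equal. apply functional_extensionality; intros k. unfold aff. ring.
    + f_equal. apply functional_extensionality; intros k. unfold aff. ring.
  - lra.
  - apply (Cc_ext n (fun x => g (fun k => refl n v y k - x k) * f x)); [intros; ring|].
    apply Cc_mult; [|assumption].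
    apply (cont_pt _ n (fun x k => refl n v y k - x k)); [|apply Hg].
    intros k Hk. apply cont_minus; [apply cont_const|now apply cont_coord].
Qed.

(** A radial bump is unchanged by the reflection and has positive integral, so it cancels from the
    previous identity. *)
Lemma integ_refl f : Cc n f -> integ n (fun x => f (refl n v x)) = integ n f.
Proof.
  intros Hf.
  set (g := fun x => Rmax 0 (1 - nrm n x)).
  assert (Hg : Cc n g) by apply bump_Cc.
  assert (Hpos : 0 < integ n g) by (apply bump_integ_pos; lra).
  pose proof (integ_refl_haar f g Hf Hg) as H.
  replace (integ n (fun y => g (refl n v y))) with (integ n g) in H.
  2: { apply integ_ext; intros y. unfold g. now rewrite nrm_refl. }
  apply (Rmult_eq_reg_l (integ n g)); lra.
Qed.

End Reflection.

(** * Rigid motions *)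

(** Isometries for which the change of variables is known. The class is closed under composition,
    which is all that a product of reflections and translations asks. *)
Record rigid (n : nat) (T : point -> point) : Prop := {
  rigid_edist : forall x y, edist n (T x) (T y) = edist n x y;
  rigid_Cc : forall f, Cc n f -> Cc n (fun x => f (T x));
  rigid_integ : forall f, Cc n f -> integ n (fun x => f (T x)) = integ n f
}.

Lemma rigid_id n : rigid n (fun x => x).
Proof. now split. Qed.

Lemma rigid_comp n T T' : rigid n T -> rigid n T' -> rigid n (fun x => T' (T x)).
Proof.
  intros [A B C] [A' B' C']. split.
  - intros x y. now rewrite A', A.
  - intros f Hf. apply (B (fun x => f (T' x))). auto.
  - intros f Hf. rewrite (C (fun x => f (T' x))) by auto. auto.
Qed.

Lemma rigid_affine_refl n v b : dot n v v <> 0 -> rigid n (fun x k => refl n v x k + b k).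
Proof.
  intros Hv.
  assert (HC : forall f, Cc n f -> Cc n (fun x => f (fun k => x k + b k))).
  { intros f Hf. apply (Cc_ext n (fun x => f (aff 1 b x))); [|apply Cc_aff; [lra|assumption]].
    intros x. f_equal. apply functional_extensionality; intros k. unfold aff. ring. }
  split.
  - intros x y. rewrite !edist_nrm. rewrite <- (nrm_refl n v Hv (fun k => x k - y k)), refl_minus by assumption.
    apply nrm_ext; intros; ring.
  - intros f Hf. apply (Cc_refl n v Hv (fun x => f (fun k => x k + b k))). auto.
  - intros f Hf. rewrite (integ_refl n v Hv (fun x => f (fun k => x k + b k))) by auto.
    now apply integ_translate.
Qed.

Lemma edist_eq_sq n x y x' y' : edist n x y = edist n x' y' -> sqdist n x y = sqdist n x' y'.
Proof.
  intros H. assert (Hp : forall x y, 0 <= sqdist n x y) by (intros; rewrite sqdist_dot; apply dot_self_ge0).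
  rewrite <- (sqrt_sqrt _ (Hp x y)), <- (sqrt_sqrt _ (Hp x' y')). unfold edist in H. now rewrite H.
Qed.

(** Once the first [M] points are placed, [T (p M)] is carried to [q M] by the reflection in their
    perpendicular bisector. The points already placed are equidistant from the two, hence lie on the
    bisector and stay fixed. *)
Lemma rigid_match n M p q :
  (forall i j, (i < M)%nat -> (j < M)%nat -> edist n (p i) (p j) = edist n (q i) (q j)) ->
  exists T, rigid n T /\ forall i k, (i < M)%nat -> (k < n)%nat -> T (p i) k = q i k.
Proof.
  induction M as [|M IH]; intros H.
  { exists (fun x => x). split; [apply rigid_id|intros; lia]. }
  destruct IH as [T [HT HTp]]; [intros; apply H; lia|].
  set (a := T (p M)). set (b := q M). set (v := fun k => a k - b k).
  destruct (Req_dec (dot n v v) 0) as [E|E].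
  - exists T. split; [assumption|]. intros i k Hi Hk.
    destruct (Nat.eq_dec i M) as [->|]; [|apply HTp; lia].
    pose proof (dot_self_eq0 n v E k Hk) as H0. unfold v, a, b in H0. lra.
  (* The bisector is the hyperplane [<v, x> = c]; the reflection in it is the linear [refl n v]
     followed by a translation along [v]. *)
  - set (c := (dot n a a - dot n b b) / 2).
    exists (fun x k => refl n v (T x) k + 2 * c / dot n v v * v k).
    assert (Hva : dot n v a - c = dot n v v / 2).
    { unfold c, v. rewrite !dot_minus_l, !dot_minus_r, (dot_comm n b a). field. }
    split; [apply (rigid_comp n T (fun x k => refl n v x k + 2 * c / dot n v v * v k)); [assumption|now apply (rigid_affine_refl n v (fun k => 2 * c / dot n v v * v k))]|].
    intros i k Hi Hk. destruct (Nat.eq_dec i M) as [->|Hn].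
    + fold a. unfold refl. replace (dot n v a) with (c + dot n v v / 2) by lra.
      replace (q M k) with (a k - v k) by (unfold v, b; ring). field. assumption.
    + assert (Ei : forall k, (k < n)%nat -> T (p i) k = q i k) by (intros; apply HTp; [lia|assumption]).
      assert (D : edist n (T (p i)) a = edist n (q i) b).
      { unfold a, b. rewrite (rigid_edist n T HT). apply H; lia. }
      rewrite (edist_ext n _ a (q i) a) in D by auto.
      apply edist_eq_sq in D. rewrite !sqdist_dot, !dot_minus_l, !dot_minus_r in D.
      rewrite (dot_comm n a (q i)), (dot_comm n b (q i)) in D.
      assert (Hc : dot n v (T (p i)) = c).
      { rewrite (dot_ext n v _ v (q i)) by auto. unfold v, c. rewrite dot_minus_l, (dot_comm n a), (dot_comm n b). lra. }
      unfold refl. rewrite Hc, Ei by assumption. field. assumption.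
Qed.

(** There are [M + 1] values: the indices run from [0] to [M]. *)
Fixpoint fmax (M : nat) (f : nat -> R) : R :=
  match M with O => f O | S m => Rmax (fmax m f) (f (S m)) end.

Definition fmin (M : nat) (f : nat -> R) : R := - fmax M (fun i => - f i).

Lemma fmax_ge M f i : (i <= M)%nat -> f i <= fmax M f.
Proof.
  induction M as [|M IH]; intros Hi; simpl.
  - replace i with O by lia. lra.
  - destruct (Nat.eq_dec i (S M)) as [->|]; [apply Rmax_r|].
    eapply Rle_trans; [apply IH; lia|apply Rmax_l].
Qed.

Lemma fmax_ex M f : exists i, (i <= M)%nat /\ fmax M f = f i.
Proof.
  induction M as [|M [i [Hi E]]]; simpl; [now exists O|].
  unfold Rmax. destruct (Rle_dec (fmax M f) (f (S M))).
  - exists (S M); split; [lia|reflexivity].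
  - exists i; split; [lia|assumption].
Qed.

Lemma fmax_lub M f c : (forall i, (i <= M)%nat -> f i <= c) -> fmax M f <= c.
Proof. intros H. destruct (fmax_ex M f) as [i [Hi ->]]. auto. Qed.

Lemma fmax_ext M f g : (forall i, (i <= M)%nat -> f i = g i) -> fmax M f = fmax M g.
Proof.
  intros H. apply Rle_antisym; apply fmax_lub; intros i Hi; [rewrite H by assumption|rewrite <- H by assumption];
  now apply fmax_ge.
Qed.

Lemma fmin_ex M f : exists i, (i <= M)%nat /\ fmin M f = f i.
Proof. destruct (fmax_ex M (fun i => - f i)) as [i [Hi E]]. exists i; split; [assumption|]. unfold fmin. rewrite E. ring. Qed.

Lemma fmin_le M f i : (i <= M)%nat -> fmin M f <= f i.
Proof. intros Hi. pose proof (fmax_ge M (fun i => - f i) i Hi). unfold fmin. lra. Qed.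

Lemma fmax_scal M c f : 0 < c -> fmax M (fun i => c * f i) = c * fmax M f.
Proof.
  intros Hc. induction M as [|M IH]; simpl; [reflexivity|]. rewrite IH. apply RmaxRmult. lra.
Qed.

(** * Lipschitz bounds for maxima, minima and compositions *)

Lemma Rmax_lip a b c d e : Rabs (a - c) <= e -> Rabs (b - d) <= e -> Rabs (Rmax a b - Rmax c d) <= e.
Proof.
  intros H1 H2. apply Rabs_le_between in H1. apply Rabs_le_between in H2. apply Rabs_le_between.
  unfold Rmax. destruct (Rle_dec a b), (Rle_dec c d); lra.
Qed.

Lemma Rmin_lip a b c d e : Rabs (a - c) <= e -> Rabs (b - d) <= e -> Rabs (Rmin a b - Rmin c d) <= e.
Proof.
  intros H1 H2. apply Rabs_le_between in H1. apply Rabs_le_between in H2. apply Rabs_le_between.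
  unfold Rmin. destruct (Rle_dec a b), (Rle_dec c d); lra.
Qed.

Lemma lipn_fmax n L M f : (forall i, (i <= M)%nat -> lipn n L (f i)) -> lipn n L (fun x => fmax M (fun i => f i x)).
Proof.
  induction M as [|M IH]; intros H x y; simpl; [apply H; lia|].
  apply Rmax_lip; [apply IH; intros; apply H; lia|apply H; lia].
Qed.

Lemma lipn_opp n L f : lipn n L f -> lipn n L (fun x => - f x).
Proof. intros H x y. replace (- f y - - f x) with (- (f y - f x)) by ring. rewrite Rabs_Ropp. apply H. Qed.

Lemma lipn_fmin n L M f : (forall i, (i <= M)%nat -> lipn n L (f i)) -> lipn n L (fun x => fmin M (fun i => f i x)).
Proof. intros H. apply lipn_opp, lipn_fmax. intros; apply lipn_opp; auto. Qed.

Lemma lipn_plus n L K f g : lipn n L f -> lipn n K g -> lipn n (L + K) (fun x => f x + g x).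
Proof.
  intros Hf Hg x y. replace (f y + g y - (f x + g x)) with ((f y - f x) + (g y - g x)) by ring.
  eapply Rle_trans; [apply Rabs_triang|]. rewrite Rmult_plus_distr_r. apply Rplus_le_compat; auto.
Qed.

Lemma lipn_comp n L K (phi : R -> R) f : 0 <= K -> (forall s t, Rabs (phi t - phi s) <= K * Rabs (t - s)) ->
  lipn n L f -> lipn n (K * L) (fun x => phi (f x)).
Proof.
  intros HK Hphi Hf x y. eapply Rle_trans; [apply Hphi|]. rewrite Rmult_assoc. apply Rmult_le_compat_l; auto.
Qed.

Lemma lipn_scal n L c f : lipn n L f -> lipn n (Rabs c * L) (fun x => c * f x).
Proof.
  apply (lipn_comp n L (Rabs c) (fun t => c * t)); [apply Rabs_pos|].
  intros s t. rewrite <- Rmult_minus_distr_l, Rabs_mult. lra.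
Qed.

Lemma lipn_le n L L' f : L <= L' -> lipn n L f -> lipn n L' f.
Proof.
  intros HL Hf x y. eapply Rle_trans; [apply Hf|]. apply Rmult_le_compat_r; [|assumption].
  apply rsum_ge0; intros; apply Rabs_pos.
Qed.

Lemma lipn_dot n a : exists L, 0 <= L /\ lipn n L (dot n a).
Proof.
  destruct (bound_coords n a) as [C [HC H]]. exists C. split; [assumption|]. intros x y.
  rewrite <- dot_minus_r. eapply Rle_trans; [apply rsum_Rabs|]. rewrite <- rsum_scal.
  apply rsum_le; intros k Hk. rewrite Rabs_mult. apply Rmult_le_compat_r; [apply Rabs_pos|auto].
Qed.

Lemma trap_lip a b th s t : 0 < th -> Rabs (trap a b th t - trap a b th s) <= / th * Rabs (t - s).
Proof.
  intros Hth. assert (0 < / th) by now apply Rinv_0_lt_compat.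
  assert (H0 : 0 <= / th * Rabs (t - s)) by (apply Rmult_le_pos; [lra|apply Rabs_pos]).
  unfold trap. apply Rmax_lip; [rewrite Rminus_diag, Rabs_R0; assumption|].
  apply Rmin_lip; [rewrite Rminus_diag, Rabs_R0; assumption|].
  rewrite <- (Rabs_pos_eq (/ th)), <- Rabs_mult by lra.
  apply Rmin_lip; apply Req_le.
  - f_equal. field. lra.
  - rewrite <- Rabs_Ropp. f_equal. field. lra.
Qed.

Lemma le_of_cont (g : R -> R) A e0 : 0 < e0 -> cont dR g -> (forall e, 0 < e < e0 -> A <= g e) -> A <= g 0.
Proof.
  intros He0 Hg H. apply Rnot_lt_le. intros Hlt.
  destruct (Hg 0 (A - g 0)) as [del [Hdel H']]; [lra|].
  set (e := Rmin (del / 2) (e0 / 2)).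
  assert (0 < e) by (apply Rmin_pos; lra).
  assert (e <= del / 2) by apply Rmin_l. assert (e <= e0 / 2) by apply Rmin_r.
  specialize (H e ltac:(lra)). specialize (H' e). unfold dR in H'. rewrite Rminus_0_r, Rabs_pos_eq in H' by lra.
  specialize (H' ltac:(lra)). apply Rabs_def2 in H'. lra.
Qed.

Lemma cont_pow_shift n c a : cont dR (fun e => (c + a * e) ^ n).
Proof. apply cont_pow, cont_plus; [apply cont_const|apply cont_scal, cont_id]. Qed.

(** * Volumes of congruent configurations *)

Definition lev (psi : point -> R) (r : R) : point -> Prop := fun x => psi x <= r.

(** The two level functions have the same trapezoid integral by rigidity. The trapezoid dominates
    the indicator of level [r] and lies under that of level [r + del], whence the slack [del]. *)
Lemma Vol_transfer n psip psiq T r del : (1 <= n)%nat -> 0 <= r -> 0 < del ->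
  lipn n 1 psip -> lipn n 1 psiq -> (forall x, 0 <= psip x) -> (forall x, 0 <= psiq x) ->
  (forall s, bdd n (lev psip s)) -> (forall s, bdd n (lev psiq s)) ->
  rigid n T -> (forall x, psiq (T x) = psip x) ->
  Vol n (lev psip r) <= Vol n (lev psiq (r + del)) /\ Vol n (lev psiq r) <= Vol n (lev psip (r + del)).
Proof.
  intros Hn Hr Hdel Lp Lq Pp Pq Bp Bq HT HTpq.
  assert (Hsupp : forall psi, (forall s, bdd n (lev psi s)) -> exists B, supp n B (fun x => trap 0 r del (psi x))).
  { intros psi HB. destruct (HB (r + del)) as [B HBB]. exists B. intros x k Hk Hx.
    apply trap_out; [assumption|]. right. apply Rnot_le_lt. intros Hle. specialize (HBB x Hle k Hk). lra. }
  assert (Hlip : forall psi, lipn n 1 psi -> lipn n (/ del * 1) (fun x => trap 0 r del (psi x))).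
  { intros psi HL. apply (lipn_comp n 1 (/ del) (trap 0 r del)); [|intros; now apply trap_lip|assumption].
    left. now apply Rinv_0_lt_compat. }
  assert (HC : forall psi, lipn n 1 psi -> (forall s, bdd n (lev psi s)) -> Cc n (fun x => trap 0 r del (psi x))).
  { intros psi HL HB. split; [eapply lipn_cont; now apply Hlip|now apply Hsupp]. }
  assert (E : integ n (fun x => trap 0 r del (psip x)) = integ n (fun x => trap 0 r del (psiq x))).
  { rewrite <- (rigid_integ n T HT (fun x => trap 0 r del (psiq x))) by now apply HC.
    apply integ_ext; intros x. now rewrite HTpq. }
  assert (Hup : forall psi, lipn n 1 psi -> (forall s, bdd n (lev psi s)) -> (forall x, 0 <= psi x) ->
    Vol n (lev psi r) <= integ n (fun x => trap 0 r del (psi x))).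
  { intros psi HL HB HP. destruct (Hsupp psi HB) as [B HB'].
    apply (Vol_le_integ n _ _ (/ del * 1) B); auto.
    - rewrite Rmult_1_r. left. now apply Rinv_0_lt_compat.
    - intros; apply trap_ge0.
    - intros x Hx. rewrite trap_in; [lra|assumption|split; [apply HP|exact Hx]]. }
  assert (Hlo : forall psi, lipn n 1 psi -> (forall s, bdd n (lev psi s)) ->
    integ n (fun x => trap 0 r del (psi x)) <= Vol n (lev psi (r + del))).
  { intros psi HL HB. apply integ_le_Vol; auto.
    - intros; apply trap_le1.
    - intros x Hx. rewrite trap_out; [lra|assumption|]. right. apply Rnot_le_lt. exact Hx. }
  split.
  - eapply Rle_trans; [apply Hup; assumption|]. rewrite E. now apply Hlo.
  - eapply Rle_trans; [apply Hup; assumption|]. rewrite <- E. now apply Hlo.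
Qed.

(** The last hypothesis puts level [r + (lam - 1) * (r - D)] inside the [lam]-dilate of level [r].
    Since [D < r] this is a positive slack, and it costs only a factor [lam ^ n], which tends to
    1. *)
Lemma Vol_level_eq n psip psiq T r D : (1 <= n)%nat -> 0 <= r -> D < r ->
  lipn n 1 psip -> lipn n 1 psiq -> (forall x, 0 <= psip x) -> (forall x, 0 <= psiq x) ->
  (forall s, bdd n (lev psip s)) -> (forall s, bdd n (lev psiq s)) ->
  rigid n T -> (forall x, psiq (T x) = psip x) ->
  (forall psi, psi = psip \/ psi = psiq -> forall lam x, 1 < lam ->
      psi x <= r + (lam - 1) * (r - D) -> psi (fun k => / lam * x k) <= r) ->
  Vol n (lev psip r) = Vol n (lev psiq r).
Proof.
  intros Hn Hr HD Lp Lq Pp Pq Bp Bq HT HTpq Hgrow.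
  assert (Hg : forall psi, psi = psip \/ psi = psiq -> (forall s, bdd n (lev psi s)) ->
    forall e, 0 < e -> Vol n (lev psi (r + e * (r - D))) <= (1 + 1 * e) ^ n * Vol n (lev psi r)).
  { intros psi Hpsi HB e He. rewrite Rmult_1_l. apply Vol_scale_le; [assumption|apply HB|lra|].
    intros x Hx. apply (Hgrow psi Hpsi (1 + e) x); [lra|]. replace (1 + e - 1) with e by ring. exact Hx. }
  assert (Hlim : forall A B, (forall e, 0 < e -> A <= (1 + 1 * e) ^ n * B) -> A <= B).
  { intros A B H. replace B with ((1 + 1 * 0) ^ n * B) by (rewrite Rmult_0_r, Rplus_0_r, pow1; ring).
    apply (le_of_cont (fun e => (1 + 1 * e) ^ n * B) A 1); [lra| |intros; apply H; lra].
    apply cont_mult; [apply cont_pow_shift|apply cont_const]. }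
  apply Rle_antisym; apply Hlim; intros e He;
  destruct (Vol_transfer n psip psiq T r (e * (r - D))) as [H1 H2]; try assumption; try (apply Rmult_lt_0_compat; lra).
  - eapply Rle_trans; [exact H1|]. apply Hg; auto.
  - eapply Rle_trans; [exact H2|]. apply Hg; auto.
Qed.

(** The [lam]-dilate of the ball about [p] has radius [lam * r] and centre [lam * p], at distance at
    most [(lam - 1) * D] from [p]; the radius left around [p] is [lam * r - (lam - 1) * D]. *)
Lemma edist_scale_shrink n x p r D lam : 1 < lam -> nrm n p <= D ->
  edist n x p <= r + (lam - 1) * (r - D) -> edist n (fun k => / lam * x k) p <= r.
Proof.
  intros Hl HD H. rewrite edist_nrm in *.
  assert (Hil : 0 < / lam) by (apply Rinv_0_lt_compat; lra).
  rewrite (nrm_ext n _ (fun k => / lam * ((x k - p k) + (1 - lam) * p k))) by (intros; field; lra).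
  rewrite nrm_scal, (Rabs_pos_eq (/ lam)) by lra.
  apply (Rmult_le_reg_l lam); [lra|]. rewrite <- Rmult_assoc, Rinv_r, Rmult_1_l by lra.
  eapply Rle_trans; [apply (nrm_triangle n (fun k => x k - p k) (fun k => (1 - lam) * p k))|].
  rewrite nrm_scal, Rabs_left by lra. nra.
Qed.

Lemma edist_lip n p : lipn n 1 (fun x => edist n x p).
Proof.
  intros x y. rewrite !edist_nrm. eapply Rle_trans; [apply (nrm_lip n)|].
  apply Req_le. f_equal. apply rsum_ext; intros; f_equal; ring.
Qed.

Lemma edist_ge0 n x y : 0 <= edist n x y.
Proof. apply sqrt_pos. Qed.

Lemma coord_le_edist n x p D k : nrm n p <= D -> (k < n)%nat -> Rabs (x k) <= edist n x p + D.
Proof.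
  intros HD Hk. rewrite edist_nrm. replace (x k) with ((x k - p k) + p k) by ring.
  eapply Rle_trans; [apply Rabs_triang|]. apply Rplus_le_compat.
  - apply (coord_le_nrm n (fun k => x k - p k)); assumption.
  - eapply Rle_trans; [now apply (coord_le_nrm n p)|assumption].
Qed.

Lemma Vol_ext n (S S' : point -> Prop) : (forall x, S x <-> S' x) -> Vol n S = Vol n S'.
Proof.
  intros H. f_equal. apply functional_extensionality; intros x.
  apply propositional_extensionality, H.
Qed.

Lemma union_lev n M p r x : union_balls n (S M) p r x <-> lev (fun x => fmin M (fun i => edist n x (p i))) r x.
Proof.
  unfold union_balls, ball, lev. split.
  - intros [i [Hi Hx]]. eapply Rle_trans; [apply (fmin_le M (fun i => edist n x (p i)) i); lia|assumption].
  - intros H. destruct (fmin_ex M (fun i => edist n x (p i))) as [i [Hi E]]. exists i. split; [lia|]. now rewrite <- E.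
Qed.

Lemma inter_lev n M p r x : inter_balls n (S M) p r x <-> lev (fun x => fmax M (fun i => edist n x (p i))) r x.
Proof.
  unfold inter_balls, ball, lev. split.
  - intros H. apply fmax_lub. intros i Hi. apply H; lia.
  - intros H i Hi. eapply Rle_trans; [apply (fmax_ge M (fun i => edist n x (p i)) i); lia|assumption].
Qed.

Definition within (n M : nat) (D : R) (p : nat -> point) : Prop :=
  forall i, (i <= M)%nat -> nrm n (p i) <= D.

Lemma bound_points n M (p : nat -> point) : exists D, 0 <= D /\ within n M D p.
Proof.
  exists (fmax M (fun i => nrm n (p i))). split.
  - eapply Rle_trans; [apply (nrm_ge0 n (p O))|]. apply (fmax_ge M (fun i => nrm n (p i)) O). lia.
  - intros i Hi. now apply (fmax_ge M (fun i => nrm n (p i))).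
Qed.

(** Covers [fmin] and [fmax], hence unions and intersections, at once. *)
Lemma equal_dist_level n M p q D r T (F : (nat -> R) -> R) : (1 <= n)%nat ->
  within n M D p -> within n M D q ->
  0 <= D -> D < r -> rigid n T ->
  (forall i x, (i <= M)%nat -> edist n (T x) (q i) = edist n x (p i)) ->
  (forall f, exists i, (i <= M)%nat /\ F f = f i) ->
  (forall f g s t, (forall i, (i <= M)%nat -> f i <= s -> g i <= t) -> F f <= s -> F g <= t) ->
  (forall f : nat -> point -> R, (forall i, (i <= M)%nat -> lipn n 1 (f i)) -> lipn n 1 (fun x => F (fun i => f i x))) ->
  Vol n (lev (fun x => F (fun i => edist n x (p i))) r) = Vol n (lev (fun x => F (fun i => edist n x (q i))) r).
Proof.
  intros Hn Hp Hq HD Hr HT HTe Fsel Fmon Flip.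
  assert (Hl : forall a : nat -> point, lipn n 1 (fun x => F (fun i => edist n x (a i)))).
  { intros a. apply (Flip (fun i x => edist n x (a i))). intros; apply edist_lip. }
  assert (H0 : forall (a : nat -> point) x, 0 <= F (fun i => edist n x (a i))).
  { intros a x. destruct (Fsel (fun i => edist n x (a i))) as [i [_ ->]]. apply edist_ge0. }
  assert (Hb : forall a, within n M D a ->
            forall s, bdd n (lev (fun x => F (fun i => edist n x (a i))) s)).
  { intros a Ha s. exists (s + D). intros x Hx k Hk. unfold lev in Hx.
    destruct (Fsel (fun i => edist n x (a i))) as [i [Hi E]]. rewrite E in Hx.
    eapply Rle_trans; [apply (coord_le_edist n x (a i) D k); auto|lra]. }
  apply (Vol_level_eq n _ _ T r D); auto; try lra.
  - intros x. apply Rle_antisym.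
    + apply (Fmon (fun i => edist n x (p i)) _ (F (fun i => edist n x (p i)))); [|apply Rle_refl].
      intros i Hi. now rewrite HTe.
    + apply (Fmon (fun i => edist n (T x) (q i)) _ (F (fun i => edist n (T x) (q i)))); [|apply Rle_refl].
      intros i Hi. now rewrite HTe.
  - intros psi [-> | ->] lam x Hlam; (apply Fmon; intros i Hi); apply edist_scale_shrink; auto.
Qed.

Lemma equal_dist_Vol n M p q D r : (1 <= n)%nat ->
  within n M D p -> within n M D q ->
  0 <= D -> D < r ->
  (forall i j, (i < S M)%nat -> (j < S M)%nat -> edist n (p i) (p j) = edist n (q i) (q j)) ->
  Vol n (union_balls n (S M) p r) = Vol n (union_balls n (S M) q r) /\
  Vol n (inter_balls n (S M) p r) = Vol n (inter_balls n (S M) q r) /\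
  congruent n (S M) p q.
Proof.
  intros Hn Hp Hq HD Hr Hd.
  destruct (rigid_match n (S M) p q Hd) as [T [HT HTp]].
  assert (HTe : forall i x, (i <= M)%nat -> edist n (T x) (q i) = edist n x (p i)).
  { intros i x Hi. rewrite <- (rigid_edist n T HT x (p i)). apply edist_ext; [auto|].
    intros k Hk. symmetry. apply HTp; [lia|assumption]. }
  split; [|split].
  - rewrite (Vol_ext n _ _ (union_lev n M p r)), (Vol_ext n _ _ (union_lev n M q r)).
    apply (equal_dist_level n M p q D r T (fmin M)); auto.
    + apply fmin_ex.
    + intros f g s t H Hf. destruct (fmin_ex M f) as [i [Hi E]]. rewrite E in Hf.
      eapply Rle_trans; [now apply (fmin_le M g i)|auto].
    + apply lipn_fmin.
  - rewrite (Vol_ext n _ _ (inter_lev n M p r)), (Vol_ext n _ _ (inter_lev n M q r)).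
    apply (equal_dist_level n M p q D r T (fmax M)); auto.
    + apply fmax_ex.
    + intros f g s t H Hf. apply fmax_lub. intros i Hi. apply H; [assumption|].
      eapply Rle_trans; [now apply (fmax_ge M f i)|assumption].
    + apply lipn_fmax.
  - exists T. split; [apply (rigid_edist n T HT)|assumption].
Qed.

(** * Gauges *)

(** Gauges of star-shaped bodies. Neither convexity nor symmetry is demanded:
    [|x| - e * max_i <p i, x>] has neither in general. *)
Record gauge (n : nat) (phi : point -> R) : Prop := {
  gauge_lip : exists L, 0 <= L /\ lipn n L phi;
  gauge_hom : forall lam x, 0 < lam -> phi (fun k => lam * x k) = lam * phi x;
  gauge_low : exists c, 0 < c /\ forall x, c * nrm n x <= phi x
}.

Section Gauge.
Variables (n : nat) (phi : point -> R).
Hypothesis (Hn : (1 <= n)%nat) (Hphi : gauge n phi).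

Let v := Vol n (lev phi 1).

Lemma gauge_ge0 x : 0 <= phi x.
Proof.
  destruct (gauge_low n phi Hphi) as [c [Hc H]]. eapply Rle_trans; [|apply H].
  apply Rmult_le_pos; [lra|apply nrm_ge0].
Qed.

Lemma gauge_cont : cont (dpt n) phi.
Proof. destruct (gauge_lip n phi Hphi) as [L [_ H]]. now apply (lipn_cont n L). Qed.

Lemma gauge_supp h B : (forall t, B < t -> h t = 0) -> exists C, supp n C (fun x => h (phi x)).
Proof.
  intros Hh. destruct (gauge_low n phi Hphi) as [c [Hc H]]. exists (B / c). intros x k Hk Hx.
  apply Hh. eapply Rlt_le_trans; [|apply H].
  pose proof (coord_le_nrm n x k Hk). apply (Rmult_lt_compat_l c) in Hx; [|assumption].
  replace (c * (B / c)) with B in Hx by (field; lra). nra.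
Qed.

Lemma gauge_bdd s : bdd n (lev phi s).
Proof.
  destruct (gauge_low n phi Hphi) as [c [Hc H]]. exists (s / c). intros x Hx k Hk.
  eapply Rle_trans; [apply (coord_le_nrm n x k Hk)|]. apply (Rmult_le_reg_l c); [assumption|].
  replace (c * (s / c)) with s by (field; lra). eapply Rle_trans; [apply H|exact Hx].
Qed.

Lemma gauge_Cc h B : cont dR h -> (forall t, B < t -> h t = 0) -> Cc n (fun x => h (phi x)).
Proof.
  intros Hh HB. split; [|now apply (gauge_supp h B)].
  apply (cont_comp_R _ phi h); [assumption|apply gauge_cont].
Qed.

Lemma gauge_scale h B s : 0 < s -> cont dR h -> (forall t, B < t -> h t = 0) ->
  integ n (fun x => h (phi x / s)) = s ^ n * integ n (fun x => h (phi x)).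
Proof.
  intros Hs Hh HB.
  assert (Hi : 0 < / s) by now apply Rinv_0_lt_compat.
  replace (s ^ n) with ((/ Rabs (/ s)) ^ n) by (now rewrite Rabs_pos_eq, Rinv_inv by lra).
  rewrite <- (integ_aff n (/ s) orig (fun x => h (phi x))) by (try lra; now apply (gauge_Cc h B)).
  apply integ_ext; intros x. f_equal. unfold Rdiv. rewrite Rmult_comm, <- (gauge_hom n phi Hphi) by assumption.
  f_equal. apply functional_extensionality; intros k. unfold aff, orig. ring.
Qed.

Lemma trap_cont a b th : 0 < th -> cont dR (trap a b th).
Proof. intros H. now apply trap_Cc1. Qed.

Lemma trap01_supp th t : 0 < th -> 1 + th < t -> trap 0 1 th t = 0.
Proof. intros H Ht. apply trap_out; auto. Qed.

Lemma gauge_trap_bounds e : 0 < e ->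
  v <= integ n (fun x => trap 0 1 e (phi x)) <= (1 + e) ^ n * v.
Proof.
  intros He. split.
  - destruct (gauge_lip n phi Hphi) as [L [HL Hlip]].
    destruct (gauge_supp (trap 0 1 e) (1 + e)) as [B HB]; [intros; now apply trap01_supp|].
    apply (Vol_le_integ n _ _ (/ e * L) B); try assumption.
    + apply Rmult_le_pos; [left; now apply Rinv_0_lt_compat|assumption].
    + apply (lipn_comp n L (/ e) (trap 0 1 e)); [left; now apply Rinv_0_lt_compat|intros; now apply trap_lip|assumption].
    + intros; apply trap_ge0.
    + intros x Hx. rewrite trap_in; [lra|assumption|split; [apply gauge_ge0|exact Hx]].
  - apply Rle_trans with (Vol n (lev phi (1 + e))).
    + apply integ_le_Vol; [assumption|apply gauge_bdd| |intros; apply trap_le1|].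
      * apply (gauge_Cc _ (1 + e)); [now apply trap_cont|intros; now apply trap01_supp].
      * intros x Hx. rewrite trap01_supp; [lra|assumption|]. apply Rnot_le_lt. exact Hx.
    + apply Vol_scale_le; [assumption|apply gauge_bdd|lra|]. intros x Hx. unfold lev in *.
      rewrite (gauge_hom n phi Hphi) by (apply Rinv_0_lt_compat; lra).
      apply (Rmult_le_reg_l (1 + e)); [lra|]. rewrite <- Rmult_assoc, Rinv_r by lra. lra.
Qed.

Lemma gauge_Vol_pos : 0 < v.
Proof.
  assert (H : 0 < integ n (fun x => trap 0 1 1 (phi x))).
  { apply (integ_pos n _ orig).
    - apply (gauge_Cc _ 2); [apply trap_cont; lra|intros; apply trap01_supp; lra].
    - intros; apply trap_ge0.
    - replace (phi orig) with 0; [rewrite trap_in; lra|].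
      pose proof (gauge_hom n phi Hphi 2 orig ltac:(lra)) as H.
      replace (fun k : nat => 2 * orig k) with orig in H; [lra|].
      apply functional_extensionality; intros; unfold orig; ring. }
  destruct (gauge_trap_bounds 1 ltac:(lra)) as [_ H'].
  apply (Rmult_lt_reg_l ((1 + 1) ^ n)); [apply pow_lt; lra|]. lra.
Qed.

Section Layers.
Variables (g : R -> R) (r th e : R).
Hypothesis (Hg : cont dR g) (Hdec : forall s t, 0 <= s <= t -> g t <= g s)
  (Hr : 0 < r) (Hg0 : forall t, r <= t -> g t = 0) (Hth : 0 < th < 1) (He : 0 < e).

(** Geometric radii, and the increment of [g] across each shell. A constant ratio [th] between the
    radii of a shell yields the single factor [th ^ n] in [layer_integ]. *)
Let s (k : nat) : R := r * th ^ k.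
Let a (k : nat) : R := g (s (S k)) - g (s k).

Lemma layer_s_pos k : 0 < s k.
Proof. apply Rmult_lt_0_compat; [assumption|apply pow_lt; lra]. Qed.

Lemma layer_s_dec k : s (S k) <= s k.
Proof. unfold s. simpl. assert (0 < th ^ k) by (apply pow_lt; lra). apply Rmult_le_compat_l; [lra|nra]. Qed.

Lemma layer_a_ge0 k : 0 <= a k.
Proof. unfold a. pose proof (Hdec (s (S k)) (s k)). pose proof (layer_s_pos (S k)). pose proof (layer_s_dec k). lra. Qed.

(** The increments of the shells reaching out to [u] or beyond telescope to a value of [g] at a
    radius not exceeding [u]. [Rmax] appears because [M] shells do not resolve the ball of radius
    [s M]. *)
Lemma layer_upper M u : 0 <= u -> g (Rmax u (s M)) <= rsum M (fun k => a k * trap 0 1 e (u / s k)).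
Proof.
  intros Hu. induction M as [|M IH]; simpl.
  - rewrite Hg0; [lra|]. eapply Rle_trans; [|apply Rmax_r]. unfold s; simpl; lra.
  - pose proof (layer_a_ge0 M) as Ha. pose proof (layer_s_pos (S M)) as Hp. pose proof (layer_s_dec M) as Hd.
    destruct (Rle_dec (s M) u) as [H|H].
    + rewrite (Rmax_left u (s M)) in IH by lra. rewrite (Rmax_left u (s (S M))) by lra.
      assert (0 <= a M * trap 0 1 e (u / s M)) by (apply Rmult_le_pos; [assumption|apply trap_ge0]). lra.
    + rewrite Rmax_right in IH by lra. rewrite (trap_in _ _ _ (u / s M)); [|assumption|].
      * assert (g (Rmax u (s (S M))) <= g (s (S M))); [|assert (a M = g (s (S M)) - g (s M)) by reflexivity; lra].
        apply Hdec. split; [lra|apply Rmax_r].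
      * pose proof (layer_s_pos M). split; [apply Rdiv_le_0_compat; lra|].
        apply (Rmult_le_reg_r (s M)); [assumption|]. unfold Rdiv. rewrite Rmult_assoc, Rinv_l by lra. lra.
Qed.

(** The lower counterpart uses the inner radii; dividing by [1 + e] keeps the foot of each trapezoid
    inside radius [s (S k)]. *)
Lemma layer_lower M u : 0 <= u ->
  rsum M (fun k => a k * trap 0 1 e (u / (s (S k) / (1 + e)))) <= g (Rmax u (s M)).
Proof.
  intros Hu. induction M as [|M IH]; simpl.
  - rewrite Hg0; [lra|]. eapply Rle_trans; [|apply Rmax_r]. unfold s; simpl; lra.
  - pose proof (layer_a_ge0 M) as Ha. pose proof (layer_s_pos (S M)) as Hp. pose proof (layer_s_dec M) as Hd.
    destruct (Rle_dec u (s (S M))) as [H|H].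
    + rewrite (Rmax_right u (s M)) in IH by lra. rewrite (Rmax_right u (s (S M))) by lra.
      pose proof (trap_le1 0 1 e (u / (s (S M) / (1 + e)))). 
      assert (a M * trap 0 1 e (u / (s (S M) / (1 + e))) <= a M) by nra. assert (a M = g (s (S M)) - g (s M)) by reflexivity. lra.
    + rewrite (trap01_supp e (u / (s (S M) / (1 + e)))); [|assumption|].
      * rewrite Rmult_0_r, Rplus_0_r. eapply Rle_trans; [exact IH|]. apply Hdec.
        split; [eapply Rle_trans; [exact Hu|apply Rmax_l]|]. apply Rmax_lub.
        -- apply Rmax_l.
        -- eapply Rle_trans; [exact Hd|apply Rmax_r].
      * apply (Rmult_lt_reg_r (s (S M) / (1 + e))); [apply Rdiv_lt_0_compat; lra|].
        replace (u / (s (S M) / (1 + e)) * (s (S M) / (1 + e))) with u by (field; lra).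
        replace ((1 + e) * (s (S M) / (1 + e))) with (s (S M)) by (field; lra). lra.
Qed.

Lemma layer_Cc u : 0 < u -> Cc n (fun x => trap 0 1 e (phi x / u)).
Proof.
  intros Hu. apply (gauge_Cc (fun t => trap 0 1 e (t / u)) ((1 + e) * u)).
  - apply (cont_map dR dR (fun t => t / u)); [|now apply trap_cont].
    apply (cont_mult dR); [apply cont_id|apply cont_const].
  - intros t Ht. apply trap01_supp; [assumption|]. apply (Rmult_lt_reg_r u); [assumption|].
    unfold Rdiv. rewrite (Rmult_assoc t), Rinv_l by lra. lra.
Qed.

Lemma layer_g_Cc : Cc n (fun x => g (phi x)).
Proof. apply (gauge_Cc g r); [assumption|intros; apply Hg0; lra]. Qed.

(** Both bounds contain the same sum, which depends on [g] but not on the gauge; eliminating it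
    between two gauges compares their integrals with their volumes. *)
Lemma layer_integ M :
  th ^ n * rsum M (fun k => a k * s k ^ n) * v <= (1 + e) ^ n * integ n (fun x => g (phi x)) /\
  integ n (fun x => g (phi x)) <= (1 + e) ^ n * v * (rsum M (fun k => a k * s k ^ n) + g 0 * s M ^ n).
Proof.
  destruct (gauge_trap_bounds e He) as [A1 A2].
  assert (Hsc : forall u, 0 < u -> integ n (fun x => trap 0 1 e (phi x / u)) = u ^ n * integ n (fun x => trap 0 1 e (phi x))).
  { intros u Hu. apply (gauge_scale (trap 0 1 e) (1 + e)); [assumption|now apply trap_cont|intros; now apply trap01_supp]. }
  set (Ae := integ n (fun x => trap 0 1 e (phi x))) in *.
  assert (Hv : 0 < v) by apply gauge_Vol_pos.
  assert (H1e : 0 < (1 + e) ^ n) by (apply pow_lt; lra).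
  split.
  - assert (H : rsum M (fun k => a k * ((s (S k) / (1 + e)) ^ n * Ae)) <= integ n (fun x => g (phi x))).
    { rewrite (rsum_ext M _ (fun k => integ n (fun x => a k * trap 0 1 e (phi x / (s (S k) / (1 + e)))))).
      2: { intros k _. rewrite integ_scal, Hsc; [reflexivity| |apply layer_Cc]; apply Rdiv_lt_0_compat; try lra; apply layer_s_pos. }
      rewrite <- integ_rsum.
      2: { intros k _. apply Cc_scal, layer_Cc, Rdiv_lt_0_compat; [apply layer_s_pos|lra]. }
      apply integ_le; [|apply layer_g_Cc|].
      - apply Cc_rsum. intros k _. apply Cc_scal, layer_Cc, Rdiv_lt_0_compat; [apply layer_s_pos|lra].
      - intros x. eapply Rle_trans; [apply layer_lower, gauge_ge0|]. apply Hdec. split; [apply gauge_ge0|apply Rmax_l]. }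
    assert (E : rsum M (fun k => a k * ((s (S k) / (1 + e)) ^ n * Ae)) =
                th ^ n * rsum M (fun k => a k * s k ^ n) * (Ae / (1 + e) ^ n)).
    { rewrite <- rsum_scal, <- rsum_mult_r. apply rsum_ext; intros k _.
      replace (s (S k)) with (th * s k) by (unfold s; simpl; ring).
      unfold Rdiv. rewrite !Rpow_mult_distr, pow_inv. ring. }
    rewrite E in H. apply (Rmult_le_compat_l ((1 + e) ^ n)) in H; [|lra].
    eapply Rle_trans; [|exact H].
    replace ((1 + e) ^ n * (th ^ n * rsum M (fun k => a k * s k ^ n) * (Ae / (1 + e) ^ n)))
      with (th ^ n * rsum M (fun k => a k * s k ^ n) * Ae) by (field; lra).
    apply Rmult_le_compat_l; [|assumption].
    apply Rmult_le_pos; [apply pow_le; lra|]. apply rsum_ge0. intros k _.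
    apply Rmult_le_pos; [apply layer_a_ge0|apply pow_le; left; apply layer_s_pos].
  - assert (H : integ n (fun x => g (phi x)) <=
        rsum M (fun k => a k * (s k ^ n * Ae)) + g 0 * (s M ^ n * Ae)).
    { rewrite (rsum_ext M _ (fun k => integ n (fun x => a k * trap 0 1 e (phi x / s k)))).
      2: { intros k _. rewrite integ_scal, Hsc; [reflexivity| |apply layer_Cc]; apply layer_s_pos. }
      rewrite <- (Hsc (s M)) by apply layer_s_pos.
      rewrite <- integ_rsum by (intros k _; apply Cc_scal, layer_Cc, layer_s_pos).
      rewrite <- (integ_scal n (g 0)) by apply layer_Cc, layer_s_pos.
      rewrite <- integ_plus.
      - apply integ_le; [apply layer_g_Cc| |].
        + apply Cc_plus; [|apply Cc_scal, layer_Cc, layer_s_pos].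
          apply Cc_rsum. intros k _. apply Cc_scal, layer_Cc, layer_s_pos.
        + intros x. cbv beta. pose proof (layer_upper M (phi x) (gauge_ge0 x)) as HU.
          pose proof (gauge_ge0 x) as H0. pose proof (layer_s_pos M) as HM.
          assert (Hg00 : 0 <= g 0). { pose proof (Hdec 0 r ltac:(lra)) as Hd0. rewrite (Hg0 r) in Hd0 by lra. assumption. }
          destruct (Rle_dec (s M) (phi x)) as [H|H].
          * rewrite Rmax_left in HU by assumption.
            assert (0 <= g 0 * trap 0 1 e (phi x / s M)) by (apply Rmult_le_pos; [assumption|apply trap_ge0]). lra.
          * rewrite (trap_in _ _ _ (phi x / s M)); [|assumption|].
            -- assert (g (phi x) <= g 0) by (apply Hdec; lra).
               assert (0 <= rsum M (fun k => a k * trap 0 1 e (phi x / s k))); [|lra].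
               apply rsum_ge0. intros k _. apply Rmult_le_pos; [apply layer_a_ge0|apply trap_ge0].
            -- split; [apply Rdiv_le_0_compat; lra|].
               apply (Rmult_le_reg_r (s M)); [assumption|]. unfold Rdiv. rewrite Rmult_assoc, Rinv_l by lra. lra.
      - apply Cc_rsum. intros k _. apply Cc_scal, layer_Cc, layer_s_pos.
      - apply Cc_scal, layer_Cc, layer_s_pos. }
    eapply Rle_trans; [exact H|].
    rewrite (rsum_ext M _ (fun k => a k * s k ^ n * Ae)) by (intros; ring).
    rewrite rsum_mult_r.
    replace (rsum M (fun k => a k * s k ^ n) * Ae + g 0 * (s M ^ n * Ae)) with
      (Ae * (rsum M (fun k => a k * s k ^ n) + g 0 * s M ^ n)) by ring.
    apply Rmult_le_compat_r; [|assumption].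
    apply Rplus_le_le_0_compat.
    + apply rsum_ge0. intros k _. apply Rmult_le_pos; [apply layer_a_ge0|apply pow_le; left; apply layer_s_pos].
    + apply Rmult_le_pos; [|apply pow_le; left; apply layer_s_pos]. pose proof (Hdec 0 r ltac:(lra)) as Hd0. rewrite (Hg0 r) in Hd0 by lra. assumption.
Qed.

End Layers.
End Gauge.

(** Integrals of a radial profile of a gauge are proportional to the volume of its unit ball:
    the profile is squeezed between step functions on a geometric sequence of dilated balls. *)
Lemma gauge_profile_le n phi psi g r : (1 <= n)%nat -> gauge n phi -> gauge n psi ->
  cont dR g -> (forall s t, 0 <= s <= t -> g t <= g s) -> 0 < r -> (forall t, r <= t -> g t = 0) ->
  Vol n (lev psi 1) * integ n (fun x => g (phi x)) <= Vol n (lev phi 1) * integ n (fun x => g (psi x)).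
Proof.
  intros Hn Hphi Hpsi Hg Hdec Hr Hg0.
  set (v := Vol n (lev phi 1)). set (w := Vol n (lev psi 1)).
  set (I := integ n (fun x => g (phi x))). set (J := integ n (fun x => g (psi x))).
  assert (Hv : 0 < v) by (now apply gauge_Vol_pos).
  assert (Hw : 0 < w) by (now apply gauge_Vol_pos).
  assert (Hg00 : 0 <= g 0). { pose proof (Hdec 0 r ltac:(lra)) as Hd0. rewrite (Hg0 r) in Hd0 by lra. assumption. }
  (* [0 <= F e] is the claim with an error governed by [e], for ratio [th = 1 - e] and trapezoids
     with ramps of width [e]. It is shown for small positive [e] and passes to [e = 0] by
     continuity. *)
  set (F := fun e => (1 + 1 * e) ^ n * v * ((1 + 1 * e) ^ n * J + e) - (1 + (-1) * e) ^ n * (w * I)).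
  assert (H : 0 <= F 0).
  { apply (le_of_cont F 0 (/ 2)); [lra| |].
    - unfold F. apply cont_minus; apply cont_mult; try apply cont_const; try apply cont_pow_shift.
      + apply cont_mult; [apply cont_pow_shift|apply cont_const].
      + apply cont_plus; [|apply cont_id]. apply cont_mult; [apply cont_pow_shift|apply cont_const].
    - intros e He. set (th := 1 - e). assert (Hth : 0 < th < 1) by (unfold th; lra).
      set (C := w * (g 0 * r ^ n) + 1).
      assert (HC : 0 < C).
      { unfold C. assert (0 <= w * (g 0 * r ^ n)); [|lra]. 
        apply Rmult_le_pos; [lra|]. apply Rmult_le_pos; [assumption|apply pow_le; lra]. }
      (* [M] is so large that the unresolved ball of radius [r * th ^ M] contributes at most [e]. *)
      destruct (pow_lt_1_zero th) with (y := e / C) as [M HM].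
      { rewrite Rabs_pos_eq; lra. }
      { apply Rdiv_lt_0_compat; lra. }
      specialize (HM M (Nat.le_refl M)). rewrite Rabs_pos_eq in HM by (apply pow_le; lra).
      destruct (layer_integ n psi Hn Hpsi g r th e Hg Hdec Hr Hg0 Hth ltac:(lra) M) as [H1 _].
      destruct (layer_integ n phi Hn Hphi g r th e Hg Hdec Hr Hg0 Hth ltac:(lra) M) as [_ H2].
      fold w J in H1. fold v I in H2.
      set (Sg := rsum M _) in *.
      replace (1 + 1 * e) with (1 + e) in * by ring. unfold F. 
      replace (1 + 1 * e) with (1 + e) by ring. replace (1 + -1 * e) with th by (unfold th; ring).
      assert (Hthn : 0 < th ^ n) by (apply pow_lt; lra).
      assert (Hthn1 : th ^ n <= 1) by (rewrite <- (pow1 n); apply pow_incr; lra).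
      assert (H1e : 0 < (1 + e) ^ n) by (apply pow_lt; lra).
      assert (HsM : (r * th ^ M) ^ n <= r ^ n * th ^ M).
      { rewrite Rpow_mult_distr. apply Rmult_le_compat_l; [apply pow_le; lra|].
        assert (0 < th ^ M) by (apply pow_lt; lra).
        assert (th ^ M <= 1) by (rewrite <- (pow1 M); apply pow_incr; lra).
        destruct n as [|m]; [lia|]. simpl.
        assert ((th ^ M) ^ m <= 1) by (rewrite <- (pow1 m); apply pow_incr; lra). nra. }
      assert (Hsmall : w * (g 0 * (r * th ^ M) ^ n) <= e).
      { apply Rle_trans with (C * th ^ M).
        - unfold C. assert (0 < th ^ M) by (apply pow_lt; lra).
          apply Rle_trans with (w * (g 0 * r ^ n) * th ^ M); [|nra].
          rewrite Rmult_assoc. apply Rmult_le_compat_l; [lra|]. rewrite Rmult_assoc.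
          apply Rmult_le_compat_l; assumption.
        - apply (Rmult_lt_compat_l C) in HM; [|assumption]. replace (C * (e / C)) with e in HM by (field; lra). lra. }
      apply (Rmult_le_compat_l (th ^ n * w)) in H2; [|nra].
      assert (H3 : (1 + e) ^ n * v * (th ^ n * Sg * w + th ^ n * (w * (g 0 * (r * th ^ M) ^ n))) <=
                   (1 + e) ^ n * v * ((1 + e) ^ n * J + e)).
      { apply Rmult_le_compat_l; [nra|]. apply Rplus_le_compat; [assumption|].
        assert (0 <= w * (g 0 * (r * th ^ M) ^ n)).
        { apply Rmult_le_pos; [lra|]. apply Rmult_le_pos; [assumption|]. apply pow_le.
          apply Rmult_le_pos; [lra|apply pow_le; lra]. }
        nra. }
      nra. }
  unfold F in H. rewrite !Rmult_0_r, !Rplus_0_r, !pow1 in H. lra.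
Qed.

Lemma gauge_profile n phi psi g r : (1 <= n)%nat -> gauge n phi -> gauge n psi ->
  cont dR g -> (forall s t, 0 <= s <= t -> g t <= g s) -> 0 < r -> (forall t, r <= t -> g t = 0) ->
  Vol n (lev psi 1) * integ n (fun x => g (phi x)) = Vol n (lev phi 1) * integ n (fun x => g (psi x)).
Proof. intros. apply Rle_antisym; now apply (gauge_profile_le n _ _ g r). Qed.

(** * Farkas' lemma and the choice of an exposed point *)

(** Membership in the cone is tested against every [y], so that it concerns the first [m]
    coordinates only. *)
Lemma farkas m N : forall (g : nat -> point) (e : point),
  (exists a : nat -> R, (forall k, (k < N)%nat -> 0 <= a k) /\
     forall y, dot m y e = rsum N (fun k => a k * dot m y (g k))) \/
  (exists nu, (forall k, (k < N)%nat -> dot m nu (g k) <= 0) /\ 0 < dot m nu e).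
Proof.
  induction N as [|N IH]; intros g e.
  - destruct (Req_dec (dot m e e) 0) as [E|E].
    + left. exists (fun _ => 0). split; [intros; lra|]. intros y. simpl.
      pose proof (dot_CS m y e) as H. rewrite E, Rmult_0_r in H.
      pose proof (Rle_0_sqr (dot m y e)) as H0. apply Rsqr_0_uniq. apply Rle_antisym; assumption.
    + right. exists e. split; [intros; lia|]. pose proof (dot_self_ge0 m e). lra.
  - set (h := g N).
    destruct (IH g e) as [[a [Ha E]]|[nu [H1 H2]]].
    { left. exists (fun k => if Nat.eq_dec k N then 0 else a k). split.
      - intros k Hk. destruct (Nat.eq_dec k N); [lra|apply Ha; lia].
      - intros y. simpl. destruct (Nat.eq_dec N N); [|contradiction]. rewrite Rmult_0_l, Rplus_0_r, E.
        apply rsum_ext. intros k Hk. destruct (Nat.eq_dec k N); [lia|reflexivity]. }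
    destruct (Rle_dec (dot m nu h) 0) as [Hh|Hh].
    { right. exists nu. split; [|assumption]. intros k Hk. destruct (Nat.eq_dec k N) as [->|]; [assumption|apply H1; lia]. }
    apply Rnot_le_lt in Hh.
    set (w := dot m nu h) in *.
    (* project along [h] onto the hyperplane orthogonal to [nu] *)
    destruct (IH (fun k j => w * g k j - dot m nu (g k) * h j) (fun j => w * e j - dot m nu e * h j))
      as [[a [Ha E]]|[nu' [H3 H4]]].
    + left. exists (fun k => if Nat.eq_dec k N then (dot m nu e - rsum N (fun k => a k * dot m nu (g k))) / w else a k). split.
      * intros k Hk. destruct (Nat.eq_dec k N) as [->|Hn]; [|apply Ha; lia].
        apply Rdiv_le_0_compat; [|assumption].
        assert (rsum N (fun k => a k * dot m nu (g k)) <= 0); [|lra].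
        rewrite <- (rsum_0 N). apply rsum_le. intros k Hk'. specialize (Ha k Hk'). specialize (H1 k Hk'). nra.
      * intros y. simpl. destruct (Nat.eq_dec N N); [|contradiction].
        rewrite (rsum_ext N _ (fun k => a k * dot m y (g k))).
        2: { intros k Hk. destruct (Nat.eq_dec k N); [lia|reflexivity]. }
        specialize (E y). rewrite dot_minus_r, !dot_scal_r in E.
        rewrite (rsum_ext N _ (fun k => w * (a k * dot m y (g k)) - dot m y h * (a k * dot m nu (g k)))) in E.
        2: { intros k Hk. rewrite dot_minus_r, !dot_scal_r. ring. }
        rewrite rsum_minus, !rsum_scal in E. fold h.
        apply (Rmult_eq_reg_l w); [|lra].
        set (s1 := rsum N (fun k => a k * dot m y (g k))) in *.
        set (s2 := rsum N (fun k => a k * dot m nu (g k))) in *.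
        replace (w * (s1 + (dot m nu e - s2) / w * dot m y h)) with (w * s1 + (dot m nu e - s2) * dot m y h) by (field; lra).
        lra.
    (* The separator of the projected vectors is corrected by a multiple of [nu] so as to vanish on
       [h]. *)
    + right. exists (fun j => w * nu' j - dot m nu' h * nu j). split.
      * intros k Hk. rewrite dot_minus_l, !dot_scal_l. destruct (Nat.eq_dec k N) as [->|Hn].
        -- fold h. fold w. lra.
        -- specialize (H3 k ltac:(lia)). rewrite dot_minus_r, !dot_scal_r in H3. lra.
      * rewrite dot_minus_l, !dot_scal_l. rewrite dot_minus_r, !dot_scal_r in H4. lra.
Qed.

Definition Dg (n : nat) (c s : R) (x : point) : point := fun k => if lt_dec k n then c * x k else s * x k.

Lemma dot_Dg m n c s x y : dot m x (Dg n c s y) = dot m (Dg n c s x) y.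
Proof. apply rsum_ext. intros k _. unfold Dg. destruct (lt_dec k n); ring. Qed.

(** The indefinite form [- <p, p'> + <q, q'>] on pairs [(p, q)]. *)
Definition bform (m n : nat) (x y : point) : R := dot m x (Dg n (-1) 1 y).

Lemma bform_sym m n x y : bform m n x y = bform m n y x.
Proof. unfold bform. rewrite dot_Dg. apply dot_comm. Qed.

Lemma bform_minus_l m n x y z : bform m n (fun k => x k - y k) z = bform m n x z - bform m n y z.
Proof. apply dot_minus_l. Qed.

Lemma bform_minus_r m n x y z : bform m n z (fun k => x k - y k) = bform m n z x - bform m n z y.
Proof. rewrite !(bform_sym m n z). apply bform_minus_l. Qed.

(** For [z i = (p i, q i)] in [R^(n+n)] this is [|q i - q j|^2 - |p i - p j|^2], see [bdist_cat]. *)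
Definition bdist (m n : nat) (x y : point) : R := bform m n (fun k => x k - y k) (fun k => x k - y k).

Lemma bdist_expand m n x y : bdist m n x y = bform m n x x - 2 * bform m n x y + bform m n y y.
Proof. unfold bdist. rewrite bform_minus_l, !bform_minus_r, (bform_sym m n y x). ring. Qed.

Lemma bdist_sym m n x y : bdist m n x y = bdist m n y x.
Proof. rewrite !bdist_expand, (bform_sym m n x y). ring. Qed.

Lemma bdist_diag m n x : bdist m n x x = 0.
Proof. rewrite bdist_expand. ring. Qed.

Lemma argmax N (f : nat -> R) : (1 <= N)%nat -> exists i, (i < N)%nat /\ forall k, (k < N)%nat -> f k <= f i.
Proof.
  destruct N as [|M]; [lia|]; intros _.
  destruct (fmax_ex M f) as [i [Hi E]]. exists i. split; [lia|]. intros k Hk. rewrite <- E. apply fmax_ge. lia.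
Qed.

Lemma common_bound N (P : nat -> R -> Prop) :
  (forall k c c', (k < N)%nat -> P k c -> c <= c' -> P k c') ->
  (forall k, (k < N)%nat -> exists c, P k c) ->
  exists c, 0 < c /\ forall k, (k < N)%nat -> P k c.
Proof.
  induction N as [|N IH]; intros Hmon H; [exists 1; split; [lra|intros; lia]|].
  destruct IH as [c [Hc Hk]]; [intros k c c' Hk; apply Hmon; lia|intros; apply H; lia|].
  destruct (H N ltac:(lia)) as [c' Hc']. exists (Rmax c c'). split.
  - eapply Rlt_le_trans; [exact Hc|apply Rmax_l].
  - intros k Hk'. destruct (Nat.eq_dec k N) as [->|Hn].
    + eapply Hmon; [lia|exact Hc'|apply Rmax_r].
    + eapply Hmon; [lia|apply Hk; lia|apply Rmax_l].
Qed.

(** Maximising the affine function [b x = B (x - z i2) - B (x - z i1)], made strictly convex by a small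
    multiple of [|x|^2], yields an exposed point [z i] with [B (z i - z i2) > 0]. The vectors
    [z k - z i] with [B (z k - z i) = 0] have pairwise nonpositive products, so [B <= 0] on the cone they
    span, which therefore does not contain [z i2 - z i]. *)
Lemma exposed_direction m n N (z : nat -> point) i1 i2 :
  (forall i j, (i < N)%nat -> (j < N)%nat -> 0 <= bdist m n (z i) (z j)) ->
  (i1 < N)%nat -> (i2 < N)%nat -> 0 < bdist m n (z i1) (z i2) ->
  exists i xi eps nu Lam, (i < N)%nat /\ 0 < eps /\ 0 < Lam /\
    (forall k, (k < N)%nat -> dot m xi (fun j => z k j - z i j) <=
       - eps * dot m (fun j => z k j - z i j) (fun j => z k j - z i j)) /\
    (forall k, (k < N)%nat -> dot m nu (fun j => z k j - z i j) <= Lam * bdist m n (z i) (z k)) /\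
    0 < dot m nu (fun j => z i2 j - z i j).
Proof.
  intros HB H1 H2 H12.
  destruct (common_bound N (fun k c => dot m (z k) (z k) <= c)) as [C [HC HCk]].
  { intros; lra. } { intros k _. exists (dot m (z k) (z k)). lra. }
  (* [C] bounds every [|z k|^2], so the convex perturbation is at most half of [B (z i1 - z i2)] at
     each point, and the maximiser keeps a positive [B]-distance from [z i2]. *)
  set (eps := bdist m n (z i1) (z i2) / (2 * C)).
  assert (Heps : 0 < eps) by (apply Rdiv_lt_0_compat; lra).
  assert (HepsC : eps * C = bdist m n (z i1) (z i2) / 2) by (unfold eps; field; lra).
  set (u := fun j => 2 * Dg n (-1) 1 (fun k => z i1 k - z i2 k) j).
  assert (Hu : forall x, dot m u x = bdist m n x (z i2) - bdist m n x (z i1)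
                                    + bform m n (z i1) (z i1) - bform m n (z i2) (z i2)).
  { intros x. unfold u. rewrite dot_scal_l, dot_comm. 
    change (dot m x (Dg n (-1) 1 (fun k => z i1 k - z i2 k))) with (bform m n x (fun k => z i1 k - z i2 k)).
    rewrite bform_minus_r, !bdist_expand. ring. }
  destruct (argmax N (fun k => dot m u (z k) + eps * dot m (z k) (z k))) as [i [Hi Hmax]]; [lia|].
  assert (Hi2 : 0 < bdist m n (z i) (z i2)).
  { pose proof (Hmax i1 H1) as Hm. cbv beta in Hm. rewrite !Hu, bdist_diag in Hm.
    pose proof (HB i i1 Hi H1). pose proof (HCk i Hi).
    pose proof (dot_self_ge0 m (z i1)). pose proof (dot_self_ge0 m (z i)).
    assert (eps * dot m (z i) (z i) <= eps * C) by (apply Rmult_le_compat_l; lra).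
    assert (0 <= eps * dot m (z i1) (z i1)) by (apply Rmult_le_pos; lra). lra. }
  set (g := fun k => if Req_EM_T (bdist m n (z k) (z i)) 0 then (fun j => z k j - z i j) else orig).
  assert (Horig : forall x, bform m n orig x = 0).
  { intros x. apply dot_orig. }
  assert (Hg : forall k l, (k < N)%nat -> (l < N)%nat -> bform m n (g k) (g l) <= 0).
  { intros k l Hk Hl. unfold g.
    destruct (Req_EM_T (bdist m n (z k) (z i)) 0) as [Ek|Ek]; [|rewrite Horig; lra].
    destruct (Req_EM_T (bdist m n (z l) (z i)) 0) as [El|El]; [|rewrite bform_sym, Horig; lra].
    pose proof (HB k l Hk Hl) as Hkl.
    rewrite bform_minus_l, !bform_minus_r. rewrite bdist_expand in *.
    rewrite (bform_sym m n (z i) (z l)). lra. }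
  destruct (farkas m N g (fun j => z i2 j - z i j)) as [[a [Ha E]]|[nu [Hnu1 Hnu2]]].
  - exfalso.
    assert (Q : bdist m n (z i2) (z i) <= 0); [|rewrite bdist_sym in Q; lra].
    unfold bdist. set (e := fun j => z i2 j - z i j) in *.
    assert (E' : forall x, bform m n x e = rsum N (fun k => a k * bform m n x (g k))).
    { intros x. rewrite bform_sym. unfold bform. rewrite dot_comm, E.
      apply rsum_ext. intros k _. f_equal. unfold bform. rewrite dot_Dg. reflexivity. }
    rewrite E', <- (rsum_0 N). apply rsum_le. intros k Hk.
    rewrite bform_sym, E'. pose proof (Ha k Hk).
    assert (rsum N (fun l => a l * bform m n (g k) (g l)) <= 0); [|nra].
    rewrite <- (rsum_0 N). apply rsum_le. intros l Hl. pose proof (Ha l Hl). pose proof (Hg k l Hk Hl). nra.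
  (* Where the [B]-distance to [z i] vanishes, the product with [nu] is nonpositive by separation;
     at the finitely many other points a large multiple of the positive distance dominates it. *)
  - destruct (common_bound N (fun k c => dot m nu (fun j => z k j - z i j) <= c * bdist m n (z i) (z k)))
      as [Lam [HLam HLk]].
    { intros k c c' Hk Hc Hcc. eapply Rle_trans; [exact Hc|]. apply Rmult_le_compat_r; [now apply HB|assumption]. }
    { intros k Hk. destruct (Req_dec (bdist m n (z i) (z k)) 0) as [E0|E0].
      - exists 0. specialize (Hnu1 k Hk). unfold g in Hnu1.
        destruct (Req_EM_T (bdist m n (z k) (z i)) 0) as [_|Hne]; [lra|]. rewrite bdist_sym in Hne. contradiction.
      - exists (dot m nu (fun j => z k j - z i j) / bdist m n (z i) (z k)). apply Req_le. field. assumption. }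
    (* [xi] is the gradient at [z i] of the maximised function; strict convexity leaves the deficit
       [eps * |z k - z i|^2]. *)
    exists i, (fun j => u j + 2 * eps * z i j), eps, nu, Lam.
    split; [assumption|]. split; [assumption|]. split; [assumption|]. split; [|split; assumption].
    intros k Hk. pose proof (Hmax k Hk) as Hm. cbv beta in Hm.
    rewrite dot_plus_l, dot_scal_l, dot_minus_l, !dot_minus_r, (dot_comm m (z i) (z k)). lra.
Qed.

(** * Differentiation *)

Lemma is_derive_rsum N (f : nat -> R -> R) (f' : nat -> R) u :
  (forall i, (i < N)%nat -> is_derive (f i) u (f' i)) ->
  is_derive (fun u => rsum N (fun i => f i u)) u (rsum N f').
Proof.
  induction N as [|N IH]; intros H; simpl.
  - apply (is_derive_const (V := R_NormedModule)).
  - apply (is_derive_plus (fun u => rsum N (fun i => f i u)) (f N)); [apply IH; intros; apply H; lia|apply H; lia].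
Qed.

Lemma is_derive_quadratic (f : R -> R) u l C :
  (forall v, Rabs (f v - f u - l * (v - u)) <= C * (v - u) * (v - u)) -> is_derive f u l.
Proof.
  intros H. apply is_derive_Reals. intros e He.
  assert (HC : 0 < Rabs C + 1) by (pose proof (Rabs_pos C); lra).
  exists (mkposreal (e / (Rabs C + 1)) (Rdiv_lt_0_compat _ _ He HC)). intros h Hh Hlt. simpl in Hlt.
  specialize (H (u + h)). replace (u + h - u) with h in H by ring.
  replace ((f (u + h) - f u) / h - l) with ((f (u + h) - f u - l * h) / h) by (field; assumption).
  unfold Rdiv. rewrite Rabs_mult, Rabs_inv. 
  assert (Hp : 0 < Rabs h) by now apply Rabs_pos_lt.
  apply (Rmult_lt_reg_r (Rabs h)); [assumption|]. rewrite Rmult_assoc, Rinv_l, Rmult_1_r by lra.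
  eapply Rle_lt_trans; [exact H|].
  apply (Rmult_lt_compat_r (Rabs C + 1)) in Hlt; [|assumption].
  replace (e / (Rabs C + 1) * (Rabs C + 1)) with e in Hlt by (field; lra).
  assert (E : C * h * h <= Rabs C * (Rabs h * Rabs h)).
  { rewrite <- Rabs_mult, (Rabs_pos_eq (h * h)) by apply Rle_0_sqr. rewrite Rmult_assoc.
    apply Rmult_le_compat_r; [apply Rle_0_sqr|apply Rle_abs]. }
  eapply Rle_lt_trans; [exact E|].
  apply Rle_lt_trans with ((Rabs h * (Rabs C + 1)) * Rabs h); [pose proof (Rmult_le_pos _ _ (Rabs_pos h) (Rabs_pos h)); lra|].
  apply Rmult_lt_compat_r; assumption.
Qed.

(** The square of the positive part is differentiable even at 0, which is why [Wgt] squares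
    [depth]. *)
Lemma is_derive_pos_sq u : is_derive (fun u => Rmax 0 u * Rmax 0 u) u (2 * Rmax 0 u).
Proof.
  apply (is_derive_quadratic _ _ _ 1). intros v. apply Rabs_le_between.
  pose proof (Rle_0_sqr u) as H1. pose proof (Rle_0_sqr v) as H2. pose proof (Rle_0_sqr (v - u)) as H3.
  unfold Rsqr in *. unfold Rmax. destruct (Rle_dec 0 u) as [Hu|Hu], (Rle_dec 0 v) as [Hv|Hv].
  - lra.
  - pose proof (Rmult_le_pos u (- v) Hu ltac:(lra)). lra.
  - pose proof (Rmult_le_pos v (- u) Hv ltac:(lra)). lra.
  - lra.
Qed.

Definition shift (x : point) (u : R) (nu : point) : point := fun j => x j + u * nu j.

Lemma shift_shift x u v nu : shift (shift x u nu) v nu = shift x (u + v) nu.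
Proof. apply functional_extensionality; intros j; unfold shift; ring. Qed.

Lemma dot_shift m a x u nu : dot m a (shift x u nu) = dot m a x + u * dot m a nu.
Proof. unfold shift. now rewrite dot_plus_r, dot_scal_r. Qed.

Lemma integ_shift m f u nu : Cc m f -> integ m (fun x => f (shift x u nu)) = integ m f.
Proof. intros Hf. apply (integ_translate m (fun j => u * nu j)); assumption. Qed.

Lemma Cc_shift m f u nu : Cc m f -> Cc m (fun x => f (shift x u nu)).
Proof.
  intros Hf. apply (Cc_ext m (fun x => f (aff 1 (fun j => u * nu j) x))); [|apply Cc_aff; [lra|assumption]].
  intros x. f_equal. apply functional_extensionality; intros j. unfold aff, shift. ring.
Qed.

(** The translation is by [sin u], to keep the supports of the translates in a fixed box. *)
Lemma integ_directional_derivative m f f' nu :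
  Cc m f -> Cc m f' ->
  (forall x, is_derive (fun u => f (shift x u nu)) 0 (f' x)) -> integ m f' = 0.
Proof.
  intros [Hf [B HB]] [Hf' [B' HB']] HD.
  destruct (bound_coords m nu) as [C [HC HCk]].
  set (D := Rmax B B' + C).
  assert (HDx : forall x u, is_derive (fun u => f (shift x u nu)) u (f' (shift x u nu))).
  { intros x u. specialize (HD (shift x u nu)).
    apply (is_derive_ext (fun v => f (shift (shift x u nu) (v - u) nu))).
    { intros v. rewrite shift_shift. do 2 f_equal. ring. }
    replace (f' (shift x u nu)) with (scal 1 (f' (shift x u nu))) by apply (Rmult_1_l (f' (shift x u nu))).
    apply (is_derive_comp (fun v => f (shift (shift x u nu) v nu)) (fun v => v - u)).
    - replace (u - u) with 0 by ring. exact HD.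
    - auto_derive; [exact I|ring]. }
  assert (Hcont : forall h, cont (dpt m) h -> cont (dprod dR (dpt m)) (fun p => h (shift (snd p) (sin (fst p)) nu))).
  { intros h Hh. apply (cont_pt _ m (fun p => shift (snd p) (sin (fst p)) nu)); [|assumption].
    intros k Hk. unfold shift. apply cont_plus.
    - apply (cont_snd dR (dpt m) (fun x => x k)). now apply cont_coord.
    - apply cont_mult; [|apply cont_const]. apply (cont_comp _ fst sin).
      + intros; apply continuity_sin.
      + apply (cont_fst dR (dpt m) (fun t => t)), cont_id. }
  assert (Hsupp : forall h b u, b <= Rmax B B' -> supp m b h -> supp m D (fun x => h (shift x (sin u) nu))).
  { intros h b u Hb Hh x k Hk Hx. apply (Hh _ k Hk). unfold shift.
    pose proof (Rabs_triang (x k + sin u * nu k) (- (sin u * nu k))) as Ht.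
    replace (x k + sin u * nu k + - (sin u * nu k)) with (x k) in Ht by ring.
    rewrite Rabs_Ropp, Rabs_mult in Ht. specialize (HCk k Hk).
    assert (Hs : Rabs (sin u) <= 1) by (apply Rabs_le_between, SIN_bound).
    pose proof (Rabs_pos (nu k)). pose proof (Rabs_pos (sin u)). unfold D in Hx. nra. }
  pose proof (integ_derive m (fun u x => f (shift x (sin u) nu)) (fun u x => cos u * f' (shift x (sin u) nu)) D) as H.
  assert (H0 : is_derive (fun u => integ m (fun x => f (shift x (sin u) nu))) 0
                 (integ m (fun x => cos 0 * f' (shift x (sin 0) nu)))).
  { apply H.
    - intros u x. apply (is_derive_comp (fun u => f (shift x u nu)) sin u); [apply HDx|].
      auto_derive; [exact I|ring].
    - now apply Hcont.
    - apply cont_mult; [|now apply Hcont]. apply (cont_comp _ fst cos); [intros; apply continuity_cos|].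
      apply (cont_fst dR (dpt m) (fun t => t)), cont_id.
    - intros u. apply (Hsupp f B); [apply Rmax_l|assumption].
    - intros u x k Hk Hx. rewrite (Hsupp f' B' u (Rmax_r _ _) HB' x k Hk Hx). ring. }
  (* The integral of the translates is constant, so the derivative just computed under the integral
     is 0. *)
  apply (is_derive_ext _ (fun _ => integ m f)) in H0.
  2: { intros u. apply integ_shift. split; [assumption|now exists B]. }
  apply is_derive_unique in H0. rewrite Derive_const in H0. rewrite H0.
  apply integ_ext. intros x. rewrite cos_0, sin_0, Rmult_1_l. f_equal.
  apply functional_extensionality; intros j; unfold shift; ring.
Qed.

(** * Soft maximum *)

Lemma exp_le x y : x <= y -> exp x <= exp y.
Proof. intros [H| ->]; [left; now apply exp_increasing|lra]. Qed.

Section Softmax.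
Variables (b : R) (N : nat).
Hypothesis (Hb : 0 < b) (HN : (1 <= N)%nat).

Definition sexp (Z : nat -> R) : R := rsum N (fun i => exp (b * Z i)).
(** Log-sum-exp, which exceeds the maximum by at most [ln N / b]. Its gradient [sw] is a probability
    vector. *)
Definition smax (Z : nat -> R) : R := / b * ln (sexp Z).
Definition sw (Z : nat -> R) (i : nat) : R := exp (b * Z i) / sexp Z.

Lemma sexp_term Z i : (i < N)%nat -> exp (b * Z i) <= sexp Z.
Proof. intros Hi. apply (rsum_term N (fun i => exp (b * Z i))); [intros; left; apply exp_pos|assumption]. Qed.

Lemma sexp_pos Z : 0 < sexp Z.
Proof. eapply Rlt_le_trans; [apply exp_pos|apply (sexp_term Z 0); lia]. Qed.

Lemma sw_pos Z i : 0 < sw Z i.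
Proof. apply Rdiv_lt_0_compat; [apply exp_pos|apply sexp_pos]. Qed.

Lemma sexp_le Z i : (forall k, (k < N)%nat -> Z k <= Z i) -> sexp Z <= INR N * exp (b * Z i).
Proof.
  intros H. rewrite <- rsum_const. apply rsum_le. intros k Hk. apply exp_le.
  apply Rmult_le_compat_l; [lra|auto].
Qed.

Lemma sw_lower Z i : (forall k, (k < N)%nat -> Z k <= Z i) -> / INR N <= sw Z i.
Proof.
  intros H. assert (HNp : 0 < INR N) by (apply lt_0_INR; lia).
  apply (Rmult_le_reg_r (INR N * sexp Z)); [apply Rmult_lt_0_compat; [assumption|apply sexp_pos]|].
  pose proof (sexp_pos Z). unfold sw.
  replace (/ INR N * (INR N * sexp Z)) with (sexp Z) by (field; lra).
  replace (exp (b * Z i) / sexp Z * (INR N * sexp Z)) with (INR N * exp (b * Z i)) by (field; lra).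
  now apply sexp_le.
Qed.

Lemma sw_upper Z i j : (j < N)%nat -> Z i + 1 <= Z j -> sw Z i <= exp (- b).
Proof.
  intros Hj H. pose proof (sexp_pos Z). apply (Rmult_le_reg_r (sexp Z)); [assumption|].
  unfold sw. unfold Rdiv. rewrite Rmult_assoc, Rinv_l, Rmult_1_r by lra.
  apply Rle_trans with (exp (- b) * exp (b * Z j)).
  - rewrite <- exp_plus. apply exp_le. nra.
  - apply Rmult_le_compat_l; [left; apply exp_pos|now apply sexp_term].
Qed.

Lemma smax_lower Z i : (i < N)%nat -> Z i <= smax Z.
Proof.
  intros Hi. unfold smax. apply (Rmult_le_reg_l b); [assumption|]. rewrite <- Rmult_assoc, Rinv_r, Rmult_1_l by lra.
  rewrite <- (ln_exp (b * Z i)). apply ln_le; [apply exp_pos|now apply sexp_term].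
Qed.

Lemma smax_upper Z i : (forall k, (k < N)%nat -> Z k <= Z i) -> smax Z <= Z i + / b * ln (INR N).
Proof.
  intros H. assert (HNp : 0 < INR N) by (apply lt_0_INR; lia).
  unfold smax. replace (Z i + / b * ln (INR N)) with (/ b * (ln (INR N) + b * Z i)) by (field; lra).
  apply Rmult_le_compat_l; [left; now apply Rinv_0_lt_compat|].
  rewrite <- (ln_exp (b * Z i)) at 1. rewrite <- ln_mult by (assumption || apply exp_pos).
  apply ln_le; [apply sexp_pos|now apply sexp_le].
Qed.

Lemma is_derive_exp_term (Z : R -> R) Z' u : is_derive Z u Z' ->
  is_derive (fun u => exp (b * Z u)) u (b * Z' * exp (b * Z u)).
Proof.
  intros H. replace (b * Z' * exp (b * Z u)) with (scal (b * Z') (exp (b * Z u))) by reflexivity.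
  apply (is_derive_comp exp (fun u => b * Z u)).
  - apply is_derive_Reals, derivable_pt_lim_exp.
  - apply is_derive_scal. exact H.
Qed.

Lemma is_derive_sexp (Z : R -> nat -> R) (Z' : nat -> R) u :
  (forall i, (i < N)%nat -> is_derive (fun u => Z u i) u (Z' i)) ->
  is_derive (fun u => sexp (Z u)) u (rsum N (fun i => b * Z' i * exp (b * Z u i))).
Proof.
  intros H. apply (is_derive_rsum N (fun i u => exp (b * Z u i))).
  intros i Hi. apply (is_derive_exp_term (fun u => Z u i)). auto.
Qed.

Lemma is_derive_smax (Z : R -> nat -> R) (Z' : nat -> R) u :
  (forall i, (i < N)%nat -> is_derive (fun u => Z u i) u (Z' i)) ->
  is_derive (fun u => smax (Z u)) u (rsum N (fun i => sw (Z u) i * Z' i)).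
Proof.
  intros H. pose proof (sexp_pos (Z u)) as Hp.
  replace (rsum N (fun i => sw (Z u) i * Z' i)) with
    (/ b * (rsum N (fun i => b * Z' i * exp (b * Z u i)) * / sexp (Z u))).
  2: { rewrite <- rsum_mult_r, <- rsum_scal. apply rsum_ext. intros i Hi. unfold sw. field. lra. }
  apply is_derive_scal. apply (is_derive_comp ln (fun u => sexp (Z u))).
  - apply is_derive_Reals, derivable_pt_lim_ln. assumption.
  - now apply is_derive_sexp.
Qed.

Lemma is_derive_sw (Z : R -> nat -> R) (Z' : nat -> R) u i :
  (forall i, (i < N)%nat -> is_derive (fun u => Z u i) u (Z' i)) -> (i < N)%nat ->
  is_derive (fun u => sw (Z u) i) u (b * rsum N (fun j => sw (Z u) i * sw (Z u) j * (Z' i - Z' j))).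
Proof.
  intros H Hi. pose proof (sexp_pos (Z u)) as Hp.
  replace (b * rsum N (fun j => sw (Z u) i * sw (Z u) j * (Z' i - Z' j))) with
    ((b * Z' i * exp (b * Z u i) * sexp (Z u) - exp (b * Z u i) * rsum N (fun i => b * Z' i * exp (b * Z u i))) / sexp (Z u) ^ 2).
  - apply (is_derive_div (fun u => exp (b * Z u i)) (fun u => sexp (Z u))); [apply (is_derive_exp_term (fun u => Z u i)); auto|now apply is_derive_sexp|lra].
  - unfold sexp at 1. rewrite <- !rsum_scal, <- rsum_minus. unfold Rdiv. rewrite <- rsum_mult_r.
    apply rsum_ext. intros j Hj. unfold sw. field. lra.
Qed.

Lemma cont_sexp {T} (d : T -> T -> R) (Z : T -> nat -> R) :
  (forall k, (k < N)%nat -> cont d (fun x => Z x k)) -> cont d (fun x => sexp (Z x)).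
Proof. intros H. apply cont_rsum. intros k Hk. apply cont_exp, cont_scal; auto. Qed.

Lemma cont_sw {T} (d : T -> T -> R) (Z : T -> nat -> R) i : (i < N)%nat ->
  (forall k, (k < N)%nat -> cont d (fun x => Z x k)) -> cont d (fun x => sw (Z x) i).
Proof.
  intros Hi H. apply cont_div; [intros x; pose proof (sexp_pos (Z x)); lra| |now apply cont_sexp].
  apply cont_exp, cont_scal; auto.
Qed.

Lemma cont_smax {T} (d : T -> T -> R) (Z : T -> nat -> R) :
  (forall k, (k < N)%nat -> cont d (fun x => Z x k)) -> cont d (fun x => smax (Z x)).
Proof. intros H. apply cont_scal, cont_ln; [intros; apply sexp_pos|now apply cont_sexp]. Qed.

End Softmax.

(** * Interpolation between two configurations *)

Section Weights.
Variables (m : nat) (R0 : R).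
Hypothesis HR0 : 0 <= R0.

Definition depth (x : point) : R := Rmax 0 (R0 * R0 - dot m x x).

Lemma depth_ge0 x : 0 <= depth x.
Proof. apply Rmax_l. Qed.

Lemma depth_supp : supp m R0 depth.
Proof.
  intros x k Hk Hx. apply Rmax_left.
  pose proof (rsum_term m (fun k => x k * x k) k ltac:(intros; apply Rle_0_sqr) Hk) as H. cbv beta in H.
  assert (R0 * R0 <= x k * x k); [|unfold dot; lra].
  replace (x k * x k) with (Rabs (x k) * Rabs (x k)) by (rewrite <- Rabs_mult; apply Rabs_pos_eq, Rle_0_sqr).
  apply Rmult_le_compat; lra.
Qed.

Lemma cont_depth : cont (dpt m) depth.
Proof.
  apply cont_Rmax; [apply cont_const|]. apply cont_minus; [apply cont_const|].
  apply cont_rsum. intros k Hk. apply cont_mult; now apply cont_coord.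
Qed.

(** Chosen so that the gradient of [Wgt] at [x] is [- wgt x] times [x]. The pair plays the part of
    the Gaussian density, which is its own partner. *)
Definition wgt (x : point) : R := 4 * depth x.
Definition Wgt (x : point) : R := depth x * depth x.

Lemma wgt_Cc : Cc m wgt.
Proof. apply Cc_scal. split; [apply cont_depth|exists R0; apply depth_supp]. Qed.

Lemma Wgt_Cc : Cc m Wgt.
Proof. apply Cc_mult; [apply cont_depth|]. split; [apply cont_depth|exists R0; apply depth_supp]. Qed.

Lemma Wgt_ge0 x : 0 <= Wgt x.
Proof. apply Rmult_le_pos; apply depth_ge0. Qed.

Lemma is_derive_Wgt x nu : is_derive (fun u => Wgt (shift x u nu)) 0 (- (dot m nu x * wgt x)).
Proof.
  apply (is_derive_ext (fun u => (fun v => Rmax 0 v * Rmax 0 v)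
     (R0 * R0 - (dot m x x + 2 * u * dot m x nu + u * u * dot m nu nu)))).
  { intros u. unfold Wgt, depth. rewrite dot_shift, (dot_comm m (shift x u nu) x), (dot_comm m (shift x u nu) nu), !dot_shift, (dot_comm m nu x).
    replace (dot m x x + u * dot m x nu + u * (dot m x nu + u * dot m nu nu))
      with (dot m x x + 2 * u * dot m x nu + u * u * dot m nu nu) by ring. reflexivity. }
  replace (- (dot m nu x * wgt x)) with (scal (- (2 * dot m x nu)) (2 * Rmax 0 (R0 * R0 - (dot m x x + 2 * 0 * dot m x nu + 0 * 0 * dot m nu nu)))).
  - apply (is_derive_comp (fun v => Rmax 0 v * Rmax 0 v)); [apply is_derive_pos_sq|].
    auto_derive; [exact I|ring].
  - unfold wgt, depth. rewrite (dot_comm m nu x). unfold scal; simpl; unfold mult; simpl.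
    replace (R0 * R0 - (dot m x x + 2 * 0 * dot m x nu + 0 * 0 * dot m nu nu)) with (R0 * R0 - dot m x x) by ring. ring.
Qed.

(** The derivative of [G * Wgt] along [nu] integrates to 0; this is the substitute for Gaussian
    integration by parts. *)
Lemma stein G DG nu : cont (dpt m) G -> cont (dpt m) DG ->
  (forall x, is_derive (fun u => G (shift x u nu)) 0 (DG x)) ->
  integ m (fun x => G x * dot m nu x * wgt x) = integ m (fun x => DG x * Wgt x).
Proof.
  intros HG HDG HD.
  assert (H1 : Cc m (fun x => DG x * Wgt x)) by (apply Cc_mult; [assumption|apply Wgt_Cc]).
  assert (H2 : Cc m (fun x => G x * dot m nu x * wgt x)).
  { apply Cc_mult; [|apply wgt_Cc]. apply cont_mult; [assumption|apply cont_dot]. }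
  assert (H : integ m (fun x => DG x * Wgt x - G x * dot m nu x * wgt x) = 0).
  { apply (integ_directional_derivative m (fun x => G x * Wgt x) _ nu).
    - apply Cc_mult; [assumption|apply Wgt_Cc].
    - now apply Cc_minus.
    - intros x. 
      assert (Ex : shift x 0 nu = x) by (apply functional_extensionality; intros j; unfold shift; ring).
      replace (DG x * Wgt x - G x * dot m nu x * wgt x) with
        (DG x * Wgt (shift x 0 nu) + G (shift x 0 nu) * - (dot m nu x * wgt x)) by (rewrite Ex; ring).
      apply (is_derive_mult (fun u => G (shift x u nu)) (fun u => Wgt (shift x u nu))).
      + apply HD.
      + apply is_derive_Wgt.
      + intros; apply Rmult_comm. }
  rewrite integ_minus in H by assumption. lra.
Qed.
End Weights.

Section Interpolation.
Variables (m n N : nat) (z : nat -> point) (R0 b : R).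
Hypothesis (HN : (1 <= N)%nat) (HR0 : 0 <= R0) (Hb : 0 < b).
Hypothesis HB : forall i j, (i < N)%nat -> (j < N)%nat -> 0 <= bdist m n (z i) (z j).

(** The scalar product of [x] with the interpolated point [(cos t * p i, sin t * q i)]. *)
Definition lform (t : R) (x : point) (i : nat) : R := dot m (z i) (Dg n (cos t) (sin t) x).

(** The [I_ij] of the derivative formula, taken with [Wgt] since integration by parts trades [wgt]
    for it. *)
Definition pairw (t : R) (i j : nat) : R :=
  integ m (fun x => sw b N (lform t x) i * sw b N (lform t x) j * Wgt m R0 x).

Definition interp (t : R) : R := integ m (fun x => smax b N (lform t x) * wgt m R0 x).

Lemma Dg_coord_cont {T} (d : T -> T -> R) (c s : T -> R) (x : T -> point) :
  cont d c -> cont d s -> (forall k, (k < m)%nat -> cont d (fun p => x p k)) ->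
  forall a, cont d (fun p => dot m a (Dg n (c p) (s p) (x p))).
Proof.
  intros Hc Hs Hx a. apply cont_rsum. intros k Hk. apply cont_scal.
  unfold Dg. destruct (lt_dec k n); (apply cont_mult; [assumption|auto]).
Qed.

Lemma cont_fst_R (phi : R -> R) : (forall t, continuity_pt phi t) ->
  cont (dprod dR (dpt m)) (fun p => phi (fst p)).
Proof. intros H. apply (cont_comp _ fst phi); [auto|]. apply (cont_fst dR (dpt m) (fun t => t)), cont_id. Qed.

Lemma cont_snd_coord k : (k < m)%nat -> cont (dprod dR (dpt m)) (fun p => snd p k).
Proof. intros Hk. apply (cont_snd dR (dpt m) (fun x => x k)). now apply cont_coord. Qed.

Lemma lform_joint i : cont (dprod dR (dpt m)) (fun p => lform (fst p) (snd p) i).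
Proof.
  apply Dg_coord_cont.
  - apply (cont_fst_R cos). intros; apply continuity_cos.
  - apply (cont_fst_R sin). intros; apply continuity_sin.
  - apply cont_snd_coord.
Qed.

Lemma lform_cont t i : cont (dpt m) (fun x => lform t x i).
Proof. apply Dg_coord_cont; [apply cont_const|apply cont_const|intros; now apply cont_coord]. Qed.

Lemma lform_shift t x u nu i : lform t (shift x u nu) i = lform t x i + u * lform t nu i.
Proof. unfold lform. rewrite !dot_Dg. apply dot_shift. Qed.

Lemma pairw_Cc t i j : (i < N)%nat -> (j < N)%nat ->
  Cc m (fun x => sw b N (lform t x) i * sw b N (lform t x) j * Wgt m R0 x).
Proof.
  intros Hi Hj. apply Cc_mult; [|now apply Wgt_Cc].
  apply cont_mult; apply cont_sw; auto; intros; apply lform_cont.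
Qed.

Lemma pairw_ge0 t i j : (i < N)%nat -> (j < N)%nat -> 0 <= pairw t i j.
Proof.
  intros Hi Hj. apply integ_ge0; [now apply pairw_Cc|]. intros x.
  apply Rmult_le_pos; [|apply Wgt_ge0]. apply Rmult_le_pos; left; now apply sw_pos.
Qed.

Lemma pairw_sym t i j : pairw t i j = pairw t j i.
Proof. apply integ_ext; intros; ring. Qed.

Definition lform' (t : R) (x : point) (i : nat) : R := dot m (Dg n (- sin t) (cos t) (z i)) x.

Lemma is_derive_lform t x i : is_derive (fun t => lform t x i) t (lform' t x i).
Proof.
  apply (is_derive_rsum m (fun k t => z i k * Dg n (cos t) (sin t) x k) (fun k => Dg n (- sin t) (cos t) (z i) k * x k)).
  intros k _. unfold Dg. destruct (lt_dec k n).
  - auto_derive; [exact I|ring].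
  - auto_derive; [exact I|ring].
Qed.

Lemma is_derive_lform_shift t x nu k : is_derive (fun u => lform t (shift x u nu) k) 0 (lform t nu k).
Proof.
  apply (is_derive_ext (fun u => lform t x k + u * lform t nu k)); [intros; symmetry; apply lform_shift|].
  auto_derive; [exact I|ring].
Qed.

Lemma shift0 x nu : shift x 0 nu = x.
Proof. apply functional_extensionality; intros j; unfold shift; ring. Qed.

Lemma lform_lform' t i k : lform t (Dg n (- sin t) (cos t) (z i)) k = sin t * cos t * bform m n (z k) (z i).
Proof.
  unfold lform, bform. rewrite <- dot_scal_r. apply dot_ext; [reflexivity|].
  intros j _. unfold Dg. destruct (lt_dec j n); ring.
Qed.

(** Integration by parts along [nu], the velocity of the interpolated point [i]. The product of this
    velocity with the position of point [k] is [sin t * cos t] times the indefinite form of [z k]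
    and [z i]. *)
Lemma stein_sw t i : (i < N)%nat ->
  integ m (fun x => sw b N (lform t x) i * lform' t x i * wgt m R0 x) =
  b * (sin t * cos t) * rsum N (fun j => (bform m n (z i) (z i) - bform m n (z j) (z i)) * pairw t i j).
Proof.
  intros Hi. set (nu := Dg n (- sin t) (cos t) (z i)).
  set (DG := fun x => b * rsum N (fun j => sw b N (lform t x) i * sw b N (lform t x) j * (lform t nu i - lform t nu j))).
  assert (Hsw : forall k, (k < N)%nat -> cont (dpt m) (fun x => sw b N (lform t x) k)).
  { intros k Hk. apply cont_sw; auto; intros; apply lform_cont. }
  unfold lform'. fold nu. rewrite (stein m R0 HR0 (fun x => sw b N (lform t x) i) DG nu).
  - unfold DG.
    rewrite (integ_ext m _ (fun x => rsum N (fun j => (b * (lform t nu i - lform t nu j)) *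
        (sw b N (lform t x) i * sw b N (lform t x) j * Wgt m R0 x)))).
    2: { intros x. rewrite <- rsum_scal, <- rsum_mult_r. apply rsum_ext; intros; ring. }
    rewrite integ_rsum by (intros j Hj; now apply Cc_scal, pairw_Cc).
    rewrite <- rsum_scal. apply rsum_ext; intros j Hj. rewrite integ_scal by now apply pairw_Cc.
    unfold nu. rewrite !lform_lform'. fold (pairw t i j). ring.
  - now apply Hsw.
  - unfold DG. apply cont_scal, cont_rsum. intros j Hj. apply cont_mult; [|apply cont_const].
    apply cont_mult; auto.
  - intros x. unfold DG.
    pose proof (is_derive_sw b N HN (fun u => lform t (shift x u nu)) (fun k => lform t nu k) 0 i) as H.
    cbv beta in H. rewrite shift0 in H. apply H; [|assumption]. intros k _. apply is_derive_lform_shift.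
Qed.

Definition pair_row (t : R) (i : nat) : R := rsum N (fun j => bdist m n (z i) (z j) * pairw t i j).

Lemma is_derive_interp t :
  is_derive interp t (b / 2 * (sin t * cos t) *
    rsum N (pair_row t)).
Proof.
  assert (E : integ m (fun x => rsum N (fun i => sw b N (lform t x) i * lform' t x i) * wgt m R0 x) =
     b / 2 * (sin t * cos t) * rsum N (pair_row t)).
  { rewrite (integ_ext m _ (fun x => rsum N (fun i => sw b N (lform t x) i * lform' t x i * wgt m R0 x))).
    2: { intros x. now rewrite <- rsum_mult_r. }
    rewrite integ_rsum.
    2: { intros i Hi. apply Cc_mult; [|now apply wgt_Cc]. apply cont_mult; [|apply cont_dot].
         apply cont_sw; auto; intros; apply lform_cont. }
    rewrite (rsum_ext N _ _ (fun i Hi => stein_sw t i Hi)).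
    rewrite rsum_scal.
    set (A := rsum N (fun i => rsum N (fun j => (bform m n (z i) (z i) - bform m n (z j) (z i)) * pairw t i j))).
    (* [pairw] is symmetric, so adding the sum with [i] and [j] exchanged completes the expansion of
       [B (z i - z j)]. *)
    assert (EA : rsum N (pair_row t) = A + A).
    { assert (EA' : A = rsum N (fun j => rsum N (fun i => (bform m n (z i) (z i) - bform m n (z j) (z i)) * pairw t i j)))
        by apply rsum_swap.
      rewrite EA' at 2. unfold A. rewrite <- rsum_plus. apply rsum_ext; intros i _.
      rewrite <- rsum_plus. apply rsum_ext; intros j _.
      rewrite bdist_expand, (pairw_sym t j i), (bform_sym m n (z j) (z i)). ring. }
    rewrite EA. field. }
  rewrite <- E. unfold interp.
  apply (integ_derive m (fun t x => smax b N (lform t x) * wgt m R0 x)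
     (fun t x => rsum N (fun i => sw b N (lform t x) i * lform' t x i) * wgt m R0 x) R0).
  - intros u x. replace (rsum N (fun i => sw b N (lform u x) i * lform' u x i) * wgt m R0 x)
      with (wgt m R0 x * rsum N (fun i => sw b N (lform u x) i * lform' u x i)) by ring.
    apply (is_derive_ext (fun u => wgt m R0 x * smax b N (lform u x))); [intros; apply Rmult_comm|].
    apply is_derive_scal. apply (is_derive_smax b N Hb HN (fun u => lform u x)).
    intros i _. apply is_derive_lform.
  - apply cont_mult; [|apply (cont_snd dR (dpt m)), wgt_Cc; assumption].
    apply (cont_smax b N HN _ (fun p => lform (fst p) (snd p))). intros; apply lform_joint.
  - apply cont_mult; [|apply (cont_snd dR (dpt m)), wgt_Cc; assumption].
    apply cont_rsum. intros i Hi. apply cont_mult.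
    + apply (cont_sw b N HN _ (fun p => lform (fst p) (snd p))); [assumption|intros; apply lform_joint].
    + apply (cont_ext _ (fun p => dot m (z i) (Dg n (- sin (fst p)) (cos (fst p)) (snd p)))).
      { intros p. apply dot_Dg. }
      apply Dg_coord_cont.
      * apply cont_opp, (cont_fst_R sin). intros; apply continuity_sin.
      * apply (cont_fst_R cos). intros; apply continuity_cos.
      * apply cont_snd_coord.
  - intros u x k Hk Hx. unfold wgt. rewrite (depth_supp m R0 HR0 x k Hk Hx). ring.
  - intros u x k Hk Hx. unfold wgt. rewrite (depth_supp m R0 HR0 x k Hk Hx). ring.
Qed.

Lemma interp_derive_sum_ge t i : (i < N)%nat ->
  pair_row t i <=
  rsum N (pair_row t).
Proof.
  intros Hi. apply (rsum_term N (fun i => pair_row t i)); [|assumption].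
  intros k Hk. apply rsum_ge0. intros j Hj. apply Rmult_le_pos; [now apply HB|now apply pairw_ge0].
Qed.

(** Moving by [nu] the region where point [i] is exposed to a region where point [j0] dominates, the total
    weight of [i] drops by a fixed amount; the drop is paid by the pairs [i, j] with [B_ij > 0] only. *)
Lemma pair_weight_lower t i j0 xi nu rho Lam :
  (i < N)%nat -> (j0 < N)%nat -> cos t <> 0 -> sin t <> 0 -> 0 < rho <= 1 -> 0 < Lam -> 2 * INR N <= b ->
  (forall x, nrm m x < rho -> forall k, (k < N)%nat ->
      lform t x k + dot m (z k) xi <= lform t x i + dot m (z i) xi) ->
  (forall x, nrm m x < rho ->
      lform t x i + dot m (z i) xi + dot m (z i) nu + 1 <= lform t x j0 + dot m (z j0) xi + dot m (z j0) nu) ->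
  (forall j, (j < N)%nat -> dot m (z j) nu - dot m (z i) nu <= Lam * bdist m n (z i) (z j)) ->
  (forall x u, nrm m x < rho -> 0 <= u <= 1 ->
      1 <= Wgt m R0 (shift (shift x 1 (Dg n (/ cos t) (/ sin t) xi)) u (Dg n (/ cos t) (/ sin t) nu))) ->
  integ m (fun x => Rmax 0 (rho - nrm m x)) <=
    2 * INR N * Lam * b * pair_row t i.
Proof.
  intros Hi Hj0 Hc Hs Hrho HLam HbN D1 D2 D3 DR.
  (* Preimages of [xi] and [nu] under the interpolation map at [t]: translating [x] by them adds
     [<z k, xi>] and [<z k, nu>] to the forms. *)
  set (xt := Dg n (/ cos t) (/ sin t) xi) in *. set (nut := Dg n (/ cos t) (/ sin t) nu) in *.
  assert (Hinv : forall y k, lform t (Dg n (/ cos t) (/ sin t) y) k = dot m (z k) y).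
  { intros y k. apply dot_ext; [reflexivity|]. intros j _. unfold Dg. destruct (lt_dec j n); field; assumption. }
  set (eta := fun x => Rmax 0 (rho - nrm m x)).
  assert (Heta : Cc m eta) by apply bump_Cc.
  assert (Heta0 : forall x, 0 <= eta x) by (intros; apply Rmax_l).
  assert (Hcase : forall x, eta x = 0 \/ (nrm m x < rho /\ eta x <= 1)).
  { intros x. unfold eta. pose proof (nrm_ge0 m x). destruct (Rlt_or_le (nrm m x) rho).
    - right. split; [assumption|]. apply Rmax_lub; lra.
    - left. apply Rmax_left. lra. }
  set (K := integ m eta). assert (HK : 0 <= K) by now apply integ_ge0.
  set (Z := fun u x => lform t (shift (shift x 1 xt) u nut)).
  assert (EZ : forall u x k, Z u x k = lform t x k + dot m (z k) xi + u * dot m (z k) nu).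
  { intros u x k. unfold Z. rewrite !lform_shift. unfold xt, nut. rewrite !Hinv. ring. }
  assert (HZc : forall k, cont (dprod dR (dpt m)) (fun p => Z (fst p) (snd p) k)).
  { intros k. apply (cont_ext _ (fun p => lform t (snd p) k + dot m (z k) xi + fst p * dot m (z k) nu)); [intros; now rewrite EZ|].
    apply cont_plus; [apply cont_plus; [|apply cont_const]|].
    - apply (cont_snd dR (dpt m) (fun x => lform t x k)), lform_cont.
    - apply cont_mult; [|apply cont_const]. apply (cont_fst dR (dpt m) (fun t => t)), cont_id. }
  assert (HZx : forall u k, cont (dpt m) (fun x => Z u x k)).
  { intros u k. apply (slice_l dR (dpt m) (fun u x => Z u x k)); [apply dR_refl|apply HZc]. }
  set (a := fun k => dot m (z k) nu).
  (* The total weight of point [i] during the move. At [u = 0] point [i] is the largest and has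
     weight at least [K / N]; at [u = 1] point [j0] leads by 1, and [exp b >= 1 + b >= 2 * INR N]
     leaves at most half of that. *)
  set (Sf := fun u => integ m (fun x => sw b N (Z u x) i * eta x)).
  set (Sf' := fun u => integ m (fun x => b * rsum N (fun j => sw b N (Z u x) i * sw b N (Z u x) j * (a i - a j)) * eta x)).
  assert (HD : forall u, is_derive Sf u (Sf' u)).
  { destruct Heta as [Hetac [B HBs]].
    apply (integ_derive m (fun u x => sw b N (Z u x) i * eta x)
      (fun u x => b * rsum N (fun j => sw b N (Z u x) i * sw b N (Z u x) j * (a i - a j)) * eta x) B).
    - intros u x. rewrite Rmult_comm.
      apply (is_derive_ext (fun u => eta x * sw b N (Z u x) i)); [intros; apply Rmult_comm|].
      apply is_derive_scal. apply (is_derive_sw b N HN (fun u => Z u x) a); [|assumption].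
      intros k _. apply (is_derive_ext (fun u => lform t x k + dot m (z k) xi + u * a k)).
      + intros v. now rewrite EZ.
      + auto_derive; [exact I|ring].
    - apply cont_mult; [|now apply (cont_snd dR (dpt m))].
      apply (cont_sw b N HN _ (fun p => Z (fst p) (snd p))); auto.
    - apply cont_mult; [|now apply (cont_snd dR (dpt m))].
      apply cont_scal, cont_rsum. intros j Hj. apply cont_mult; [|apply cont_const].
      apply cont_mult; apply (cont_sw b N HN _ (fun p => Z (fst p) (snd p))); auto.
    - intros u x k Hk Hx. rewrite (HBs x k Hk Hx). ring.
    - intros u x k Hk Hx. rewrite (HBs x k Hk Hx). ring. }
  assert (HNp : 0 < INR N) by (apply lt_0_INR; lia).
  assert (HCsw : forall u k, (k < N)%nat -> cont (dpt m) (fun x => sw b N (Z u x) k)).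
  { intros u k Hk. apply cont_sw; auto. }
  assert (HS0 : / INR N * K <= Sf 0).
  { unfold Sf, K. rewrite <- integ_scal by assumption. apply integ_le.
    - now apply Cc_scal.
    - apply Cc_mult; auto.
    - intros x. destruct (Hcase x) as [E|[Hx _]]; [rewrite E; lra|].
      apply Rmult_le_compat_r; [apply Heta0|]. apply sw_lower; auto.
      intros k Hk. rewrite !EZ, !Rmult_0_l, !Rplus_0_r. now apply D1. }
  assert (HS1 : Sf 1 <= / (2 * INR N) * K).
  { unfold Sf, K. rewrite <- integ_scal by assumption. apply integ_le.
    - apply Cc_mult; auto.
    - now apply Cc_scal.
    - intros x. destruct (Hcase x) as [E|[Hx _]]; [rewrite E; lra|].
      apply Rmult_le_compat_r; [apply Heta0|]. apply Rle_trans with (exp (- b)).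
      + apply (sw_upper b N Hb HN _ i j0 Hj0). rewrite !EZ, !Rmult_1_l. specialize (D2 x Hx). lra.
      + rewrite exp_Ropp. apply Rinv_le_contravar; [lra|]. pose proof (exp_ineq1_le b). lra. }
  destruct (MVT_gen Sf 0 1 Sf') as [u [Hu Eu]].
  { intros; apply HD. }
  { intros u _. apply continuity_pt_filterlim. apply (ex_derive_continuous Sf). eexists; apply HD. }
  rewrite Rmin_left, Rmax_right in Hu by lra. rewrite Rminus_0_r, Rmult_1_r in Eu.
  set (Q := fun j => integ m (fun x => sw b N (Z u x) i * sw b N (Z u x) j * eta x)).
  assert (HQC : forall j, (j < N)%nat -> Cc m (fun x => sw b N (Z u x) i * sw b N (Z u x) j * eta x)).
  { intros j Hj. apply Cc_mult; [|assumption]. apply cont_mult; auto. }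
  assert (ES : Sf' u = - (b * rsum N (fun j => (a j - a i) * Q j))).
  { unfold Sf'. rewrite (integ_ext m _ (fun x => rsum N (fun j => (b * (a i - a j)) * (sw b N (Z u x) i * sw b N (Z u x) j * eta x)))).
    2: { intros x. rewrite <- rsum_scal, <- rsum_mult_r. apply rsum_ext; intros; ring. }
    rewrite integ_rsum by (intros; now apply Cc_scal, HQC).
    rewrite <- rsum_scal. rewrite <- (Rmult_1_l (rsum N (fun k => b * _))), Ropp_mult_distr_l, <- rsum_scal.
    apply rsum_ext. intros j Hj. rewrite integ_scal by now apply HQC. unfold Q. ring. }
  (* Translation invariance brings [Q j] back to [pairw]: on the support of [eta] the translated
     [Wgt] is at least 1, and [eta <= 1]. *)
  assert (HQ : forall j, (j < N)%nat -> 0 <= Q j <= pairw t i j).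
  { intros j Hj. assert (Hsp : forall x, 0 <= sw b N (Z u x) i * sw b N (Z u x) j).
    { intros x. apply Rmult_le_pos; left; now apply sw_pos. }
    split.
    - apply integ_ge0; [now apply HQC|]. intros x. apply Rmult_le_pos; auto.
    - set (h := fun x => sw b N (lform t x) i * sw b N (lform t x) j * Wgt m R0 x).
      assert (Hh : Cc m h) by now apply pairw_Cc.
      unfold pairw. fold h. rewrite <- (integ_shift m h u nut Hh).
      rewrite <- (integ_shift m (fun x => h (shift x u nut)) 1 xt) by now apply Cc_shift.
      apply integ_le; [now apply HQC|apply (Cc_shift m (fun x => h (shift x u nut))); now apply Cc_shift|].
      intros x. unfold h. fold (Z u x). apply Rmult_le_compat_l; [auto|].
      destruct (Hcase x) as [E|[Hx Hx1]]; [rewrite E; apply Wgt_ge0|]. specialize (DR x u Hx Hu). lra. }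
  assert (HSum : rsum N (fun j => (a j - a i) * Q j) <= Lam * pair_row t i).
  { unfold pair_row. rewrite <- rsum_scal. apply rsum_le. intros j Hj. specialize (HQ j Hj). specialize (D3 j Hj). fold (a j) (a i) in D3.
    pose proof (HB i j Hi Hj) as HBij. apply Rle_trans with (Lam * bdist m n (z i) (z j) * Q j).
    - apply Rmult_le_compat_r; lra.
    - rewrite Rmult_assoc. apply Rmult_le_compat_l; [lra|]. apply Rmult_le_compat_l; lra. }
  assert (HF : / (2 * INR N) * K <= b * rsum N (fun j => (a j - a i) * Q j)).
  { rewrite ES in Eu. replace (/ INR N) with (2 * / (2 * INR N)) in HS0 by (field; lra). lra. }
  apply (Rmult_le_compat_l (2 * INR N)) in HF; [|lra].
  rewrite <- Rmult_assoc, Rinv_r, Rmult_1_l in HF by lra. fold eta. fold K.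
  eapply Rle_trans; [exact HF|].
  replace (2 * INR N * Lam * b * pair_row t i) with
    (2 * INR N * (b * (Lam * pair_row t i))) by ring.
  apply Rmult_le_compat_l; [lra|]. apply Rmult_le_compat_l; lra.
Qed.

End Interpolation.

Lemma nrm_Dg m n c s C x : Rabs c <= C -> Rabs s <= C -> nrm m (Dg n c s x) <= C * nrm m x.
Proof.
  intros Hc Hs. assert (HC : 0 <= C) by (pose proof (Rabs_pos c); lra).
  eapply Rle_trans; [apply Rle_abs|]. apply Rabs_le_of_sqr; [apply Rmult_le_pos; [assumption|apply nrm_ge0]|].
  replace (C * nrm m x * (C * nrm m x)) with (C * C * (nrm m x * nrm m x)) by ring.
  rewrite !nrm_sq. unfold dot. rewrite <- rsum_scal. apply rsum_le. intros k _.
  assert (Hsq : forall u, Rabs u <= C -> u * x k * (u * x k) <= C * C * (x k * x k)).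
  { intros u Hu. replace (u * x k * (u * x k)) with (u * u * (x k * x k)) by ring.
    apply Rmult_le_compat_r; [apply Rle_0_sqr|].
    rewrite <- (Rabs_pos_eq (u * u)), Rabs_mult by apply Rle_0_sqr. apply Rmult_le_compat; auto; apply Rabs_pos. }
  unfold Dg. destruct (lt_dec k n); auto.
Qed.

Lemma cont_fmax {T} (d : T -> T -> R) M (f : T -> nat -> R) :
  (forall i, (i <= M)%nat -> cont d (fun x => f x i)) -> cont d (fun x => fmax M (f x)).
Proof.
  induction M as [|M IH]; intros H; simpl; [apply H; lia|].
  apply cont_Rmax; [apply IH; intros; apply H; lia|apply H; lia].
Qed.

Lemma derive_increasing (f f' : R -> R) a b c : a <= b -> (forall t, is_derive f t (f' t)) ->
  (forall t, a <= t <= b -> c <= f' t) -> f a + c * (b - a) <= f b.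
Proof.
  intros Hab HD Hc. destruct (MVT_gen f a b f') as [t [Ht E]].
  { intros; apply HD. }
  { intros t _. apply continuity_pt_filterlim. apply (ex_derive_continuous f). eexists; apply HD. }
  rewrite Rmin_left, Rmax_right in Ht by lra. specialize (Hc t Ht).
  apply (Rmult_le_compat_r (b - a)) in Hc; lra.
Qed.

(** The gain [c] does not depend on [b]: the factor [b] of the derivative cancels the [/ b] in the
    lower bound for the pair weights. *)
Lemma interp_increase m n N (z : nat -> point) i1 i2 : (1 <= N)%nat ->
  (forall i j, (i < N)%nat -> (j < N)%nat -> 0 <= bdist m n (z i) (z j)) ->
  (i1 < N)%nat -> (i2 < N)%nat -> 0 < bdist m n (z i1) (z i2) ->
  exists R0 c b0, 0 < R0 /\ 0 < c /\ 0 < b0 /\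
    forall b, b0 <= b -> interp m n N z R0 b 0 + c <= interp m n N z R0 b (PI / 2).
Proof.
  intros HN HB H1 H2 H12.
  destruct (exposed_direction m n N z i1 i2 HB H1 H2 H12) as
    [i [xi [eps [nu0 [Lam0 [Hi [Heps [HLam0 [Hexp [Hnu Hpos]]]]]]]]]].
  set (e := fun k j => z k j - z i j).
  set (a0 := dot m nu0 (e i2)). fold (e i2) in Hpos. fold a0 in Hpos.
  (* [nu0] is scaled up until point [i2] overtakes point [i] by 1 in spite of the losses, at most
     [|e i2| * |xi|] from [xi] and at most [|e i2|] from [x]. *)
  set (lam := (1 + nrm m (e i2) * (nrm m xi + 1)) / a0).
  assert (Hlam : 0 < lam).
  { apply Rdiv_lt_0_compat; [|assumption]. pose proof (nrm_ge0 m (e i2)). pose proof (nrm_ge0 m xi). nra. }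
  assert (Hlama : lam * a0 = 1 + nrm m (e i2) * (nrm m xi + 1)) by (unfold lam; field; lra).
  set (nu := fun j => lam * nu0 j).
  set (Lam := lam * Lam0). assert (HLam : 0 < Lam) by (apply Rmult_lt_0_compat; assumption).
  destruct (common_bound N (fun k c => nrm m (e k) = 0 \/ 1 <= c * (eps * nrm m (e k)))) as [C [HC HCk]].
  { intros k c c' _ [E|Hc] Hcc; [now left|right]. eapply Rle_trans; [exact Hc|]. apply Rmult_le_compat_r; [|assumption].
    apply Rmult_le_pos; [lra|apply nrm_ge0]. }
  { intros k _. destruct (Req_dec (nrm m (e k)) 0) as [E|E]; [exists 0; now left|].
    exists (/ (eps * nrm m (e k))). right. apply Req_le. field. split; [assumption|lra]. }
  (* So small that the deficit [eps * |e k|^2] outweighs the perturbation [rho * |e k|] for every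
     [k]; where [e k] vanishes there is no perturbation. *)
  set (rho := Rmin 1 (/ C)).
  assert (Hrho : 0 < rho <= 1) by (split; [apply Rmin_pos; [lra|now apply Rinv_0_lt_compat]|apply Rmin_l]).
  assert (HrhoC : rho <= / C) by apply Rmin_r.
  (* On the middle range of [t] the factors [/ sin t] and [/ cos t] are at most 2, so the translated
     ball stays within radius [R1], where [depth >= R0^2 - R1^2 >= 1]. *)
  set (R1 := 1 + 2 * nrm m xi + 2 * nrm m nu).
  assert (HR1 : 0 < R1) by (unfold R1; pose proof (nrm_ge0 m xi); pose proof (nrm_ge0 m nu); lra).
  set (R0 := R1 + 1).
  set (K := integ m (fun x => Rmax 0 (rho - nrm m x))).
  assert (HK : 0 < K) by (apply bump_integ_pos; lra).
  assert (HNp : 0 < INR N) by (apply lt_0_INR; lia).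
  (* One eighth of [K / (2 * INR N * Lam)], because [b / 2] comes with [sin t * cos t >= / 4]. *)
  set (c1 := K / (16 * INR N * Lam)).
  assert (HNL : 0 < INR N * Lam) by (apply Rmult_lt_0_compat; assumption).
  assert (Hc1 : 0 < c1) by (apply Rdiv_lt_0_compat; lra).
  exists R0, (c1 * (PI / 3 - PI / 6)), (2 * INR N).
  pose proof PI_RGT_0 as HPI.
  split; [unfold R0; lra|]. split; [apply Rmult_lt_0_compat; lra|]. split; [lra|].
  intros b Hb. assert (Hb0 : 0 < b) by lra.
  assert (HR0 : 0 <= R0) by (unfold R0; lra).
  set (E' := fun t => b / 2 * (sin t * cos t) *
    rsum N (pair_row m n N z R0 b t)).
  assert (HD : forall t, is_derive (interp m n N z R0 b) t (E' t)) by (intros t; now apply is_derive_interp).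
  assert (HS : forall t, 0 <= rsum N (pair_row m n N z R0 b t)).
  { intros t. apply rsum_ge0. intros k Hk. apply rsum_ge0. intros j Hj.
    apply Rmult_le_pos; [now apply HB|now apply pairw_ge0]. }
  assert (HE0 : forall t, 0 <= t <= PI / 2 -> 0 <= E' t).
  { intros t Ht. unfold E'. apply Rmult_le_pos; [|apply HS]. apply Rmult_le_pos; [lra|].
    apply Rmult_le_pos; [apply sin_ge_0|apply cos_ge_0]; lra. }
  (* Near the ends [sin t * cos t] degenerates; there only monotonicity is used. *)
  assert (Hmid : forall t, PI / 6 <= t <= PI / 3 -> c1 <= E' t).
  { intros t Ht.
    assert (Hsin : / 2 <= sin t).
    { replace (/ 2) with (sin (PI / 6)) by (rewrite sin_PI6; lra). apply sin_incr_1; lra. }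
    assert (Hcos : / 2 <= cos t).
    { replace (/ 2) with (cos (PI / 3)) by (rewrite cos_PI3; lra). apply cos_decr_1; lra. }
    assert (Hsin1 : Rabs (sin t) <= 1) by (apply Rabs_le_between, SIN_bound).
    assert (Hcos1 : Rabs (cos t) <= 1) by (apply Rabs_le_between, COS_bound).
    assert (Hinv : forall u, / 2 <= u -> Rabs (/ u) <= 2).
    { intros u Hu. rewrite Rabs_pos_eq by (left; apply Rinv_0_lt_compat; lra).
      rewrite <- (Rinv_inv 2). apply Rinv_le_contravar; lra. }
    assert (Hdiff : forall x k, dot m (e k) (Dg n (cos t) (sin t) x) = lform m n z t x k - lform m n z t x i).
    { intros x k. unfold e, lform. now rewrite dot_minus_l. }
    assert (HDg : forall x k, nrm m x < rho -> Rabs (dot m (e k) (Dg n (cos t) (sin t) x)) <= nrm m (e k) * rho).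
    { intros x k Hx. eapply Rle_trans; [apply dot_le_nrm|]. apply Rmult_le_compat_l; [apply nrm_ge0|].
      pose proof (nrm_Dg m n (cos t) (sin t) 1 x Hcos1 Hsin1). lra. }
    pose proof (pair_weight_lower m n N z R0 b HN HR0 Hb0 HB t i i2 xi nu rho Lam Hi H2 ltac:(lra) ltac:(lra) Hrho HLam Hb) as HP.
    fold K in HP.
    assert (HP' : K <= 2 * INR N * Lam * b * pair_row m n N z R0 b t i).
    { apply HP; clear HP.
      - intros x Hx k Hk. specialize (Hexp k Hk). fold (e k) in Hexp. rewrite <- nrm_sq in Hexp.
        specialize (HDg x k Hx). rewrite Hdiff in HDg. apply Rabs_le_between in HDg.
        assert (Hxk : dot m xi (e k) = dot m (z k) xi - dot m (z i) xi).
        { unfold e. rewrite dot_minus_r, !(dot_comm m xi). reflexivity. }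
        rewrite Hxk in Hexp. pose proof (nrm_ge0 m (e k)) as Hd.
        assert (nrm m (e k) * rho <= eps * (nrm m (e k) * nrm m (e k))); [|lra].
        destruct (HCk k Hk) as [E|Hck]; [rewrite E; lra|].
        replace (eps * (nrm m (e k) * nrm m (e k))) with (nrm m (e k) * (eps * nrm m (e k))) by ring.
        apply Rmult_le_compat_l; [assumption|]. eapply Rle_trans; [exact HrhoC|].
        apply (Rmult_le_reg_l C); [assumption|]. rewrite Rinv_r by lra. exact Hck.
      - intros x Hx. specialize (HDg x i2 Hx). rewrite Hdiff in HDg. apply Rabs_le_between in HDg.
        assert (Hx2 : dot m xi (e i2) = dot m (z i2) xi - dot m (z i) xi).
        { unfold e. rewrite dot_minus_r, !(dot_comm m xi). reflexivity. }
        assert (Hn2 : lam * a0 = dot m (z i2) nu - dot m (z i) nu).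
        { unfold a0, nu, e. rewrite dot_minus_r, !dot_scal_r, !(dot_comm m nu0). ring. }
        pose proof (dot_le_nrm m xi (e i2)) as Hcs. rewrite Hx2 in Hcs. apply Rabs_le_between in Hcs.
        rewrite Hlama in Hn2.
        assert (nrm m (e i2) * rho <= nrm m (e i2) * 1) by (apply Rmult_le_compat_l; [apply nrm_ge0|lra]).
        lra.
      - intros j Hj. specialize (Hnu j Hj). apply (Rmult_le_compat_l lam) in Hnu; [|lra].
        unfold nu, Lam. rewrite !dot_scal_r. rewrite dot_minus_r, !(dot_comm m nu0) in Hnu. lra.
      - intros x u Hx Hu.
        set (y1 := Dg n (/ cos t) (/ sin t) xi). set (y2 := Dg n (/ cos t) (/ sin t) nu).
        assert (Hy1 : nrm m y1 <= 2 * nrm m xi) by (apply nrm_Dg; now apply Hinv).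
        assert (Hy2 : nrm m y2 <= 2 * nrm m nu) by (apply nrm_Dg; now apply Hinv).
        set (y := shift (shift x 1 y1) u y2).
        assert (Hy : nrm m y <= R1).
        { unfold y, shift at 1. eapply Rle_trans; [apply (nrm_triangle m (shift x 1 y1) (fun j => u * y2 j))|].
          rewrite nrm_scal, (Rabs_pos_eq u) by lra. unfold shift.
          pose proof (nrm_triangle m x (fun j => 1 * y1 j)) as Htr. rewrite nrm_scal, Rabs_R1, Rmult_1_l in Htr.
          pose proof (nrm_ge0 m y2). unfold R1. cbv beta in Htr. nra. }
        assert (Hdep : 1 <= depth m R0 y).
        { unfold depth. eapply Rle_trans; [|apply Rmax_r]. rewrite <- nrm_sq. pose proof (nrm_ge0 m y).
          assert (nrm m y * nrm m y <= R1 * R1) by (apply Rmult_le_compat; lra). unfold R0. lra. }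
        unfold Wgt. nra. }
    pose proof (interp_derive_sum_ge m n N z R0 b HN HR0 HB t i Hi) as Hge.
    set (S1 := pair_row m n N z R0 b t i) in *.
    specialize (HS t). unfold E'.
    set (S2 := rsum N (pair_row m n N z R0 b t)) in *.
    assert (Hbs : K / (2 * INR N * Lam) <= b * S2).
    { apply (Rmult_le_reg_l (2 * INR N * Lam)); [lra|].
      replace (2 * INR N * Lam * (K / (2 * INR N * Lam))) with K by (field; split; lra).
      eapply Rle_trans; [exact HP'|].
      rewrite Rmult_assoc. apply Rmult_le_compat_l; [lra|]. apply Rmult_le_compat_l; lra. }
    replace c1 with (/ 8 * (K / (2 * INR N * Lam))) by (unfold c1; field; split; lra).
    assert (Hsc : / 4 <= sin t * cos t) by (replace (/ 4) with (/ 2 * / 2) by field; apply Rmult_le_compat; lra).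
    apply Rle_trans with (/ 8 * (b * S2)); [apply Rmult_le_compat_l; lra|].
    replace (b / 2 * (sin t * cos t) * S2) with (/ 2 * (sin t * cos t) * (b * S2)) by field.
    apply Rmult_le_compat_r; [apply Rmult_le_pos; lra|lra]. }
  pose proof (derive_increasing _ E' 0 (PI / 6) 0 ltac:(lra) HD ltac:(intros; apply HE0; lra)) as I1.
  pose proof (derive_increasing _ E' (PI / 6) (PI / 3) c1 ltac:(lra) HD Hmid) as I2.
  pose proof (derive_increasing _ E' (PI / 3) (PI / 2) 0 ltac:(lra) HD ltac:(intros; apply HE0; lra)) as I3.
  lra.
Qed.

(** * Strict comparison of mean widths *)

Lemma rsum_cat n (f : nat -> R) : rsum (n + n) f = rsum n f + rsum n (fun k => f (n + k)%nat).
Proof. apply rsum_app. Qed.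

Lemma cat_l n x y k : (k < n)%nat -> cat n x y k = x k.
Proof. unfold cat. now destruct (lt_dec k n). Qed.

Lemma cat_r n x y k : cat n x y (n + k)%nat = y k.
Proof. unfold cat. destruct (lt_dec (n + k) n); [lia|]. f_equal. lia. Qed.

Lemma dot_cat n a b x y : dot (n + n) (cat n a b) (cat n x y) = dot n a x + dot n b y.
Proof.
  unfold dot. rewrite rsum_cat. f_equal; apply rsum_ext; intros k Hk; [now rewrite !cat_l|now rewrite !cat_r].
Qed.

Lemma Dg_cat n c s x y : Dg n c s (cat n x y) = cat n (fun k => c * x k) (fun k => s * y k).
Proof. apply functional_extensionality; intros k. unfold Dg, cat. now destruct (lt_dec k n). Qed.

Lemma bdist_cat n a b x y : bdist (n + n) n (cat n a b) (cat n x y) = sqdist n b y - sqdist n a x.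
Proof.
  unfold bdist, bform. rewrite !sqdist_dot.
  replace (fun k => cat n a b k - cat n x y k) with (cat n (fun k => a k - x k) (fun k => b k - y k)).
  - rewrite Dg_cat, dot_cat, !dot_scal_r. ring.
  - apply functional_extensionality; intros k. unfold cat. now destruct (lt_dec k n).
Qed.

Definition hmax (n M : nat) (p : nat -> point) (x : point) : R := fmax M (fun i => dot n (p i) x).

(** The marginal of [wgt] on [R^n], as a function of the norm. *)
Definition marg (n : nat) (R0 s : R) : R := integ n (fun y => 4 * Rmax 0 (R0 * R0 - (s * s + dot n y y))).

Definition mean_width (n M : nat) (R0 : R) (p : nat -> point) : R :=
  integ n (fun x => hmax n M p x * marg n R0 (nrm n x)).

Lemma marg_supp_aux n R0 s y k : 0 <= R0 -> (k < n)%nat -> R0 < Rabs (y k) -> Rmax 0 (R0 * R0 - (s * s + dot n y y)) = 0.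
Proof.
  intros HR0 Hk Hy. apply Rmax_left. pose proof (depth_supp n R0 HR0 y k Hk Hy) as H. unfold depth in H.
  pose proof (Rmax_r 0 (R0 * R0 - dot n y y)). rewrite H in H0. pose proof (Rle_0_sqr s) as Hs. unfold Rsqr in Hs. lra.
Qed.

Lemma marg_slice_Cc n R0 s : 0 <= R0 -> Cc n (fun y => 4 * Rmax 0 (R0 * R0 - (s * s + dot n y y))).
Proof.
  intros HR0. split.
  - apply cont_scal, cont_Rmax; [apply cont_const|]. apply cont_minus; [apply cont_const|].
    apply cont_plus; [apply cont_const|]. apply cont_rsum. intros; apply cont_mult; now apply cont_coord.
  - exists R0. intros y k Hk Hy. rewrite (marg_supp_aux n R0 s y k) by assumption. ring.
Qed.

Lemma marg_ge0 n R0 s : 0 <= R0 -> 0 <= marg n R0 s.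
Proof.
  intros HR0. apply integ_ge0; [now apply marg_slice_Cc|]. intros y. pose proof (Rmax_l 0 (R0 * R0 - (s * s + dot n y y))). lra.
Qed.

Lemma marg_out n R0 s : 0 <= R0 -> R0 <= Rabs s -> marg n R0 s = 0.
Proof.
  intros HR0 Hs. unfold marg. etransitivity; [|apply (integ_0 n)]. apply integ_ext; intros y.
  rewrite Rmax_left; [ring|]. pose proof (dot_self_ge0 n y).
  assert (R0 * R0 <= s * s); [|lra].
  replace (s * s) with (Rabs s * Rabs s) by (rewrite <- Rabs_mult; apply Rabs_pos_eq, Rle_0_sqr).
  apply Rmult_le_compat; lra.
Qed.

Lemma cont_marg n R0 : 0 <= R0 -> cont dR (marg n R0).
Proof.
  intros HR0. apply (integ_cont n dR (fun s y => 4 * Rmax 0 (R0 * R0 - (s * s + dot n y y))) R0).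
  - apply dR_refl.
  - apply cont_scal, cont_Rmax; [apply cont_const|]. apply cont_minus; [apply cont_const|].
    apply cont_plus.
    + apply cont_mult; apply (cont_fst dR (dpt n) (fun t => t)), cont_id.
    + apply (cont_snd dR (dpt n) (fun y => dot n y y)). apply cont_rsum. intros; apply cont_mult; now apply cont_coord.
  - intros s y k Hk Hy. rewrite (marg_supp_aux n R0 s y k) by assumption. ring.
Qed.

Lemma wgt_cat n R0 x y : wgt (n + n) R0 (cat n x y) = 4 * Rmax 0 (R0 * R0 - (nrm n x * nrm n x + dot n y y)).
Proof. unfold wgt, depth. now rewrite dot_cat, nrm_sq. Qed.

Lemma cont_hmax n M p : cont (dpt n) (hmax n M p).
Proof. apply cont_fmax. intros; apply cont_dot. Qed.

(** At [t = 0] the forms see only the first block of coordinates, at [PI / 2] only the second;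
    integrating out the idle block turns [wgt] into [marg]. *)
Lemma strict_mean_width n M p q i1 i2 :
  (forall i j, (i < S M)%nat -> (j < S M)%nat -> sqdist n (p i) (p j) <= sqdist n (q i) (q j)) ->
  (i1 < S M)%nat -> (i2 < S M)%nat -> sqdist n (p i1) (p i2) < sqdist n (q i1) (q i2) ->
  exists R0, 0 < R0 /\
    mean_width n M R0 p < mean_width n M R0 q.
Proof.
  intros Hpq H1 H2 H12.
  set (N := S M). set (m := (n + n)%nat). set (z := fun i => cat n (p i) (q i)).
  assert (HN : (1 <= N)%nat) by (unfold N; lia).
  assert (Hz : forall i j, bdist m n (z i) (z j) = sqdist n (q i) (q j) - sqdist n (p i) (p j)) by (intros; apply bdist_cat).
  destruct (interp_increase m n N z i1 i2 HN) as [R0 [c [b0 [HR0 [Hc [Hb0 Hincr]]]]]]; try assumption.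
  { intros i j Hi Hj. rewrite Hz. specialize (Hpq i j Hi Hj). lra. }
  { rewrite Hz. lra. }
  exists R0. split; [assumption|].
  assert (HR0' : 0 <= R0) by lra.
  set (H := fun t => integ m (fun x => fmax M (lform m n z t x) * wgt m R0 x)).
  assert (Hw : Cc m (wgt m R0)) by now apply wgt_Cc.
  assert (HCmax : forall t, Cc m (fun x => fmax M (lform m n z t x) * wgt m R0 x)).
  { intros t. apply Cc_mult; [|assumption]. apply cont_fmax. intros; apply lform_cont. }
  assert (HCsm : forall b t, Cc m (fun x => smax b N (lform m n z t x) * wgt m R0 x)).
  { intros b t. apply Cc_mult; [|assumption]. apply cont_smax; [assumption|]. intros; apply lform_cont. }
  set (Iw := integ m (wgt m R0)).
  assert (HIw : 0 <= Iw) by (apply integ_ge0; [assumption|intros x; pose proof (depth_ge0 m R0 x); unfold wgt; lra]).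
  assert (Hw0 : forall x, 0 <= wgt m R0 x) by (intros x; pose proof (depth_ge0 m R0 x); unfold wgt; lra).
  set (l := ln (INR N)). 
  assert (Hstrict : H 0 < H (PI / 2)).
  { assert (Hl : 0 <= l).
    { unfold l. rewrite <- ln_1. apply ln_le; [lra|]. change 1 with (INR 1). apply le_INR. assumption. }
    (* Large enough for the smoothing error [l * Iw / b] to stay below the gain [c]. *)
    set (b := b0 + 2 * l * Iw / c).
    assert (Hlc : 0 <= 2 * l * Iw / c) by (apply Rdiv_le_0_compat; [|assumption]; nra).
    assert (Hb : b0 <= b) by (unfold b; lra). assert (Hbp : 0 < b) by lra.
    specialize (Hincr b Hb).
    assert (L1 : H 0 <= interp m n N z R0 b 0).
    { apply integ_le; auto. intros x. apply Rmult_le_compat_r; [auto|].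
      apply fmax_lub. intros i Hi. apply smax_lower; [assumption|unfold N; lia]. }
    assert (L2 : interp m n N z R0 b (PI / 2) <= H (PI / 2) + / b * l * Iw).
    { unfold Iw, H. rewrite <- integ_scal, <- integ_plus by (auto; now apply Cc_scal).
      apply integ_le; auto.
      - apply Cc_plus; [auto|now apply Cc_scal].
      - intros x. rewrite <- Rmult_plus_distr_r. apply Rmult_le_compat_r; [auto|].
        destruct (fmax_ex M (lform m n z (PI / 2) x)) as [i [Hi E]]. rewrite E.
        apply smax_upper; [assumption|assumption|]. intros k Hk. rewrite <- E. apply fmax_ge. unfold N in Hk; lia. }
    assert (L3 : / b * l * Iw < c).
    { apply (Rmult_lt_reg_l b); [assumption|].
      replace (b * (/ b * l * Iw)) with (l * Iw) by (field; lra).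
      unfold b. replace ((b0 + 2 * l * Iw / c) * c) with (b0 * c + 2 * (l * Iw)) by (field; lra).
      assert (0 < b0 * c) by (apply Rmult_lt_0_compat; assumption).
      assert (0 <= l * Iw) by (apply Rmult_le_pos; assumption). lra. }
    lra. }
  assert (Hcatc : cont (dprod (dpt n) (dpt n)) (fun pt => wgt m R0 (cat n (fst pt) (snd pt)))).
  { apply (cont_pt _ m (fun pt => cat n (fst pt) (snd pt))); [|apply Hw]. intros k Hk. unfold cat.
    destruct (lt_dec k n).
    - apply (cont_fst (dpt n) (dpt n) (fun x => x k)). now apply cont_coord.
    - apply (cont_snd (dpt n) (dpt n) (fun x => x (k - n)%nat)). apply cont_coord. unfold m in Hk; lia. }
  assert (E0 : H 0 = mean_width n M R0 p).
  { unfold H, m. rewrite integ_split by apply HCmax. apply integ_ext; intros x. unfold marg.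
    rewrite <- integ_scal by now apply marg_slice_Cc. apply integ_ext; intros y. rewrite wgt_cat. f_equal.
    apply fmax_ext. intros i Hi. unfold lform. rewrite cos_0, sin_0, Dg_cat. unfold z.
    rewrite dot_cat, !dot_scal_r. ring. }
  assert (E1 : H (PI / 2) = mean_width n M R0 q).
  { unfold H, m. rewrite integ_split by apply HCmax.
    rewrite (integ_fubini n n (fun x y => fmax M (lform (n + n) n z (PI / 2) (cat n x y)) * wgt (n + n) R0 (cat n x y)) R0).
    - apply integ_ext; intros y. unfold marg.
      rewrite <- integ_scal by now apply marg_slice_Cc. apply integ_ext; intros x. f_equal.
      + apply fmax_ext. intros i Hi. unfold lform. rewrite cos_PI2, sin_PI2, Dg_cat. unfold z.
        rewrite dot_cat, !dot_scal_r. ring.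
      + rewrite wgt_cat, !nrm_sq. do 3 f_equal. ring.
    - apply cont_mult; [|apply Hcatc].
      apply (cont_fmax _ M (fun pt => lform (n + n) n z (PI / 2) (cat n (fst pt) (snd pt)))). intros i Hi.
      apply (cont_pt _ m (fun pt => cat n (fst pt) (snd pt)) (fun x => lform (n + n) n z (PI / 2) x i)); [|apply lform_cont].
      intros k Hk. unfold cat. destruct (lt_dec k n).
      + apply (cont_fst (dpt n) (dpt n) (fun x => x k)). now apply cont_coord.
      + apply (cont_snd (dpt n) (dpt n) (fun x => x (k - n)%nat)). apply cont_coord. unfold m in Hk; lia.
    - intros x y k Hk Hy. rewrite wgt_cat, (marg_supp_aux n R0 _ y k) by assumption. ring.
    - intros y x k Hk Hx. rewrite wgt_cat, nrm_sq, Rplus_comm, <- (nrm_sq n y).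
      rewrite (marg_supp_aux n R0 (nrm n y) x k) by assumption. ring. }
  rewrite <- E0, <- E1. exact Hstrict.
Qed.

(** * First order expansion of the volume *)

(** For [e = 1 / r] its sublevel [r] approximates the union of the balls of radius [r]; for [e = - 1 / r] and the
    points [- p i] it approximates their intersection. *)
Definition gphi (n M : nat) (p : nat -> point) (e : R) (x : point) : R := nrm n x - e * hmax n M p x.

Lemma hmax_bound n M p D x : within n M D p -> Rabs (hmax n M p x) <= D * nrm n x.
Proof.
  intros HD. unfold hmax. destruct (fmax_ex M (fun i => dot n (p i) x)) as [i [Hi ->]].
  eapply Rle_trans; [apply dot_le_nrm|]. apply Rmult_le_compat_r; [apply nrm_ge0|auto].
Qed.

Lemma gphi_low n M p D e x : within n M D p -> Rabs e * D <= / 2 ->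
  / 2 * nrm n x <= gphi n M p e x.
Proof.
  intros HD He. pose proof (hmax_bound n M p D x HD) as H. pose proof (nrm_ge0 n x).
  assert (Rabs (e * hmax n M p x) <= / 2 * nrm n x).
  { rewrite Rabs_mult. apply Rle_trans with (Rabs e * (D * nrm n x)).
    - apply Rmult_le_compat_l; [apply Rabs_pos|assumption].
    - rewrite <- Rmult_assoc. apply Rmult_le_compat_r; assumption. }
  pose proof (Rle_abs (e * hmax n M p x)). unfold gphi. lra.
Qed.

Lemma gphi_gauge n M p D e : within n M D p -> Rabs e * D <= / 2 ->
  gauge n (gphi n M p e).
Proof.
  intros HD He. split.
  - destruct (common_bound (S M) (fun i L => lipn n L (dot n (p i)))) as [L [HL HLi]].
    { intros k c c' _ H Hc. now apply (lipn_le n c). }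
    { intros k _. destruct (lipn_dot n (p k)) as [L [_ HL]]. now exists L. }
    exists (1 + Rabs (- e) * L). split.
    + pose proof (Rabs_pos (- e)). nra.
    + intros x y. pose proof (lipn_plus n 1 (Rabs (- e) * L) (nrm n) (fun x => - e * hmax n M p x) (nrm_lip n)
        (lipn_scal n L (- e) (hmax n M p) (lipn_fmax n L M (fun i => dot n (p i)) (fun i Hi => HLi i (proj2 (Nat.lt_succ_r i M) Hi)))) x y) as H.
      unfold gphi. eapply Rle_trans; [|exact H]. apply Req_le. f_equal. ring.
  - intros lam x Hlam. unfold gphi. rewrite nrm_scal, Rabs_pos_eq by lra.
    replace (hmax n M p (fun k => lam * x k)) with (lam * hmax n M p x); [ring|].
    unfold hmax. rewrite <- fmax_scal by assumption. apply fmax_ext. intros; now rewrite dot_scal_r.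
  - exists (/ 2). split; [lra|]. intros x. now apply (gphi_low n M p D).
Qed.

Lemma nrm_gauge n : gauge n (nrm n).
Proof.
  split.
  - exists 1. split; [lra|apply nrm_lip].
  - intros lam x Hlam. rewrite nrm_scal, Rabs_pos_eq; lra.
  - exists 1. split; [lra|intros; lra].
Qed.

Section Profile.
Variables (n : nat) (R0 : R).
Hypothesis HR0 : 0 < R0.

(** The primitive of [- marg] that vanishes from [R0] on: the derivative of [prof (|x| - e * h)] at
    [e = 0] is [h * marg |x|], the integrand of the mean width. *)
Definition prof (s : R) : R := RInt (marg n R0) s R0.

Let HR0' : 0 <= R0 := Rlt_le _ _ HR0.

Lemma is_derive_prof s : is_derive prof s (- marg n R0 s).
Proof.
  apply (is_derive_RInt' (marg n R0) prof s R0).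
  - apply filter_forall. intros u. apply (RInt_correct (marg n R0)), cont_ex_RInt. now apply cont_marg.
  - apply (proj1 (cont_dR_continuous (marg n R0))). now apply cont_marg.
Qed.

Lemma cont_prof : cont dR prof.
Proof. apply cont_dR_continuous. intros s. apply (ex_derive_continuous prof). eexists; apply is_derive_prof. Qed.

Lemma prof_dec s t : s <= t -> prof t <= prof s.
Proof.
  intros Hst. unfold prof. rewrite <- (RInt_Chasles_R (marg n R0) s t R0) by now apply cont_marg.
  assert (0 <= RInt (marg n R0) s t); [|lra].
  apply RInt_ge_0; [assumption|apply cont_ex_RInt; now apply cont_marg|intros; now apply marg_ge0].
Qed.

Lemma prof_out t : R0 <= t -> prof t = 0.
Proof.
  intros Ht. unfold prof. rewrite (RInt_ext _ (fun _ => 0)).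
  - rewrite RInt_const_R. toR; ring.
  - intros s. rewrite Rmin_right by lra. intros Hs. apply marg_out; [assumption|]. rewrite Rabs_pos_eq; lra.
Qed.

Lemma prof_0_pos : 0 < prof 0.
Proof.
  apply RInt_gt_0; [assumption| |].
  - intros s Hs. unfold marg. apply (integ_pos n _ orig).
    + now apply marg_slice_Cc.
    + intros y. pose proof (Rmax_l 0 (R0 * R0 - (s * s + dot n y y))). lra.
    + rewrite dot_orig, Rmax_right; nra.
  - intros s _. apply (proj1 (cont_dR_continuous (marg n R0))). now apply cont_marg.
Qed.

(** The cutoff does not change the integrand when [e] is small, and gives a common support for all [e]. *)
Definition vprof (M : nat) (p : nat -> point) (e : R) : R :=
  integ n (fun x => prof (gphi n M p e x) * trap 0 (2 * R0) 1 (nrm n x)).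

Lemma vprof_eq M p D e : within n M D p -> Rabs e * D <= / 2 ->
  vprof M p e = integ n (fun x => prof (gphi n M p e x)).
Proof.
  intros HD He. apply integ_ext. intros x. destruct (Rle_dec (nrm n x) (2 * R0)) as [H|H].
  - rewrite trap_in; [ring|lra|]. split; [apply nrm_ge0|assumption].
  - rewrite (prof_out (gphi n M p e x)); [ring|]. pose proof (gphi_low n M p D e x HD He). lra.
Qed.

Lemma is_derive_vprof M p : is_derive (vprof M p) 0 (mean_width n M R0 p).
Proof.
  set (chi := fun x => trap 0 (2 * R0) 1 (nrm n x)).
  assert (Hchi : cont (dpt n) chi).
  { apply (cont_comp_R _ (nrm n) (trap 0 (2 * R0) 1)); [apply trap_cont; lra|apply cont_nrm]. }
  assert (Hchis : supp n (2 * R0 + 1) chi).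
  { intros x k Hk Hx. apply trap_out; [lra|]. right. pose proof (coord_le_nrm n x k Hk). lra. }
  replace (mean_width n M R0 p)
    with (integ n (fun x => hmax n M p x * marg n R0 (gphi n M p 0 x) * chi x)).
  2: { apply integ_ext. intros x. unfold gphi. rewrite Rmult_0_l, Rminus_0_r.
       destruct (Rle_dec (nrm n x) (2 * R0)) as [H|H].
       - unfold chi. rewrite trap_in; [ring|lra|]. split; [apply nrm_ge0|assumption].
       - rewrite marg_out; [ring|assumption|]. rewrite Rabs_pos_eq by apply nrm_ge0. lra. }
  assert (Hphi : cont (dprod dR (dpt n)) (fun p' => gphi n M p (fst p') (snd p'))).
  { apply cont_minus; [apply (cont_snd dR (dpt n)), cont_nrm|]. apply cont_mult.
    - apply (cont_fst dR (dpt n) (fun t => t)), cont_id.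
    - apply (cont_snd dR (dpt n)), cont_hmax. }
  assert (Hcomp : forall h, cont dR h -> cont (dprod dR (dpt n)) (fun p' => h (gphi n M p (fst p') (snd p')))).
  { intros h Hh. now apply (cont_comp_R _ (fun p' => gphi n M p (fst p') (snd p')) h). }
  apply (integ_derive n (fun e x => prof (gphi n M p e x) * chi x)
     (fun e x => hmax n M p x * marg n R0 (gphi n M p e x) * chi x) (2 * R0 + 1)).
  - intros e x. rewrite (Rmult_comm _ (chi x)).
    apply (is_derive_ext (fun e => chi x * prof (gphi n M p e x))); [intros; apply Rmult_comm|].
    apply is_derive_scal.
    replace (hmax n M p x * marg n R0 (gphi n M p e x)) with (scal (- hmax n M p x) (- marg n R0 (gphi n M p e x)))
      by (unfold scal; simpl; unfold mult; simpl; ring).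
    apply (is_derive_comp prof (fun e => gphi n M p e x)); [apply is_derive_prof|].
    unfold gphi. auto_derive; [exact I|ring].
  - apply cont_mult; [apply Hcomp, cont_prof|now apply (cont_snd dR (dpt n))].
  - apply cont_mult; [|now apply (cont_snd dR (dpt n))].
    apply cont_mult; [apply (cont_snd dR (dpt n)), cont_hmax|]. apply Hcomp. now apply cont_marg.
  - intros e x k Hk Hx. rewrite (Hchis x k Hk Hx). ring.
  - intros e x k Hk Hx. rewrite (Hchis x k Hk Hx). ring.
Qed.

End Profile.

Lemma derive_sign f l : is_derive f 0 l -> f 0 = 0 -> 0 < l ->
  exists e0, 0 < e0 /\ forall x, x <> 0 -> Rabs x < e0 -> 0 < f x / x.
Proof.
  intros HD H0 Hl. apply is_derive_Reals in HD. destruct (HD l Hl) as [del Hdel].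
  exists del. split; [apply cond_pos|]. intros x Hx Hlt. specialize (Hdel x Hx Hlt).
  rewrite Rplus_0_l, H0, Rminus_0_r in Hdel. apply Rabs_def2 in Hdel. lra.
Qed.

(** For small [e] the volumes of unit balls are a fixed multiple of [vprof], whose value at 0 is
    common to all configurations and whose derivative there is the mean width. The factor
    [(1 - C * e * e) ^ n] has derivative 0 at 0, so it makes room for a second order error without
    affecting the sign. For a negative argument the comparison reverses. *)
Lemma gphi_volume_compare n M p q i1 i2 C : (1 <= n)%nat ->
  (forall i j, (i < S M)%nat -> (j < S M)%nat -> sqdist n (p i) (p j) <= sqdist n (q i) (q j)) ->
  (i1 < S M)%nat -> (i2 < S M)%nat -> sqdist n (p i1) (p i2) < sqdist n (q i1) (q i2) ->
  exists e0, 0 < e0 /\ forall e, 0 < e < e0 ->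
    Vol n (lev (gphi n M p e) 1) < (1 - C * e * e) ^ n * Vol n (lev (gphi n M q e) 1) /\
    Vol n (lev (gphi n M q (- e)) 1) < (1 - C * e * e) ^ n * Vol n (lev (gphi n M p (- e)) 1).
Proof.
  intros Hn Hpq H1 H2 H12.
  destruct (strict_mean_width n M p q i1 i2 Hpq H1 H2 H12) as [R0 [HR0 Hlt]].
  destruct (bound_points n M p) as [Dp [HDp HDpi]]. destruct (bound_points n M q) as [Dq [HDq HDqi]].
  set (D := Dp + Dq + 1).
  assert (HP : within n M D p) by (intros i Hi; specialize (HDpi i Hi); unfold D; lra).
  assert (HQ : within n M D q) by (intros i Hi; specialize (HDqi i Hi); unfold D; lra).
  assert (HDpos : 0 < D) by (unfold D; lra).
  set (I0 := integ n (fun x => prof n R0 (nrm n x))). set (v0 := Vol n (lev (nrm n) 1)).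
  assert (Hv0 : 0 < v0) by (apply gauge_Vol_pos; [assumption|apply nrm_gauge]).
  assert (HI0 : 0 < I0).
  { apply (integ_pos n _ orig).
    - apply (gauge_Cc n (nrm n) (nrm_gauge n) _ R0); [now apply cont_prof|]. intros t Ht. apply prof_out; [assumption|lra].
    - intros x. rewrite <- (prof_out n R0 HR0 (Rmax R0 (nrm n x)) (Rmax_l _ _)). apply prof_dec; [assumption|apply Rmax_r].
    - rewrite nrm_orig. now apply prof_0_pos. }
  assert (HV : forall r, within n M D r -> forall e, Rabs e * D <= / 2 ->
    Vol n (lev (gphi n M r e) 1) = v0 / I0 * vprof n R0 M r e).
  { intros r Hr e He. rewrite (vprof_eq n R0 HR0 M r D e Hr He).
    pose proof (gauge_profile n (gphi n M r e) (nrm n) (prof n R0) R0 Hn (gphi_gauge n M r D e Hr He) (nrm_gauge n)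
      (cont_prof n R0 HR0) (fun s t H => prof_dec n R0 HR0 s t (proj2 H)) HR0 (prof_out n R0 HR0)) as H.
    fold v0 I0 in H. unfold Rdiv. rewrite (Rmult_comm v0), Rmult_assoc, H. field. lra. }
  assert (Hk : 0 < v0 / I0) by now apply Rdiv_lt_0_compat.
  assert (Hpow : is_derive (fun e => (1 - C * e * e) ^ n) 0 0) by (auto_derive; [exact I|ring]).
  assert (HF : forall r s, is_derive (fun e => (1 - C * e * e) ^ n * vprof n R0 M r e - vprof n R0 M s e) 0
     (mean_width n M R0 r - mean_width n M R0 s)).
  { intros r s. apply (is_derive_minus (fun e => (1 - C * e * e) ^ n * vprof n R0 M r e) (vprof n R0 M s));
      [|now apply is_derive_vprof].
    replace (mean_width n M R0 r) with
      (0 * vprof n R0 M r 0 + (1 - C * 0 * 0) ^ n * mean_width n M R0 r).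
    - apply (is_derive_mult (fun e => (1 - C * e * e) ^ n) (vprof n R0 M r)); [exact Hpow|now apply is_derive_vprof|].
      intros; apply Rmult_comm.
    - rewrite !Rmult_0_r, Rminus_0_r, pow1. ring. }
  assert (HF0 : forall r s, (1 - C * 0 * 0) ^ n * vprof n R0 M r 0 - vprof n R0 M s 0 = 0).
  { intros r s. rewrite !Rmult_0_r, Rminus_0_r, pow1.
    assert (E : vprof n R0 M r 0 = vprof n R0 M s 0); [|lra].
    apply integ_ext; intros x. unfold gphi. now rewrite !Rmult_0_l. }
  destruct (derive_sign _ _ (HF q p) (HF0 q p)) as [e1 [He1 Hs1]]; [lra|].
  destruct (derive_sign (fun e => - ((1 - C * e * e) ^ n * vprof n R0 M p e - vprof n R0 M q e))
     (- (mean_width n M R0 p - mean_width n M R0 q)))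
     as [e2 [He2 Hs2]].
  { apply (is_derive_opp (fun e => (1 - C * e * e) ^ n * vprof n R0 M p e - vprof n R0 M q e)), HF. }
  { rewrite HF0. apply Ropp_0. } { lra. }
  exists (Rmin (Rmin e1 e2) (/ (2 * D))). split.
  { apply Rmin_pos; [now apply Rmin_pos|]. apply Rinv_0_lt_compat. lra. }
  intros e [He Hlt'].
  assert (Hm1 : e < e1) by (eapply Rlt_le_trans; [exact Hlt'|]; eapply Rle_trans; apply Rmin_l).
  assert (Hm2 : e < e2) by (eapply Rlt_le_trans; [exact Hlt'|]; eapply Rle_trans; [apply Rmin_l|apply Rmin_r]).
  assert (Hm3 : e * D <= / 2).
  { assert (e < / (2 * D)) by (eapply Rlt_le_trans; [exact Hlt'|apply Rmin_r]).
    apply (Rmult_lt_compat_r D) in H; [|assumption]. replace (/ (2 * D) * D) with (/ 2) in H by (field; lra). lra. }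
  assert (Hae : Rabs e = e) by (apply Rabs_pos_eq; lra).
  assert (Hae' : Rabs (- e) = e) by (rewrite Rabs_Ropp; exact Hae).
  rewrite (HV p HP e), (HV q HQ e), (HV q HQ (- e)), (HV p HP (- e)) by (rewrite ?Hae, ?Hae'; exact Hm3).
  split.
  - specialize (Hs1 e ltac:(lra) ltac:(lra)).
    apply (Rmult_lt_compat_r e) in Hs1; [|assumption]. unfold Rdiv in Hs1. rewrite Rmult_assoc, Rinv_l in Hs1 by lra.
    replace ((1 - C * e * e) ^ n * (v0 / I0 * vprof n R0 M q e)) with (v0 / I0 * ((1 - C * e * e) ^ n * vprof n R0 M q e)) by ring.
    apply Rmult_lt_compat_l; [assumption|]. lra.
  - specialize (Hs2 (- e) ltac:(lra) ltac:(lra)).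
    apply (Rmult_lt_compat_r e) in Hs2; [|assumption]. cbv beta in Hs2.
    replace (1 - C * - e * - e) with (1 - C * e * e) in Hs2 by ring.
    set (X := (1 - C * e * e) ^ n * vprof n R0 M p (- e) - vprof n R0 M q (- e)) in *.
    replace (- X / - e * e) with X in Hs2 by (field; lra).
    replace ((1 - C * e * e) ^ n * (v0 / I0 * vprof n R0 M p (- e))) with (v0 / I0 * ((1 - C * e * e) ^ n * vprof n R0 M p (- e))) by ring.
    apply Rmult_lt_compat_l; [assumption|]. unfold X in Hs2. lra.
Qed.

(** * Balls of large radius and the linearised distance *)

(** Expand [|x - a|^2 <= r^2] and use [2 * r * |x| <= |x|^2 + r^2]. *)
Lemma ball_outer n x a r : 0 < r -> edist n x a <= r -> nrm n x - / r * dot n a x <= r.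
Proof.
  intros Hr H. rewrite edist_nrm in H.
  assert (Hsq : nrm n (fun k => x k - a k) * nrm n (fun k => x k - a k) <= r * r).
  { pose proof (nrm_ge0 n (fun k => x k - a k)). apply Rmult_le_compat; lra. }
  rewrite nrm_sq, dot_minus_l, !dot_minus_r, (dot_comm n x a), <- (nrm_sq n x) in Hsq.
  pose proof (dot_self_ge0 n a). set (t := nrm n x) in *. set (y := dot n a x) in *.
  apply (Rmult_le_reg_l (2 * r)); [lra|].
  replace (2 * r * (t - / r * y)) with (2 * r * t - 2 * y) by (field; lra).
  pose proof (Rle_0_sqr (t - r)) as Hs. unfold Rsqr in Hs. lra.
Qed.

(** If [|x| <= r - D], the triangle inequality suffices. Otherwise [|x|] differs from [r] by at most
    [2 * D], and in the expansion of [|x - a|^2] the terms [(|x| - r)^2 <= 4 * D^2] and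
    [|a|^2 <= D^2] are paid by twice the margin [3 * D * D]. *)
Lemma ball_inner n x a r D : 0 < r -> nrm n a <= D -> 2 * D <= r ->
  nrm n x - / r * dot n a x <= r - 3 * D * D / r -> edist n x a <= r.
Proof.
  intros Hr HD HrD H.
  assert (HD0 : 0 <= D) by (pose proof (nrm_ge0 n a); lra).
  pose proof (dot_le_nrm n a x) as Hcs. apply Rabs_le_between in Hcs.
  pose proof (nrm_ge0 n x) as Ht0. pose proof (nrm_ge0 n a) as Ha0.
  set (t := nrm n x) in *. set (y := dot n a x) in *.
  assert (Hy : y <= D * t).
  { apply Rle_trans with (nrm n a * t); [lra|now apply Rmult_le_compat_r]. }
  apply (Rmult_le_compat_l r) in H; [|lra].
  replace (r * (t - / r * y)) with (r * t - y) in H by (field; lra).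
  replace (r * (r - 3 * D * D / r)) with (r * r - 3 * D * D) in H by (field; lra).
  assert (Hup : t <= r + 2 * D).
  { apply Rnot_lt_le. intros Hlt.
    pose proof (Rmult_le_pos D D HD0 HD0). pose proof (Rmult_le_pos r D (Rlt_le _ _ Hr) HD0).
    assert ((r + 2 * D) * (r - D) < t * (r - D)) by (apply Rmult_lt_compat_r; lra). lra. }
  rewrite edist_nrm. eapply Rle_trans; [apply Rle_abs|]. 
  destruct (Rle_dec t (r - D)) as [Hs|Hs].
  - rewrite Rabs_pos_eq by apply nrm_ge0.
    rewrite (nrm_ext n _ (fun k => x k + (-1) * a k)) by (intros; ring).
    eapply Rle_trans; [apply (nrm_triangle n x (fun k => (-1) * a k))|]. rewrite nrm_scal, Rabs_m1. fold t. lra.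
  - apply Rabs_le_of_sqr; [lra|]. rewrite nrm_sq, dot_minus_l, !dot_minus_r, (dot_comm n x a).
    fold y. rewrite <- (nrm_sq n x), <- (nrm_sq n a). fold t.
    assert (nrm n a * nrm n a <= D * D) by (apply Rmult_le_compat; lra).
    pose proof (Rmult_le_pos (2 * D - (t - r)) (2 * D + (t - r)) ltac:(lra) ltac:(lra)).
    pose proof (Rmult_le_pos D D HD0 HD0). lra.
Qed.

(** The union for [p] lies in the [r]-dilate of its gauge ball, and the union for [q] contains the
    dilate of its own by [s = r * (1 - C / r^2)]; the loss [(s / r) ^ n] is the factor allowed in
    the comparison of gauges. Intersections work alike with [p] and [q] exchanged. *)
Lemma large_radius_strict n M p q i1 i2 : (1 <= n)%nat ->
  (forall i j, (i < S M)%nat -> (j < S M)%nat -> sqdist n (p i) (p j) <= sqdist n (q i) (q j)) ->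
  (i1 < S M)%nat -> (i2 < S M)%nat -> sqdist n (p i1) (p i2) < sqdist n (q i1) (q i2) ->
  exists r0, 0 < r0 /\ forall r, r0 <= r ->
    Vol n (union_balls n (S M) p r) < Vol n (union_balls n (S M) q r) /\
    Vol n (inter_balls n (S M) q r) < Vol n (inter_balls n (S M) p r).
Proof.
  intros Hn Hpq H1 H2 H12.
  destruct (bound_points n M p) as [Dp [HDp HDpi]]. destruct (bound_points n M q) as [Dq [HDq HDqi]].
  set (D := Dp + Dq + 1).
  assert (HP : within n M D p) by (intros i Hi; specialize (HDpi i Hi); unfold D; lra).
  assert (HQ : within n M D q) by (intros i Hi; specialize (HDqi i Hi); unfold D; lra).
  assert (HDpos : 1 <= D) by (unfold D; lra).
  set (C := 3 * D * D).
  assert (HC : 0 < C) by (unfold C; nra).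
  destruct (gphi_volume_compare n M p q i1 i2 C Hn Hpq H1 H2 H12) as [e1 [He1 Hc1]].
  (* The largest distance to the points involves the minimum of [<p i, x>], which is minus the
     maximum for the points [- p i]; hence the negated points and the parameter [- / r]. *)
  set (np := fun i k => (-1) * p i k). set (nq := fun i k => (-1) * q i k).
  assert (Hneg : forall a b : point, sqdist n (fun k => (-1) * a k) (fun k => (-1) * b k) = sqdist n a b).
  { intros a b. rewrite !sqdist_dot. apply rsum_ext; intros; ring. }
  destruct (gphi_volume_compare n M np nq i1 i2 C Hn) as [e2 [He2 Hc2]]; try assumption.
  { intros i j Hi Hj. unfold np, nq. rewrite !Hneg. auto. }
  { unfold np, nq. rewrite !Hneg. assumption. }
  (* [2 * D] makes [gphi] a gauge and serves [ball_inner], [C] helps to make [s] positive, and the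
     last two terms bring [/ r] below [e1] and [e2]. *)
  exists (2 * D + C + 2 / e1 + 2 / e2).
  assert (Hie1 : 0 < / e1) by now apply Rinv_0_lt_compat. assert (Hie2 : 0 < / e2) by now apply Rinv_0_lt_compat.
  split; [unfold Rdiv; lra|]. intros r Hr. unfold Rdiv in Hr.
  assert (Hrp : 0 < r) by lra. assert (Hr2D : 2 * D <= r) by lra.
  set (e := / r). assert (He : 0 < e) by now apply Rinv_0_lt_compat.
  assert (Hee : forall u, 0 < u -> 2 * / u <= r -> e < u).
  { intros u Hu Hur. unfold e. rewrite <- (Rinv_inv u). apply Rinv_lt_contravar; [|].
    - apply Rmult_lt_0_compat; [now apply Rinv_0_lt_compat|assumption].
    - assert (0 < / u) by now apply Rinv_0_lt_compat. lra. }
  destruct (Hc1 e ltac:(split; [assumption|apply Hee; lra])) as [Hun _].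
  destruct (Hc2 e ltac:(split; [assumption|apply Hee; lra])) as [_ Hin].
  set (s := r * (1 - C * e * e)).
  assert (Hs : s = r - 3 * D * D / r) by (unfold s, e, C; field; lra).
  assert (Hspos : 0 < s).
  { rewrite Hs. fold C. apply (Rmult_lt_reg_r r); [assumption|].
    replace ((r - C / r) * r) with (r * r - C) by (field; lra). nra. }
  assert (Hrn : 0 < r ^ n) by now apply pow_lt. assert (Hsn : 0 < s ^ n) by now apply pow_lt.
  assert (Hcomb : forall A B V W, A <= r ^ n * V -> V < (1 - C * e * e) ^ n * W -> W <= (/ s) ^ n * B -> A < B).
  { intros A B V W HA HVW HW. apply Rle_lt_trans with (1 := HA).
    apply Rlt_le_trans with (r ^ n * ((1 - C * e * e) ^ n * W)); [now apply Rmult_lt_compat_l|].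
    rewrite <- Rmult_assoc, <- Rpow_mult_distr. fold s.
    apply (Rmult_le_compat_l (s ^ n)) in HW; [|lra]. rewrite <- Rmult_assoc, <- Rpow_mult_distr, Rinv_r, pow1, Rmult_1_l in HW by lra.
    exact HW. }
  assert (Habs : Rabs e * D <= / 2).
  { rewrite Rabs_pos_eq by lra. unfold e. apply (Rmult_le_reg_l r); [assumption|].
    rewrite <- Rmult_assoc, Rinv_r by lra. lra. }
  assert (HnP : within n M D np) by (intros i Hi; unfold np; rewrite nrm_scal, Rabs_m1, Rmult_1_l; auto).
  assert (HnQ : within n M D nq) by (intros i Hi; unfold nq; rewrite nrm_scal, Rabs_m1, Rmult_1_l; auto).
  assert (Habs' : Rabs (- e) * D <= / 2) by (rewrite Rabs_Ropp; exact Habs).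
  assert (Hdotneg : forall a x, dot n (fun k => (-1) * a k) x = - dot n a x) by (intros; rewrite dot_scal_l; ring).
  assert (Hbd : forall a, within n M D a -> bdd n (union_balls n (S M) a r)).
  { intros a Ha. exists (r + D). intros x [i [Hi Hx]] k Hk.
    eapply Rle_trans; [apply (coord_le_edist n x (a i) D k); [apply Ha; lia|assumption]|]. unfold ball in Hx. lra. }
  split.
  - apply (Hcomb _ _ _ _) with (2 := Hun).
    + apply Vol_scale_le; [assumption|apply gauge_bdd; now apply (gphi_gauge n M p D)|assumption|].
      intros x [i [Hi Hx]]. unfold lev. rewrite (gauge_hom n _ (gphi_gauge n M p D e HP Habs)) by assumption.
      pose proof (ball_outer n x (p i) r Hrp Hx) as Hb. fold e in Hb |- *.
      assert (Hh : dot n (p i) x <= hmax n M p x) by (apply (fmax_ge M (fun i => dot n (p i) x)); lia).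
      apply (Rmult_le_reg_l r); [assumption|]. unfold e at 1. rewrite <- Rmult_assoc, Rinv_r by lra.
      unfold gphi. assert (e * dot n (p i) x <= e * hmax n M p x) by (apply Rmult_le_compat_l; lra). lra.
    + apply Vol_scale_le; [assumption|now apply Hbd|now apply Rinv_0_lt_compat|].
      intros x Hx. rewrite Rinv_inv. unfold lev in Hx.
      apply (Rmult_le_compat_l s) in Hx; [|lra]. rewrite <- (gauge_hom n _ (gphi_gauge n M q D e HQ Habs)) in Hx by assumption.
      set (y := fun k => s * x k) in *. unfold gphi, hmax in Hx.
      destruct (fmax_ex M (fun i => dot n (q i) y)) as [i [Hi E]]. rewrite E in Hx.
      exists i. split; [lia|]. apply (ball_inner n y (q i) r D); auto. fold e. rewrite <- Hs. lra.
  - apply (Hcomb _ _ _ _) with (2 := Hin).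
    + apply Vol_scale_le; [assumption|apply gauge_bdd; now apply (gphi_gauge n M nq D)|assumption|].
      intros x Hx. unfold lev. rewrite (gauge_hom n _ (gphi_gauge n M nq D (- e) HnQ Habs')) by assumption.
      apply (Rmult_le_reg_l r); [assumption|]. fold e. unfold e at 1. rewrite <- Rmult_assoc, Rinv_r by lra.
      unfold gphi, hmax. destruct (fmax_ex M (fun i => dot n (nq i) x)) as [i [Hi E]]. rewrite E.
      unfold nq. rewrite Hdotneg. pose proof (ball_outer n x (q i) r Hrp (Hx i ltac:(lia))) as Hb. fold e in Hb. lra.
    + apply Vol_scale_le; [assumption| |now apply Rinv_0_lt_compat|].
      * apply (bdd_mono n (union_balls n (S M) p r)); [|now apply Hbd].
        intros x Hx. exists O. split; [lia|apply Hx; lia].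
      * intros x Hx. rewrite Rinv_inv. unfold lev in Hx.
        apply (Rmult_le_compat_l s) in Hx; [|lra]. rewrite <- (gauge_hom n _ (gphi_gauge n M np D (- e) HnP Habs')) in Hx by assumption.
        set (y := fun k => s * x k) in *. unfold gphi in Hx.
        intros i Hi. apply (ball_inner n y (p i) r D); auto; [apply HP; lia|]. fold e. rewrite <- Hs.
        assert (Hh : dot n (np i) y <= hmax n M np y) by (apply (fmax_ge M (fun i => dot n (np i) y)); lia).
        unfold np at 1 in Hh. rewrite Hdotneg in Hh.
        assert (e * - dot n (p i) y <= e * hmax n M np y) by (apply Rmult_le_compat_l; lra). lra.
Qed.

(** * Expanding and congruent configurations *)

Theorem theorem1 (n N : nat) (p q : nat -> point)
  (hn : (1 <= n)%nat) (hN : (1 <= N)%nat)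
  (hpq : forall i j, (i < j)%nat -> (j < N)%nat ->
           edist n (p i) (p j) <= edist n (q i) (q j)) :
  exists r0 : R, 0 < r0 /\
    forall r : R, r0 <= r ->
      Vol n (union_balls n N p r) <= Vol n (union_balls n N q r) /\
      Vol n (inter_balls n N p r) >= Vol n (inter_balls n N q r) /\
      (~ congruent n N p q ->
        Vol n (union_balls n N p r) < Vol n (union_balls n N q r) /\
        Vol n (inter_balls n N p r) > Vol n (inter_balls n N q r)).
Proof.
  destruct N as [|M]; [lia|].
  assert (hall : forall i j, (i < S M)%nat -> (j < S M)%nat -> edist n (p i) (p j) <= edist n (q i) (q j)).
  { intros i j Hi Hj. destruct (Nat.lt_trichotomy i j) as [H|[->|H]].
    - now apply hpq.
    - assert (E : forall x, edist n x x = 0).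
      { intros x. unfold edist. replace (sqdist n x x) with 0; [apply sqrt_0|].
        rewrite sqdist_dot. unfold dot. rewrite (rsum_ext n _ (fun _ => 0)) by (intros; ring). now rewrite rsum_0. }
      rewrite !E. lra.
    - rewrite (edist_sym n (p i)), (edist_sym n (q i)). now apply hpq. }
  (* One strictly longer distance gives strict inequalities for all large [r]. Otherwise all
     distances agree, the volumes are equal and the configurations are congruent, so the strict
     claim holds vacuously. *)
  destruct (classic (exists i j, (i < S M)%nat /\ (j < S M)%nat /\ edist n (p i) (p j) < edist n (q i) (q j)))
    as [[i1 [i2 [H1 [H2 H12]]]]|Hno].
  - destruct (large_radius_strict n M p q i1 i2 hn) as [r0 [Hr0 Hr]]; try assumption.
    + intros i j Hi Hj. apply sqrt_le_0; [rewrite sqdist_dot; apply dot_self_ge0|rewrite sqdist_dot; apply dot_self_ge0|].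
      now apply hall.
    + apply sqrt_lt_0; [rewrite sqdist_dot; apply dot_self_ge0|rewrite sqdist_dot; apply dot_self_ge0|assumption].
    + exists r0. split; [assumption|]. intros r Hrr. destruct (Hr r Hrr) as [A B].
      split; [lra|]. split; [lra|]. intros _. split; lra.
  - assert (Heq : forall i j, (i < S M)%nat -> (j < S M)%nat -> edist n (p i) (p j) = edist n (q i) (q j)).
    { intros i j Hi Hj. apply Rle_antisym; [now apply hall|]. apply Rnot_lt_le. intros Hlt. apply Hno. eauto. }
    destruct (bound_points n M p) as [Dp [HDp HDpi]]. destruct (bound_points n M q) as [Dq [HDq HDqi]].
    (* [Dp + Dq] bounds the norms of all points, and the dilation argument for equal volumes takes
       radii beyond that bound. *)
    exists (Dp + Dq + 1). split; [lra|]. intros r Hr.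
    destruct (equal_dist_Vol n M p q (Dp + Dq) r hn) as [A [B Cg]]; try assumption; try lra.
    + intros i Hi. specialize (HDpi i Hi). lra.
    + intros i Hi. specialize (HDqi i Hi). lra.
    + rewrite A, B. split; [lra|]. split; [lra|]. intros Hnc. contradiction.
Qed.
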